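(* Let $n$ take values only in an infinite set of odd square-free integers greater than $1$ such that \[ \frac{(\log n)^7}{p_n}\to 0 \quad\text{as } n\to\infty, \] where $p_n$ is the smallest prime factor of $n$, and let $r$ be real. Let $J(z)=\sum_{j=1}^{n-1}\left(\frac{j}{n}\right)z^j$ be the character polynomial of degree $n-1$ and define \[ V(z)=\sum_{\substack{0\le j\le n-1\\ \gcd(j,n)>1}}\left(\frac{j}{n/\gcd(j,n)}\right) z^j. \] Then \[ \lim_{n\to\infty}F(J_r+V_r)=f(r). \]
   Context: For real $\alpha\ge1$ and $A\in\mathbb{C}[z]$, $\|A\|_\alpha=\left(\frac{1}{2\pi}\int_0^{2\pi}|A(e^{i\theta})|^\alpha d\theta\right)^{1/\alpha}$. The merit factor of $A$ is $F(A)=\frac{\|A\|_2^4}{\|A\|_4^4-\|A\|_2^4}$. For a polynomial $A$ of degree at most $n-1$ and real $r$, the rotation is $A_r(z)=z^{-\lfloor nr\rfloor}A(z)\bmod (z^n-1)$. $\left(\frac{\cdot}{m}\right)$ denotes the Jacobi symbol modulo an odd positive integer $m$ (with $\left(\frac{\cdot}{1}\right)\equiv 1$). The function $f$ is $1$-periodic with $f(r)=\dfrac{1}{\frac16+8\left(|r|-\frac14\right)^2}$ for $-\frac12<r\le\frac12$. *)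

(* Defs.v *)
From Stdlib Require Import Reals ZArith.
From Coquelicot Require Import Coquelicot.
From mathcomp Require Import ssreflect ssrfun ssrbool eqtype ssrnat seq div prime.

Definition legendre (a p : nat) : R :=
  if (p %| a)%N then 0%R
  else if has (fun x => (x * x %% p == a %% p)%N) (iota 0 p) then 1%R else (-1)%R.

Definition jacobi (a m : nat) : R :=
  foldr (fun p acc => (legendre a p ^ logn p m * acc)%R) 1%R (primes m).

Definition squarefree (n : nat) : Prop :=
  forall p : nat, prime p -> ~ (p * p %| n)%N.

Definition smallest_prime_factor (n : nat) : nat := pdiv n.

(* A polynomial of degree at most n-1 is given by its coefficients a 0 .. a (n-1). *)
Fixpoint sumR (n : nat) (f : nat -> R) : R :=
  match n with
  | O => 0%R
  | S k => (sumR k f + f k)%R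
  end.

Definition floorZ (x : R) : Z := Int_part x.

(* rotation A_r(z) = z^{-floor(n r)} A(z) mod (z^n - 1):
   the coefficient of z^j (0 <= j < n) is a_{(j + floor(n r)) mod n}. *)
Definition rotate (n : nat) (a : nat -> R) (r : R) : nat -> R :=
  fun j => if (j < n)%N then
             a (Z.to_nat (Z.modulo (Z.of_nat j + floorZ (INR n * r)) (Z.of_nat n)))
           else 0%R.

Definition poly_re (n : nat) (a : nat -> R) (t : R) : R :=
  sumR n (fun j => a j * cos (INR j * t))%R.
Definition poly_im (n : nat) (a : nat -> R) (t : R) : R :=
  sumR n (fun j => a j * sin (INR j * t))%R.

Definition poly_abs (n : nat) (a : nat -> R) (t : R) : R :=
  sqrt (poly_re n a t ^ 2 + poly_im n a t ^ 2).

Definition normpow (n : nat) (a : nat -> R) (k : nat) : R :=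
  (/ (2 * PI) * RInt (fun t => poly_abs n a t ^ k) 0 (2 * PI))%R.

Definition merit_factor (n : nat) (a : nat -> R) : R :=
  (normpow n a 2 ^ 2 / (normpow n a 4 - normpow n a 2 ^ 2))%R.

Definition Jpoly (n : nat) : nat -> R :=
  fun j => if (1 <= j)%N && (j < n)%N then jacobi j n else 0%R.

Definition Vpoly (n : nat) : nat -> R :=
  fun j => if (j < n)%N && (1 < gcdn j n)%N then jacobi j (n %/ gcdn j n) else 0%R.

Definition addpoly (a b : nat -> R) : nat -> R := fun j => (a j + b j)%R.

Definition f_base (x : R) : R := (/ (/ 6 + 8 * (Rabs x - / 4) ^ 2))%R.

(* f is 1-periodic and equals f_base on (-1/2, 1/2]:
   r - k lies in (-1/2,1/2] for k = -floor(1/2 - r). *)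
Definition f_lim (r : R) : R :=
  f_base (r + IZR (floorZ (/ 2 - r)))%R.

(* Main.v *)
Require Import Defs.
From Stdlib Require Import Reals ZArith.
From Coquelicot Require Import Coquelicot.
From Stdlib Require Import Lra Lia.
From mathcomp Require all_boot all_order all_algebra complex Rstruct zify ring lra.

(* The coefficients of J + V form the n-periodic sequence a_j = prod_{p | n} x_p(j), where x_p(j) is
   the Legendre symbol of j modulo p, or 1 when p divides j.  Since |A|^4 is a trigonometric
   polynomial of degree below 2n, the fourth norm is the mean of |A|^4 over the 2n-th roots of unity.
   At the even roots A is, up to a phase, sqrt n X(l), where X is the normalised discrete Fourier
   transform of a; at the odd roots it is sqrt n sum_m c_m X(l + m) with an explicit kernel c_m of
   size 1 / |2m + 1|.

   Gauss sums and the Chinese remainder theorem give X = gamma chi_n + small with |gamma| = 1, and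
   |a_j| = 1 makes the translates of X exactly orthonormal.  Orthonormality disposes of the terms
   |m| >= p / 2 of the sum (p the least prime factor of n): they are small in mean square and
   O(log n) pointwise.  The remaining m are distinct modulo p, so their fourth-order correlations
   are governed by the sums over F_p of chi((x+a)(x+b)(x+c)(x+d)), for which Davenport's p^(3/4) is
   enough; it follows from the fourth moment of character sums over all cubics.  Only the three
   pairings survive, giving 2 (sum |c|^2)^2 + |sum c^2|^2 - 2 sum |c|^4, which is evaluated in closed
   form and tends to 4/3 + (1 - 4|r|)^2. *)

(** * Means of trigonometric polynomials *)

(** The obstacle is that different shifts m may agree modulo p, and then the factor at p of a
    fourth-order correlation no longer cancels; cancellation is extracted from the least prime only,
    the other primes being bounded trivially. Cutting the sum at |m| about p / 2 removes such
    collisions and has a second effect: inside the cut the kernel has total weight O(log p), not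
    O(log n), so the relative saving p^(-1/4) has to beat only (log p)^4. Outside the cut the kernel
    has mean square O(1 / p), which costs (log n)^3 p^(-1/2) in the fourth moment. Replacing X by
    gamma chi_n costs omega(n) p^(-1/2) times (log p)^4, where omega(n) <= log n counts the primes.
    The growth hypothesis makes all these errors vanish. The shape of f comes from averaging the two
    families of nodes: the even ones contribute 1, because |X| is nearly 1, the odd ones 4/3 + (1 -
    4|r|)^2, and half of the total, less 1, is 1/6 + 8 (|r| - 1/4)^2. *)

Module TrigonometricMeans.
Local Open Scope R_scope.

Lemma sumR_ext n f g : (forall j, (j < n)%nat -> f j = g j) -> sumR n f = sumR n g.
Proof.
  induction n as [|n IH]; intros H; simpl; [easy|].
  rewrite IH, H; [easy|lia|]. intros j Hj; apply H; lia.
Qed.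

Lemma sumR_plus n f g : sumR n (fun j => f j + g j) = sumR n f + sumR n g.
Proof. induction n as [|n IH]; simpl; [ring|rewrite IH; ring]. Qed.

Lemma sumR_scal n c f : sumR n (fun j => c * f j) = c * sumR n f.
Proof. induction n as [|n IH]; simpl; [ring|rewrite IH; ring]. Qed.

Lemma sumR_mult n m f g :
  sumR n f * sumR m g = sumR n (fun j => sumR m (fun k => f j * g k)).
Proof.
  induction n as [|n IH]; simpl; [ring|].
  rewrite Rmult_plus_distr_r, IH, sumR_scal. easy.
Qed.

Lemma sumR_zero n : sumR n (fun _ => 0) = 0.
Proof. induction n as [|n IH]; simpl; [easy|rewrite IH; ring]. Qed.

(* [trig_mean N f v]: [f] is a real trigonometric polynomial with frequencies below [N] and
   constant term [v]. *)
Inductive trig_mean (N : Z) : (R -> R) -> R -> Prop :=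
| tm_zero : trig_mean N (fun _ => 0) 0
| tm_cos q : (Z.abs q < N)%Z ->
    trig_mean N (fun t => cos (IZR q * t)) (if Z.eqb q 0 then 1 else 0)
| tm_scal c f v : trig_mean N f v -> trig_mean N (fun t => c * f t) (c * v)
| tm_plus f g v w : trig_mean N f v -> trig_mean N g w ->
    trig_mean N (fun t => f t + g t) (v + w)
| tm_ext f g v : (forall t, f t = g t) -> trig_mean N f v -> trig_mean N g v.

Lemma trig_mean_sum N n F V : (forall j, (j < n)%nat -> trig_mean N (F j) (V j)) ->
  trig_mean N (fun t => sumR n (fun j => F j t)) (sumR n V).
Proof.
  induction n as [|n IH]; intros H; simpl; [apply tm_zero|].
  apply tm_plus; [apply IH; intros j Hj; apply H; lia|apply H; lia].
Qed.

(** Product-to-sum formulas, by induction on both factors. Only the existence of a constant term is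
    claimed: [normpow_4] reads the same unknown [u] off the integral and off the nodes, so it never
    has to be computed. *)
Lemma trig_mean_mult N M f g v w : trig_mean N f v -> trig_mean M g w ->
  exists u, trig_mean (N + M) (fun t => f t * g t) u.
Proof.
  intros Hf Hg; revert f v Hf.
  induction Hg as [|q Hq|c g w Hg IH|g1 g2 w1 w2 Hg1 IH1 Hg2 IH2|g1 g2 w E Hg IH]; intros f v Hf.
  - exists 0; apply (tm_ext _ (fun _ => 0)); [intros; ring|apply tm_zero].
  - induction Hf as [|p Hp|c f v Hf IH|f1 f2 v1 v2 Hf1 IH1 Hf2 IH2|f1 f2 v E Hf IH].
    + exists 0; apply (tm_ext _ (fun _ => 0)); [intros; ring|apply tm_zero].
    + eexists.
      apply (tm_ext _ (fun t => / 2 * cos (IZR (p + q) * t) + / 2 * cos (IZR (p - q) * t))).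
      * intros t; rewrite plus_IZR, minus_IZR.
        replace ((IZR p + IZR q) * t) with (IZR p * t + IZR q * t) by ring.
        replace ((IZR p - IZR q) * t) with (IZR p * t - IZR q * t) by ring.
        rewrite cos_plus, cos_minus; field.
      * apply tm_plus; apply tm_scal; apply tm_cos; lia.
    + destruct IH as [u Hu]; exists (c * u).
      apply (tm_ext _ (fun t => c * (f t * cos (IZR q * t)))); [intros; ring|].
      now apply tm_scal.
    + destruct IH1 as [u1 Hu1], IH2 as [u2 Hu2]; exists (u1 + u2).
      apply (tm_ext _ (fun t => f1 t * cos (IZR q * t) + f2 t * cos (IZR q * t)));
        [intros; ring|].
      now apply tm_plus.
    + destruct IH as [u Hu]; exists u.
      apply (tm_ext _ (fun t => f1 t * cos (IZR q * t))); [intros; now rewrite E|easy].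
  - destruct (IH f v Hf) as [u Hu]; exists (c * u).
    apply (tm_ext _ (fun t => c * (f t * g t))); [intros; ring|now apply tm_scal].
  - destruct (IH1 f v Hf) as [u1 Hu1], (IH2 f v Hf) as [u2 Hu2]; exists (u1 + u2).
    apply (tm_ext _ (fun t => f t * g1 t + f t * g2 t)); [intros; ring|now apply tm_plus].
  - destruct (IH f v Hf) as [u Hu]; exists u.
    apply (tm_ext _ (fun t => f t * g1 t)); [intros; now rewrite E|easy].
Qed.

Lemma sin_IZR_2PI q : sin (IZR q * (2 * PI)) = 0.
Proof.
  apply sin_eq_0_1; exists (2 * q)%Z; rewrite mult_IZR; ring.
Qed.

Lemma cos_IZR_2PI q : cos (IZR q * (2 * PI)) = 1.
Proof.
  replace (IZR q * (2 * PI)) with (2 * (IZR q * PI)) by ring.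
  rewrite cos_2a_sin.
  assert (E : sin (IZR q * PI) = 0) by (apply sin_eq_0_1; now exists q).
  rewrite E; ring.
Qed.

Lemma trig_mean_integral N f v : trig_mean N f v -> is_RInt f 0 (2 * PI) (2 * PI * v).
Proof.
  intros H; induction H as [|q Hq|c f v Hf IH|f1 f2 v1 v2 Hf1 IH1 Hf2 IH2|f1 f2 v E Hf IH].
  - replace (2 * PI * 0) with (scal (2 * PI - 0) 0)
      by (unfold scal; simpl; unfold mult; simpl; ring).
    apply (is_RInt_const 0 (2 * PI) 0).
  - destruct (Z.eqb_spec q 0) as [->|Hq0].
    + apply (is_RInt_ext (fun _ => 1)).
      * intros x _; now rewrite Rmult_0_l, cos_0.
      * replace (2 * PI * 1) with (scal (2 * PI - 0) 1)
          by (unfold scal; simpl; unfold mult; simpl; ring).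
        apply (is_RInt_const 0 (2 * PI) 1).
    + assert (Hq1 : IZR q <> 0) by (now apply not_0_IZR).
      replace (2 * PI * 0) with
        (minus (sin (IZR q * (2 * PI)) / IZR q) (sin (IZR q * 0) / IZR q)).
      * apply (is_RInt_derive (fun t => sin (IZR q * t) / IZR q)).
        -- intros x _; auto_derive; [easy|field; easy].
        -- intros x _; apply continuity_pt_filterlim.
           apply (continuity_pt_comp (fun t => IZR q * t) cos); [|apply continuity_cos].
           apply derivable_continuous_pt, derivable_pt_mult;
             [apply derivable_pt_const|apply derivable_pt_id].
      * rewrite sin_IZR_2PI, Rmult_0_r, sin_0; unfold minus, plus, opp; simpl; field; easy.
  - replace (2 * PI * (c * v)) with (scal c (2 * PI * v))
      by (unfold scal; simpl; unfold mult; simpl; ring).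
    now apply (is_RInt_scal f).
  - replace (2 * PI * (v1 + v2)) with (plus (2 * PI * v1) (2 * PI * v2))
      by (unfold plus; simpl; ring).
    now apply (is_RInt_plus f1 f2).
  - apply (is_RInt_ext f1); [intros; apply E|easy].
Qed.

(** The nodes are arguments of 2n-th roots of unity, taken clockwise to match a transform at the
    inverse root: with z = exp(i PI / n) and w = z^2 they belong to w^(-l) here and to z w^(-l) in
    [odd_node]. *)
Definition even_node (n l : nat) : R := - (2 * PI * INR l / INR n).
Definition odd_node (n l : nat) : R := PI / INR n - 2 * PI * INR l / INR n.

(** Multiplying by [2 * sin (x / 2)] makes the sum telescope; the last two hypotheses say that the
    progression closes up after [n] steps. *)
Lemma sum_cos_progression n b x : sin (x / 2) <> 0 -> cos (b - INR n * x) = cos b ->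
  sin (b - INR n * x) = sin b -> sumR n (fun l => cos (b - INR l * x)) = 0.
Proof.
  intros Hs Hc Hsn.
  assert (T : forall k, 2 * sin (x / 2) * sumR k (fun l => cos (b - INR l * x))
            = sin (b + x / 2) - sin (b - INR k * x + x / 2)).
  { induction k as [|k IH].
    - simpl; rewrite Rmult_0_l, Rminus_0_r; ring.
    - cbn [sumR]; rewrite Rmult_plus_distr_l, IH.
      replace (b - INR (S k) * x + x / 2) with ((b - INR k * x) - x / 2)
        by (rewrite S_INR; field).
      rewrite (sin_plus (b - INR k * x)), (sin_minus (b - INR k * x)); ring. }
  specialize (T n); rewrite !sin_plus, Hc, Hsn in T.
  assert (Z0 : 2 * sin (x / 2) * sumR n (fun l => cos (b - INR l * x)) = 0) by (rewrite T; ring).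
  destruct (Rmult_integral _ _ Z0) as [H|H]; [|easy].
  exfalso; apply Hs; lra.
Qed.

Lemma trig_mean_nodes n f v : (0 < n)%nat -> trig_mean (2 * Z.of_nat n) f v ->
  sumR n (fun l => f (even_node n l) + f (odd_node n l)) = 2 * INR n * v.
Proof.
  intros Hn H.
  assert (Hn0 : INR n <> 0) by (apply not_0_INR; lia).
  induction H as [|q Hq|c f v Hf IH|f1 f2 v1 v2 Hf1 IH1 Hf2 IH2|f1 f2 v E Hf IH].
  - rewrite (sumR_ext _ _ (fun _ => 0)), sumR_zero; [ring|intros; ring].
  - destruct (Z.eqb_spec q 0) as [->|Hq0].
    + rewrite (sumR_ext _ _ (fun _ => 2)); [|intros; rewrite !Rmult_0_l, cos_0; ring].
      clear; induction n as [|n IH]; [simpl; ring|].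
      cbn [sumR]; rewrite IH, S_INR; ring.
    + rewrite Rmult_0_r.
      (* At frequency n or -n the two families must cancel each other: the cosine is constantly 1 on
         the even nodes and -1 on the odd ones. At any other nonzero frequency below 2n, q is not a
         multiple of n and each family sums to zero by itself. *)
      destruct (Z.eq_dec (Z.abs q) (Z.of_nat n)) as [Eq|Nq].
      * rewrite (sumR_ext _ _ (fun _ => 0)); [apply sumR_zero|intros l Hl].
        unfold even_node, odd_node.
        assert (D : q = Z.of_nat n \/ q = (- Z.of_nat n)%Z) by lia.
        assert (Ec : cos (IZR q * - (2 * PI * INR l / INR n)) = 1).
        { rewrite <- (cos_IZR_2PI (Z.of_nat l)), <- INR_IZR_INZ.
          destruct D as [-> | ->]; rewrite ?opp_IZR, <- INR_IZR_INZ.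
          - rewrite <- cos_neg; f_equal; field; easy.
          - f_equal; field; easy. }
        assert (Es : sin (IZR q * - (2 * PI * INR l / INR n)) = 0).
        { destruct D as [-> | ->]; rewrite ?opp_IZR, <- INR_IZR_INZ.
          - rewrite <- (sin_IZR_2PI (- Z.of_nat l)), opp_IZR, <- INR_IZR_INZ; f_equal; field; easy.
          - rewrite <- (sin_IZR_2PI (Z.of_nat l)), <- INR_IZR_INZ; f_equal; field; easy. }
        replace (IZR q * (PI / INR n - 2 * PI * INR l / INR n))
          with (IZR q * (PI / INR n) + IZR q * - (2 * PI * INR l / INR n)) by ring.
        rewrite cos_plus, Ec, Es.
        assert (Ep : cos (IZR q * (PI / INR n)) = -1).
        { rewrite <- cos_PI; destruct D as [-> | ->]; rewrite ?opp_IZR, <- INR_IZR_INZ.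
          - f_equal; field; easy.
          - rewrite <- (cos_neg PI); f_equal; field; easy. }
        rewrite Ep; ring.
      * set (x := IZR q * (2 * PI / INR n)).
        assert (Hs : sin (x / 2) <> 0).
        { intros H; apply sin_eq_0_0 in H as [k Hk].
          assert (E : IZR q = IZR (k * Z.of_nat n)).
          { rewrite mult_IZR, <- INR_IZR_INZ.
            apply (Rmult_eq_reg_r (PI / INR n));
              [|apply Rmult_integral_contrapositive_currified;
                [apply PI_neq0|now apply Rinv_neq_0_compat]].
            transitivity (x / 2); [unfold x; field; easy|rewrite Hk; field; easy]. }
          apply eq_IZR in E; subst q.
          destruct (Z.eq_dec k 0) as [->|]; [lia|].
          destruct (Z.eq_dec k 1) as [->|]; [lia|].
          destruct (Z.eq_dec k (-1)) as [->|]; [lia|]. nia. }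
        assert (Hx : INR n * x = IZR q * (2 * PI)) by (unfold x; field; easy).
        assert (P : forall b, sumR n (fun l => cos (b - INR l * x)) = 0).
        { intros b; apply sum_cos_progression; [easy| |].
          - rewrite Hx, cos_minus, cos_IZR_2PI, sin_IZR_2PI; ring.
          - rewrite Hx, sin_minus, cos_IZR_2PI, sin_IZR_2PI; ring. }
        rewrite sumR_plus.
        rewrite (sumR_ext _ _ (fun l => cos (0 - INR l * x)));
          [rewrite P|intros; unfold even_node, x; f_equal; field; easy].
        rewrite (sumR_ext _ _ (fun l => cos (IZR q * (PI / INR n) - INR l * x)));
          [rewrite P; ring|intros; unfold odd_node, x; f_equal; field; easy].
  - rewrite (sumR_ext _ _ (fun l => c * (f (even_node n l) + f (odd_node n l))));
      [rewrite sumR_scal, IH; ring|intros; ring].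
  - rewrite (sumR_ext _ _ (fun l => (f1 (even_node n l) + f1 (odd_node n l))
      + (f2 (even_node n l) + f2 (odd_node n l))));
      [rewrite sumR_plus, IH1, IH2; ring|intros; ring].
  - rewrite <- IH; apply sumR_ext; intros; now rewrite !E.
Qed.

Lemma poly_abs_sqr n a t : poly_abs n a t ^ 2 = poly_re n a t ^ 2 + poly_im n a t ^ 2.
Proof.
  unfold poly_abs; rewrite pow2_sqrt; [easy|].
  apply Rplus_le_le_0_compat; apply pow2_ge_0.
Qed.

Lemma poly_abs_sqr_trig_mean n a :
  trig_mean (Z.of_nat n) (fun t => poly_abs n a t ^ 2) (sumR n (fun j => a j ^ 2)).
Proof.
  apply (tm_ext _ (fun t => sumR n (fun j => sumR n (fun k =>
    a j * a k * cos (IZR (Z.of_nat j - Z.of_nat k) * t))))).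
  - intros t; rewrite poly_abs_sqr; unfold poly_re, poly_im; simpl; rewrite !Rmult_1_r, !sumR_mult.
    rewrite <- sumR_plus; apply sumR_ext; intros j _.
    rewrite <- sumR_plus; apply sumR_ext; intros k _.
    rewrite minus_IZR, <- !INR_IZR_INZ.
    replace ((INR j - INR k) * t) with (INR j * t - INR k * t) by ring.
    rewrite cos_minus; ring.
  - replace (sumR n (fun j => a j ^ 2)) with (sumR n (fun j => sumR n (fun k =>
      a j * a k * (if Z.eqb (Z.of_nat j - Z.of_nat k) 0 then 1 else 0)))).
    + apply trig_mean_sum; intros j Hj; apply trig_mean_sum; intros k Hk.
      apply tm_scal, tm_cos; lia.
    + apply sumR_ext; intros j Hj.
      assert (G : forall m, sumR m (fun k =>
        a j * a k * (if Z.eqb (Z.of_nat j - Z.of_nat k) 0 then 1 else 0))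
        = if Nat.ltb j m then a j ^ 2 else 0).
      { induction m as [|m IH]; [easy|]. cbn [sumR]; rewrite IH.
        destruct (Z.eqb_spec (Z.of_nat j - Z.of_nat m) 0), (Nat.ltb_spec j m),
          (Nat.ltb_spec j (S m)); try lia; try ring.
        replace m with j by lia; ring. }
      rewrite G; destruct (Nat.ltb_spec j n); [easy|lia].
Qed.

Lemma normpow_2 n a : normpow n a 2 = sumR n (fun j => a j ^ 2).
Proof.
  unfold normpow.
  rewrite (is_RInt_unique _ _ _ _ (trig_mean_integral _ _ _ (poly_abs_sqr_trig_mean n a))).
  field; apply PI_neq0.
Qed.

Lemma normpow_4 n a : (0 < n)%nat ->
  normpow n a 4 = sumR n (fun l => poly_abs n a (even_node n l) ^ 4
                                   + poly_abs n a (odd_node n l) ^ 4) / (2 * INR n).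
Proof.
  intros Hn.
  destruct (trig_mean_mult _ _ _ _ _ _ (poly_abs_sqr_trig_mean n a) (poly_abs_sqr_trig_mean n a))
    as [u Hu].
  replace (Z.of_nat n + Z.of_nat n)%Z with (2 * Z.of_nat n)%Z in Hu by lia.
  apply (tm_ext _ _ (fun t => poly_abs n a t ^ 4)) in Hu; [|intros; ring].
  rewrite (trig_mean_nodes _ _ _ Hn Hu); unfold normpow.
  rewrite (is_RInt_unique _ _ _ _ (trig_mean_integral _ _ _ Hu)).
  field; split; [apply not_0_INR; lia|apply PI_neq0].
Qed.

End TrigonometricMeans.

Module CharacterPolynomials.
Import TrigonometricMeans.
(* The [field] of Stdlib, shadowed by the imports that follow. *)
Ltac Rfield := field.
Import all_boot all_order all_algebra complex Rstruct zify ring lra.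
Import Order.TTheory GRing.Theory Num.Theory.
Set Implicit Arguments. Unset Strict Implicit. Unset Printing Implicit Defensive.
Local Open Scope ring_scope.
Local Notation "x %:C" := (real_complex _ x) (format "x %:C") : ring_scope.
Local Delimit Scope R_scope with coqR.

(** * Sums of periodic sequences *)

Definition periodic (T : Type) (n : nat) (F : nat -> T) := forall j, F (j + n)%N = F j.

Lemma periodic_mod (T : Type) n (F : nat -> T) : periodic n F -> forall j, F (j %% n)%N = F j.
Proof.
move=> perF j; rewrite [in RHS](divn_eq j n) addnC.
by elim: (j %/ n)%N => [|k IH]; rewrite ?addn0 // mulSn addnCA addnC perF.
Qed.

Section PeriodicSums.
Variable V : pzRingType.
Implicit Types F G : nat -> V.

Lemma sum_periodic_affine n u k F : (0 < n)%N -> coprime u n -> periodic n F ->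
  \sum_(i < n) F (u * i + k)%N = \sum_(i < n) F i.
Proof.
case: n => // n _ cop perF.
pose h (i : 'I_n.+1) : 'I_n.+1 := inord ((u * i + k) %% n.+1).
have hE i : h i = ((u * i + k) %% n.+1)%N :> nat by rewrite inordK // ltn_mod.
have inj_h : injective h.
  move=> i j /(congr1 val) /=; rewrite !hE => /eqP.
  rewrite eqn_modDr => /eqP eq_ij; apply: val_inj.
  rewrite /= -(modn_small (ltn_ord i)) -(modn_small (ltn_ord j)); apply/eqP.
  have {eq_ij} := eq_ij => /eqP.
  wlog le_ij : i j / (i <= j)%N.
    by move=> H; case/orP: (leq_total i j) => /H // H2; rewrite eq_sym => /H2; rewrite eq_sym.
  rewrite eq_sym eqn_mod_dvd ?leq_mul2l ?le_ij ?orbT // -mulnBr Gauss_dvdr 1?coprime_sym //.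
  by rewrite -eqn_mod_dvd // eq_sym.
rewrite [RHS](reindex_inj inj_h) /=; apply: eq_bigr => i _.
by rewrite hE periodic_mod.
Qed.

Lemma sum_periodic_shift n k F : periodic n F -> \sum_(i < n) F (i + k)%N = \sum_(i < n) F i.
Proof.
case: n => [|n] perF; first by rewrite !big_ord0.
by rewrite -[RHS](@sum_periodic_affine _ 1 k) ?coprime1n //; apply: eq_bigr => i _; rewrite mul1n.
Qed.

Lemma sum_blocks p q F :
  \sum_(0 <= j < q * p) F j = \sum_(0 <= i < q) \sum_(0 <= k < p) F (i * p + k)%N.
Proof.
elim: q => [|q IH]; first by rewrite !big_geq.
rewrite [RHS]big_nat_recr //= -IH (big_cat_nat (n := (q * p)%N)) //=; last first.
  by rewrite leq_mul2r leqnSn orbT.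
congr (_ + _); rewrite -{1}[(q * p)%N]add0n big_addn mulSn addnK.
by apply: eq_bigr => k _; rewrite addnC.
Qed.

End PeriodicSums.

(** Cut the range into [q] blocks of length [p]. At position [k] of every block F has the value
    [F k], while the arguments [i * p + k] run through all residues modulo [q] because [p] is
    invertible there. *)
Lemma sum_crt (V : comPzRingType) p q (F G : nat -> V) : (0 < p)%N -> (0 < q)%N -> coprime p q ->
  periodic p F -> periodic q G ->
  \sum_(j < p * q) F j * G j = (\sum_(i < p) F i) * (\sum_(i < q) G i).
Proof.
move=> p0 q0 cop perF perG.
rewrite -(big_mkord xpredT (fun j => F j * G j)) mulnC sum_blocks exchange_big /=.
rewrite mulr_suml -(big_mkord xpredT (fun i => F i * _)); apply: eq_bigr => k _.
rewrite -(sum_periodic_affine k q0 cop perG) mulr_sumr big_mkord.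
apply: eq_bigr => i _.
have -> : F (i * p + k)%N = F k by rewrite -(periodic_mod perF) modnMDl periodic_mod.
by rewrite mulnC.
Qed.

(** * Quadratic character sums over finite fields *)

Lemma le_of_eq (d : Order.disp_t) (T : porderType d) (x y : T) : x = y -> (x <= y)%O.
Proof. by move->. Qed.

(** Meant for [Q = #|F| - 1] and [T] a character sum over a cubic. Since Q >= 2 gives (Q + 1)^2 <=
    9/4 Q^2, the hypothesis yields T^4 <= 243/4 (Q + 1)^3 and then (T - 1)^4 <= 494 (Q + 1)^3; the
    constant is rounded up to 5^4. *)
Lemma fourth_power_bound (R : realDomainType) (T Q : R) : 2 <= Q ->
  T ^+ 4 * ((Q + 1) * Q ^+ 2) <= 27 * (Q + 1) ^+ 6 -> (T - 1) ^+ 4 <= 625 * (Q + 1) ^+ 3.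
Proof.
move=> Q2; set P := Q + 1 => H.
have T4 : 0 <= T ^+ 4 by rewrite exprn_even_ge0.
have P1 : 1 <= P by rewrite /P; lra.
have P3 : 1 <= P ^+ 3 by rewrite exprn_ege1.
have le1 : 4 * P ^+ 2 <= 9 * Q ^+ 2.
  rewrite -subr_ge0 (_ : _ - _ = (Q - 2) * (5 * Q + 2)); last by rewrite /P; ring.
  by rewrite mulr_ge0 //; lra.
have le2 : T ^+ 4 * P * (4 * P ^+ 2) <= T ^+ 4 * P * (9 * Q ^+ 2).
  by rewrite ler_wpM2l // mulr_ge0 //; lra.
have le3 : 4 * T ^+ 4 <= 243 * P ^+ 3.
  rewrite -(ler_pM2r (lt_le_trans ltr01 P3)).
  apply: (@le_trans _ _ (T ^+ 4 * P * (9 * Q ^+ 2))).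
    by apply: le_trans le2; apply: le_of_eq; ring.
  apply: (@le_trans _ _ (9 * (27 * P ^+ 6))); last by apply: le_of_eq; ring.
  by apply: (@le_trans _ _ (9 * (T ^+ 4 * (P * Q ^+ 2))));
    [apply: le_of_eq; ring | rewrite ler_wpM2l].
have le4 : (T - 1) ^+ 4 <= 8 * T ^+ 4 + 8.
  rewrite -subr_ge0.
  have -> : 8 * T ^+ 4 + 8 - (T - 1) ^+ 4 =
      (T + 1) ^+ 2 * (5 * (T - 1) ^+ 2 + 2 * T ^+ 2 + 2) by ring.
  by rewrite mulr_ge0 ?sqr_ge0 // !addr_ge0 // mulr_ge0 // sqr_ge0.
by move: le3 le4 P3; move: (T ^+ 4) ((T - 1) ^+ 4) (P ^+ 3) => ? ? ?; lra.
Qed.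

Section QuadraticCharacter.
Variable F : finFieldType.
Hypothesis two_neq0 : (1 + 1 : F) != 0.
Implicit Types x y a b c d : F.

Definition is_square x := [exists y, y ^+ 2 == x].
Definition qchar x : int := if x == 0 then 0 else if is_square x then 1 else -1.

Lemma is_squareP x : reflect (exists y, y ^+ 2 = x) (is_square x).
Proof. by apply: (iffP existsP) => -[y /eqP]; exists y => //; apply/eqP. Qed.

Lemma qchar0 : qchar 0 = 0.
Proof. by rewrite /qchar eqxx. Qed.

Lemma qchar_sqr x : x != 0 -> qchar (x ^+ 2) = 1.
Proof.
move=> x0; rewrite /qchar sqrf_eq0 (negPf x0).
by have -> : is_square (x ^+ 2) by apply/is_squareP; exists x.
Qed.

Lemma qchar1 : qchar 1 = 1.
Proof. by rewrite -(expr1n F 2) qchar_sqr ?oner_eq0. Qed.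

Lemma opp_neq x : x != 0 -> - x != x.
Proof.
move=> x0; rewrite eq_sym -subr_eq0 opprK -{1}[x]mul1r -{2}[x]mul1r -mulrDl.
by rewrite mulf_neq0.
Qed.

Let Sq := [set x | (x != 0) && is_square x].

Lemma card_nonzero_squares : (#|[set x : F | x != 0%R]| <= 2 * #|Sq|)%N.
Proof.
rewrite -sum1_card (partition_big (fun x => x ^+ 2) (mem Sq)) /=; last first.
  move=> x; rewrite !inE sqrf_eq0 => -> /=; apply/is_squareP; by exists x.
rewrite mulnC -sum_nat_const; apply: leq_sum => y; rewrite inE => /andP[y0 /is_squareP[z zy]].
rewrite sum1_card; apply: (@leq_trans #|[set z; - z]|); last by rewrite cards2; case: eqP.
apply/subset_leq_card/subsetP => x; rewrite !inE => /andP[_]; rewrite -zy eqf_sqr.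
by [].
Qed.

(** By [card_nonzero_squares] the squares fill at least half of the nonzero elements. The coset
    [aSq] is as large and disjoint from them, so together they exhaust the nonzero elements and [b]
    lies in the coset. *)
Lemma is_squareM_nonsquare a b : a != 0 -> b != 0 -> ~~ is_square a -> ~~ is_square b ->
  is_square (a * b).
Proof.
move=> a0 b0 na nb.
pose aSq := [set a * x | x in Sq].
have cardaSq : #|aSq| = #|Sq| by rewrite card_imset //; apply: mulfI.
have dis : [disjoint Sq & aSq].
  rewrite -setI_eq0; apply/eqP/setP => y; rewrite !inE; apply/negP => /andP[/andP[y0]].
  case/is_squareP => z zy /imsetP[x]; rewrite inE => /andP[x0 /is_squareP[w wx]] yE.
  move/negP: na; apply; apply/is_squareP; exists (z / w).
  by rewrite expr_div_n zy wx yE mulfK.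
have cov : Sq :|: aSq = [set x : F | x != 0].
  apply/eqP; rewrite eqEcard; apply/andP; split.
    apply/subsetP => x; rewrite !inE => /orP[/andP[]//|/imsetP[y]].
    by rewrite inE => /andP[y0 _] ->; rewrite mulf_neq0.
  apply: leq_trans card_nonzero_squares _.
  by rewrite cardsU cardaSq disjoint_setI0 // cards0 subn0 mul2n addnn.
have : b \in Sq :|: aSq by rewrite cov inE.
rewrite !inE b0 (negPf nb) /= => /imsetP[y]; rewrite inE => /andP[y0 /is_squareP[z zy]] ->.
by apply/is_squareP; exists (a * z); rewrite exprMn zy expr2 mulrA.
Qed.

Lemma qcharM x y : qchar (x * y) = qchar x * qchar y.
Proof.
rewrite /qchar mulf_eq0; case: (eqVneq x 0) => [|x0] /=; first by rewrite mul0r.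
case: (eqVneq y 0) => [|y0] /=; first by rewrite mulr0.
case: ifP => sxy; case: ifP => sx; case: ifP => sy; rewrite ?mulr1 ?mul1r ?mulrNN //; exfalso.
- case/is_squareP: sx => u ux; case/is_squareP: sxy => w wxy.
  case/negP: (negbT sy); apply/is_squareP; exists (w / u).
  by rewrite expr_div_n wxy ux mulrC mulKf.
- case/is_squareP: sy => u uy; case/is_squareP: sxy => w wxy.
  case/negP: (negbT sx); apply/is_squareP; exists (w / u).
  by rewrite expr_div_n wxy uy mulfK.
- case/is_squareP: sx => u ux; case/is_squareP: sy => w wy.
  by case/negP: (negbT sxy); apply/is_squareP; exists (u * w); rewrite exprMn ux wy.
- by case/negP: (negbT sxy); apply: is_squareM_nonsquare => //; rewrite ?sx ?sy.
Qed.

(** Squaring identifies 1 and -1, so on a finite field it is not onto and some [a] is not a square.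
    Multiplying the variable by [a] permutes the field and changes the sign of the sum. *)
Lemma qchar_sum0 : \sum_x qchar x = 0.
Proof.
have [a na] : exists a, ~~ is_square a.
  apply/existsP; rewrite -negb_forall; apply/negP => /forallP all_sq.
  have sur : forall y, y \in codom (fun x : F => x ^+ 2).
    by move=> y; have /is_squareP[z <-] := all_sq y; apply: codom_f.
  have := @image_injP F F (fun x => x ^+ 2) predT.
  have -> : #|image (fun x : F => x ^+ 2) predT| == #|(predT : pred F)|.
    by apply/eqP; apply: eq_card => y; rewrite sur.
  move/elimT => /(_ isT) /(_ 1 (-1)); rewrite !inE sqrrN => /(_ isT isT erefl) /esym.
  by apply/eqP; rewrite opp_neq ?oner_eq0.
have a0 : a != 0.
  by apply: contraNneq na => ->; apply/is_squareP; exists 0; rewrite expr0n.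
have : \sum_x qchar x = - \sum_x qchar x.
  rewrite [LHS](reindex_inj (mulfI a0)) /= -sumrN; apply: eq_bigr => x _.
  by rewrite qcharM [qchar a]/qchar (negPf a0) (negPf na) mulN1r.
lia.
Qed.

Lemma qchar_le1 x : `|qchar x| <= 1.
Proof. by rewrite /qchar; case: ifP => // _; case: ifP. Qed.

Lemma qchar_sum_affine a b : a != 0 -> \sum_x qchar (b + x * a) = 0.
Proof.
move=> a0; rewrite -[RHS]qchar_sum0 [RHS](reindex_inj (addrI b)) /=.
by rewrite [RHS](reindex_inj (mulIf a0)).
Qed.

Lemma sum_inv (G : F -> int) : \sum_(x | x != 0) G x^-1 = \sum_(x | x != 0) G x.
Proof.
rewrite [RHS](reindex_inj invr_inj) /=; apply: eq_bigl => x; by rewrite invr_eq0.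
Qed.

(** Move [- b] to the origin. For nonzero x the product is the character of x^2 (1 + (c - b) / x),
    so inversion leaves an affine sum without its term 1 at the origin. *)
Lemma qchar_correlation b c : b != c -> \sum_x qchar (x + b) * qchar (x + c) = -1.
Proof.
move=> bc; rewrite (reindex_inj (addIr (- b))) /=.
have cb0 : c - b != 0 by rewrite subr_eq0 eq_sym.
rewrite (bigD1 0) //= add0r addNr qchar0 mul0r add0r.
rewrite (eq_bigr (fun x => qchar (1 + x^-1 * (c - b)))); last first.
  move=> x x0; rewrite subrK -qcharM.
  have -> : x * (x - b + c) = x ^+ 2 * (1 + x^-1 * (c - b)) by field.
  by rewrite qcharM qchar_sqr // mul1r.
rewrite (sum_inv (fun y => qchar (1 + y * (c - b)))).
have := qchar_sum_affine 1 cb0; rewrite (bigD1 0) //= mul0r addr0 qchar1.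
by move/eqP; rewrite addrC addr_eq0 => /eqP.
Qed.


(** Coefficients by increasing degree. The degree may drop, so the parameters form a group under
    addition and the moment below can be averaged over translations. *)
Definition cubic (v : F * F * F * F) x : F :=
  v.1.1.1 + v.1.1.2 * x + v.1.2 * x ^+ 2 + v.2 * x ^+ 3.

Lemma cubicD u v x : cubic (u + v) x = cubic u x + cubic v x.
Proof. rewrite /cubic /=; ring. Qed.

Definition cubic_of_roots c x1 x2 x3 : F * F * F * F :=
  (- (c * (x1 * x2 * x3)), c * (x1 * x2 + x1 * x3 + x2 * x3), - (c * (x1 + x2 + x3)), c).

Lemma cubic_of_rootsE c x1 x2 x3 x :
  cubic (cubic_of_roots c x1 x2 x3) x = c * ((x - x1) * (x - x2) * (x - x3)).
Proof. rewrite /cubic /cubic_of_roots /=; ring. Qed.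

(* Adding multiples of a cubic that vanishes at x2, x3, x4 makes the value at x1 equidistributed
   without changing the other three. *)
Lemma cubic_moment_isolated x1 x2 x3 x4 : x1 != x2 -> x1 != x3 -> x1 != x4 ->
  \sum_v qchar (cubic v x1) * (qchar (cubic v x2) * qchar (cubic v x3) * qchar (cubic v x4)) = 0.
Proof.
move=> n2 n3 n4.
pose f v := qchar (cubic v x1) * (qchar (cubic v x2) * qchar (cubic v x3) * qchar (cubic v x4)).
rewrite -/(f _); set Sf := \sum_v _.
have SfE (t : F) : Sf = \sum_(v : F * F * F * F) f (v + cubic_of_roots t x2 x3 x4).
  by rewrite /Sf (reindex_inj (addIr (cubic_of_roots t x2 x3 x4))).
have : \sum_(t : F) Sf = 0.
  rewrite (eq_bigr _ (fun t _ => SfE t)) exchange_big big1 // => v _ /=.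
  pose w := (x1 - x2) * (x1 - x3) * (x1 - x4).
  rewrite (eq_bigr (fun t => qchar (cubic v x1 + t * w) *
     (qchar (cubic v x2) * qchar (cubic v x3) * qchar (cubic v x4)))); last first.
    move=> t _; rewrite /f !cubicD !cubic_of_rootsE /w.
    by rewrite !subrr !(mul0r, mulr0) !addr0.
  by rewrite -mulr_suml qchar_sum_affine ?mul0r // !mulf_neq0 // subr_eq0.
rewrite sumr_const => /eqP; rewrite mulrn_eq0 => /orP[|/eqP //].
by move=> /eqP F0; have := cardD1 (0 : F) F; rewrite F0.
Qed.

Definition paired (T : eqType) (x1 x2 x3 x4 : T) :=
  [|| (x1 == x2) && (x3 == x4), (x1 == x3) && (x2 == x4) | (x1 == x4) && (x2 == x3)].

Lemma unpaired_isolated (T : eqType) (x1 x2 x3 x4 : T) : ~~ paired x1 x2 x3 x4 ->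
  [|| [&& x1 != x2, x1 != x3 & x1 != x4], [&& x2 != x1, x2 != x3 & x2 != x4],
      [&& x3 != x1, x3 != x2 & x3 != x4] | [&& x4 != x1, x4 != x2 & x4 != x3]].
Proof.
rewrite /paired [x2 == x1]eq_sym [x3 == x1]eq_sym [x3 == x2]eq_sym [x4 == x1]eq_sym.
rewrite [x4 == x2]eq_sym [x4 == x3]eq_sym.
case: (x1 =P x2) => ?; case: (x1 =P x3) => ?; case: (x1 =P x4) => ?;
case: (x2 =P x3) => ?; case: (x2 =P x4) => ?; case: (x3 =P x4) => ? //=; congruence.
Qed.

Let chisum v := \sum_x qchar (cubic v x).

Lemma sum_pow4 (I : finType) (f : I -> int) :
  (\sum_i f i) ^+ 4 = \sum_i1 \sum_i2 \sum_i3 \sum_i4 f i1 * (f i2 * f i3 * f i4).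
Proof.
rewrite exprS mulr_suml; apply: eq_bigr => i1 _.
rewrite exprS mulr_suml mulr_sumr; apply: eq_bigr => i2 _.
rewrite expr2 mulr_suml !mulr_sumr; apply: eq_bigr => i3 _.
rewrite !mulr_sumr; apply: eq_bigr => i4 _; ring.
Qed.

Lemma sum_delta (I : finType) (i : I) : \sum_j ((i == j)%:R : int) = 1.
Proof.
by rewrite (bigD1 i) //= eqxx big1 ?addr0 // => j; rewrite eq_sym => /negPf ->.
Qed.

Lemma qcharM4_le1 x y z t : qchar x * (qchar y * qchar z * qchar t) <= 1.
Proof.
apply: le_trans (ler_norm _) _; rewrite !normrM.
have := qchar_le1 x; have := qchar_le1 y; have := qchar_le1 z; have := qchar_le1 t.
have h (u v : int) : 0 <= u -> 0 <= v -> u <= 1 -> v <= 1 -> 0 <= u * v <= 1.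
  by move=> *; rewrite mulr_ge0 // mulr_ile1.
move=> h1 h2 h3 h4.
have /andP[p1 p2] := h _ _ (normr_ge0 (qchar y)) (normr_ge0 (qchar z)) h3 h2.
have /andP[p3 p4] := h _ _ p1 (normr_ge0 (qchar t)) p2 h1.
by have /andP[] := h _ _ (normr_ge0 (qchar x)) p3 h4 p4.
Qed.

Lemma cubic_moment_le x1 x2 x3 x4 :
  \sum_v qchar (cubic v x1) * (qchar (cubic v x2) * qchar (cubic v x3) * qchar (cubic v x4))
  <= (#|F| ^ 4)%:R * ((x1 == x2)%:R * (x3 == x4)%:R + (x1 == x3)%:R * (x2 == x4)%:R +
       (x1 == x4)%:R * (x2 == x3)%:R).
Proof.
case: (boolP (paired x1 x2 x3 x4)) => [pr|npr].
  apply: (@le_trans _ _ (#|F| ^ 4)%:R).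
    apply: le_trans (ler_sum _ (fun v _ => qcharM4_le1 _ _ _ _)) _.
    by rewrite sumr_const !card_prod !expnSr expn0 mul1n.
  rewrite -[leLHS]mulr1 ler_wpM2l // -!natrM -!natrD ler1n.
  by case/or3P: pr => /andP[/eqP -> /eqP ->]; rewrite !eqxx ?addn_gt0 ?orbT.
have -> : \sum_v qchar (cubic v x1) * (qchar (cubic v x2) * qchar (cubic v x3)
   * qchar (cubic v x4)) = 0; last first.
  by rewrite mulr_ge0 // -!natrM -!natrD ler0n.
have mE2 (a1 a2 a3 a4 : int) : a1 * (a2 * a3 * a4) = a2 * (a1 * a3 * a4) by ring.
have mE3 (a1 a2 a3 a4 : int) : a1 * (a2 * a3 * a4) = a3 * (a1 * a2 * a4) by ring.
have mE4 (a1 a2 a3 a4 : int) : a1 * (a2 * a3 * a4) = a4 * (a1 * a2 * a3) by ring.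
case/or4P: (unpaired_isolated npr) => /and3P[? ? ?].
- exact: cubic_moment_isolated.
- by rewrite (eq_bigr _ (fun v _ => mE2 _ _ _ _)) cubic_moment_isolated.
- by rewrite (eq_bigr _ (fun v _ => mE3 _ _ _ _)) cubic_moment_isolated.
- by rewrite (eq_bigr _ (fun v _ => mE4 _ _ _ _)) cubic_moment_isolated.
Qed.

(** After expansion the average over the cubics is taken first. By [cubic_moment_le] only quadruples
    of points matched two by two remain: three matchings, [#|F| ^ 2] quadruples each, every one
    worth at most [#|F| ^ 4]. *)
Lemma cubic_fourth_moment : \sum_v chisum v ^+ 4 <= (3 * #|F| ^ 6)%:R.
Proof.
rewrite (eq_bigr _ (fun v _ => sum_pow4 _)) exchange_big /=.
under eq_bigr do rewrite exchange_big /=.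
under eq_bigr do under eq_bigr do rewrite exchange_big /=.
under eq_bigr do under eq_bigr do under eq_bigr do rewrite exchange_big /=.
apply: (@le_trans _ _ (\sum_x1 \sum_x2 \sum_x3 \sum_x4 ((#|F| ^ 4)%:R *
   ((x1 == x2)%:R * (x3 == x4)%:R + (x1 == x3)%:R * (x2 == x4)%:R +
       (x1 == x4)%:R * (x2 == x3)%:R : int)))).
  by do 4!apply: ler_sum => ? _; apply: cubic_moment_le.
have c1 : \sum_(x1 : F) \sum_(x2 : F) (1 : int) = (#|F| ^ 2)%:R.
  by rewrite !sumr_const -mulrnA.
have d1 : \sum_(x1 : F) \sum_(x2 : F) \sum_(x3 : F) \sum_(x4 : F)
    ((x1 == x2)%:R * (x3 == x4)%:R : int) = (#|F| ^ 2)%:R.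
  rewrite -c1; apply: eq_bigr => x1 _.
  under eq_bigr do under eq_bigr do rewrite -mulr_sumr sum_delta mulr1.
  by rewrite exchange_big /=; apply: eq_bigr => x3 _; rewrite sum_delta.
have d2 : \sum_(x1 : F) \sum_(x2 : F) \sum_(x3 : F) \sum_(x4 : F)
    ((x1 == x3)%:R * (x2 == x4)%:R : int) = (#|F| ^ 2)%:R.
  rewrite -c1; apply: eq_bigr => x1 _; apply: eq_bigr => x2 _.
  by under eq_bigr do rewrite -mulr_sumr sum_delta mulr1; rewrite sum_delta.
have d3 : \sum_(x1 : F) \sum_(x2 : F) \sum_(x3 : F) \sum_(x4 : F)
    ((x1 == x4)%:R * (x2 == x3)%:R : int) = (#|F| ^ 2)%:R.
  rewrite -c1; apply: eq_bigr => x1 _; apply: eq_bigr => x2 _.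
  by under eq_bigr do rewrite -mulr_suml sum_delta mul1r; rewrite sum_delta.
under eq_bigr do under eq_bigr do under eq_bigr do rewrite -mulr_sumr !big_split /=.
under eq_bigr do under eq_bigr do rewrite -mulr_sumr !big_split /=.
under eq_bigr do rewrite -mulr_sumr !big_split /=.
rewrite -mulr_sumr !big_split /= d1 d2 d3 -!natrD -natrM.
by rewrite ler_nat -[6%N]/(4 + 2)%N expnD !mulSn mul0n addn0 !mulnDr addnA.
Qed.

Lemma sum_fiber_le (I J : finType) (P : pred I) (h : I -> J) (f : J -> int) (k : nat) :
  (forall v, 0 <= f v) -> (forall v, (#|[set i | P i && (h i == v)]| <= k)%N) ->
  \sum_(i | P i) f (h i) <= k%:R * \sum_v f v.
Proof.
move=> f0 hk; rewrite (partition_big h xpredT) //= mulr_sumr; apply: ler_sum => v _.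
rewrite (eq_bigr (fun=> f v)); last by move=> i /andP[_ /eqP ->].
rewrite sumr_const -[leLHS]mulr_natl ler_wpM2r // ler_nat.
by apply: leq_trans (hk v); rewrite cardsE.
Qed.

(* The cubics with leading coefficient [b] and roots [r], [r + d], [r + lam * d] sweep out the orbit
   of the given one under affine substitutions and scaling, and the character sum has constant
   absolute value on that orbit. *)
Lemma cubic_sum_roots c x1 x2 x3 : c != 0 -> x1 != x2 -> x1 != x3 -> x2 != x3 ->
  chisum (cubic_of_roots c x1 x2 x3) ^+ 4 * (#|F| * #|F|.-1 ^ 2)%:R <= (27 * #|F| ^ 6)%:R.
Proof.
move=> c0 n12 n13 n23.
have d12 : x2 - x1 != 0 by rewrite subr_eq0 eq_sym.
pose lam := (x3 - x1) / (x2 - x1).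
pose g (i : F * F * F) := cubic_of_roots i.1.1 i.1.2 (i.1.2 + i.2) (i.1.2 + lam * i.2).
pose P : pred (F * F * F) := [predX [predX predC1 0 & predT] & predC1 0].
pose base := \sum_y qchar (y * (y - 1) * (y - lam)).
have PE b r d : P (b, r, d) = (b != 0) && (d != 0) by rewrite /P /= !inE /= andbT.
have orb i : P i -> chisum (g i) ^+ 4 = base ^+ 4.
  case: i => [[b r] d]; rewrite PE => /andP[b0 d0].
  have -> : chisum (g (b, r, d)) = qchar (b * d ^+ 3) * base.
    rewrite /chisum (reindex_inj (addrI r)) /= (reindex_inj (mulIf d0)) /= mulr_sumr.
    apply: eq_bigr => y _; rewrite -qcharM; congr qchar.
    rewrite cubic_of_rootsE /=; ring.
  have u0 : b * d ^+ 3 != 0 by rewrite mulf_neq0 // expf_neq0.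
  have q2 : qchar (b * d ^+ 3) ^+ 2 = 1 by rewrite expr2 -qcharM -expr2 qchar_sqr.
  by rewrite exprMn -[4%N]/(2 * 2)%N exprM q2 expr1n mul1r.
have cardP : #|P| = (#|F| * #|F|.-1 ^ 2)%N.
  have cP : #|predC1 (0 : F)| = #|F|.-1.
    by rewrite -(cardC (pred1 (0 : F))) card1; apply: eq_card.
  by rewrite /P !cardX cP mulnAC mulnC.
(* At most nine parameters give the same cubic: its leading coefficient determines [b], and [r] and
   [r + d] are both among its at most three roots. Nine times the 3 of [cubic_fourth_moment] is the
   27 of the statement. *)
have fib v : (#|[set i | P i && (g i == v)]| <= 9)%N.
  case: (set_0Vmem [set i | P i && (g i == v)]) => [->|[[[b r] d]]]; first by rewrite cards0.
  rewrite inE PE => /andP[/andP[b0 d0] /eqP vE].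
  pose Rt := [set r; r + d; r + lam * d].
  have cR : (#|Rt| <= 3)%N.
    apply: leq_trans (leq_card_setU _ _) _; rewrite cards1 addn1 ltnS.
    by rewrite cards2; case: eqP.
  have rootE x : cubic v x = 0 -> x \in Rt.
    rewrite -vE /g cubic_of_rootsE /= => /eqP; rewrite !mulf_eq0 (negPf b0) /=.
    by rewrite !subr_eq0 !inE.
  pose h (i : F * F * F) := (i.1.2, i.1.2 + i.2).
  rewrite -(card_in_imset (f := h)); last first.
    move=> [[b1 r1] d1] [[b2 r2] d2]; rewrite !inE => /andP[_ /eqP e1] /andP[_ /eqP e2].
    by move: e1 e2; rewrite -vE /g /= => -[_ _ _ ->] [_ _ _ ->] [-> /addrI ->].
  apply: (@leq_trans #|setX Rt Rt|); last by rewrite cardsX (leq_mul cR cR).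
  apply/subset_leq_card/subsetP => y /imsetP[[[b1 r1] d1]].
  rewrite inE => /andP[_ /eqP e1] ->.
  rewrite /h /= inE /=; apply/andP; split; apply: rootE; rewrite -e1 cubic_of_rootsE /=.
    by rewrite subrr !(mul0r, mulr0).
  by rewrite subrr !(mul0r, mulr0).
have gx : cubic_of_roots c x1 x2 x3 = g (c, x1, x2 - x1).
  by rewrite /g /= /lam divfK // [x1 + (x2 - x1)]addrC subrK [x1 + (x3 - x1)]addrC subrK.
rewrite gx orb; last by rewrite PE c0.
have pos v : 0 <= chisum v ^+ 4 by rewrite exprn_even_ge0.
have := sum_fiber_le pos fib.
rewrite (eq_bigr (fun=> base ^+ 4)); last by move=> i /orb.
rewrite sumr_const cardP -[_ *+ (#|F| * _)]mulr_natr => /le_trans; apply.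
apply: le_trans (ler_wpM2l _ cubic_fourth_moment) _ => //.
by rewrite -natrM ler_nat mulnA.
Qed.

Lemma card_ge3 : (2 < #|F|)%N.
Proof.
have -> : 3%N = #|[set (0 : F); 1; -1]|.
  rewrite !cardsU !cards1 (_ : [set 0] :&: [set 1] = set0) ?cards0; last first.
    by apply/setP => x; rewrite !inE; case: eqVneq => [->|//]; rewrite eq_sym oner_eq0.
  rewrite (_ : _ :&: _ = set0) ?cards0 //.
  apply/setP => x; rewrite !inE; case: (eqVneq x (-1)) => [->|]; last by rewrite andbF.
  by rewrite oppr_eq0 oner_eq0 (negPf (opp_neq _)) ?oner_eq0.
exact: max_card.
Qed.

(** Translate the root [- d] to 0 and write the quartic as x^4 times a cubic in 1/x. As the factor
    x^4 is a square, inversion turns the sum into a sum over a cubic, without the point 0, where the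
    cubic equals 1; this explains [chisum v - 1]. *)
Lemma quartic_sum_le a b c d : a != b -> a != c -> a != d -> b != c -> b != d -> c != d ->
  (\sum_x qchar (x + a) * (qchar (x + b) * qchar (x + c) * qchar (x + d))) ^+ 4
    <= 625 * #|F|%:R ^+ 3.
Proof.
move=> ab ac ad bc bd cd.
have [da db dc] : [/\ a - d != 0, b - d != 0 & c - d != 0] by rewrite !subr_eq0.
pose k := (a - d) * (b - d) * (c - d).
pose v := cubic_of_roots k (- (a - d)^-1) (- (b - d)^-1) (- (c - d)^-1).
have -> : \sum_x qchar (x + a) * (qchar (x + b) * qchar (x + c) * qchar (x + d))
          = chisum v - 1.
  rewrite (reindex_inj (addIr (- d))) /= (bigD1 0) //= add0r addNr qchar0 !mulr0 add0r.
  rewrite (eq_bigr (fun x => qchar (cubic v x^-1))); last first.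
    move=> x x0; rewrite -!qcharM subrK.
    have -> : (x - d + a) * ((x - d + b) * (x - d + c) * x) =
              (x ^+ 2) ^+ 2 * cubic v x^-1.
      rewrite cubic_of_rootsE /k; field; by rewrite x0 da db dc.
    by rewrite qcharM qchar_sqr ?mul1r // expf_neq0.
  rewrite (sum_inv (fun y => qchar (cubic v y))) /chisum [X in _ = X - 1](bigD1 0) //=.
  have -> : cubic v 0 = 1 by rewrite cubic_of_rootsE /k; field; rewrite da db dc.
  by rewrite qchar1 addrAC subrr add0r.
have inj : injective (fun x : F => - x^-1) by move=> x y /oppr_inj /invr_inj.
have := @cubic_sum_roots k (- (a - d)^-1) (- (b - d)^-1) (- (c - d)^-1).
rewrite -/v !(inj_eq inj) !(inj_eq (addIr _)) => /(_ _ ab ac bc).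
move/(_ ltac:(by rewrite !mulf_neq0)).
have := card_ge3; move: (chisum v) #|F| => T [//|q] /= q2.
rewrite [(27 * _)%:R]natrM [(_ * q ^ 2)%:R]natrM [(q ^ 2)%:R]natrX [(q.+1 ^ 6)%:R]natrX.
rewrite -[q.+1%:R]natr1 => H.
by apply: fourth_power_bound H; rewrite (ler_nat _ 2).
Qed.

(** The doubled factor is 1 except at [- a], where it vanishes. What remains is the two-point
    correlation -1 less one term, hence at most 2 in absolute value. *)
Lemma square_pair_sum_le a b c : b != c ->
  (\sum_x qchar (x + a) * (qchar (x + a) * qchar (x + b) * qchar (x + c))) ^+ 4
    <= 625 * #|F|%:R ^+ 3.
Proof.
move=> bc.
have -> : \sum_x qchar (x + a) * (qchar (x + a) * qchar (x + b) * qchar (x + c))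
   = -1 - qchar (b - a) * qchar (c - a).
  rewrite -(qchar_correlation bc) (bigD1 (- a)) //= addNr qchar0 mul0r add0r.
  rewrite [X in _ = X - _](bigD1 (- a)) //= ![- a + _]addrC [X in _ = X - _]addrC addrK.
  apply: eq_bigr => x xa; rewrite -mulrA mulrA -expr2 expr2 -qcharM -expr2 qchar_sqr ?mul1r //.
  by rewrite addr_eq0.
have h (u v : int) : `|u| <= 1 -> `|v| <= 1 -> (-1 - u * v) ^+ 4 <= 16.
  move=> u1 v1; have : `|u * v| <= 1 by rewrite normrM mulr_ile1.
  move: (u * v) => w w1; have : w = -1 \/ (w = 0 \/ w = 1) by lia.
  by case=> [->|[->|->]].
apply: le_trans (h _ _ (qchar_le1 _) (qchar_le1 _)) _.
have : 1 <= (#|F|%:R : int) ^+ 3 by rewrite exprn_ege1 // ler1n (ltn_trans _ card_ge3).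
by move: (_ ^+ 3) => q q1; lra.
Qed.

(** Either the four arguments are distinct, or two of them coincide and the remaining two differ
    from each other. One of these may still equal the repeated argument; [square_pair_sum_le] allows
    for that. *)
Lemma unpaired_sum_le a b c d : ~~ paired a b c d ->
  (\sum_x qchar (x + a) * (qchar (x + b) * qchar (x + c) * qchar (x + d))) ^+ 4
    <= 625 * #|F|%:R ^+ 3.
Proof.
rewrite /paired.
have h (x y z t : F) : z != t ->
    (forall u, qchar (u + x) * (qchar (u + x) * qchar (u + z) * qchar (u + t)) =
       qchar (u + a) * (qchar (u + b) * qchar (u + c) * qchar (u + d))) ->
  (\sum_u qchar (u + a) * (qchar (u + b) * qchar (u + c) * qchar (u + d))) ^+ 4
    <= 625 * #|F|%:R ^+ 3.
  by move=> zt E; rewrite -(eq_bigr _ (fun u _ => E u)) square_pair_sum_le.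
case: (eqVneq a b) h => [<-|ab] h /=.
  by case: (eqVneq c d) => //= cd _; apply: (h a a c d).
case: (eqVneq a c) h => [<-|ac] h /=.
  by case: (eqVneq b d) => //= bd _; apply: (h a a b d) => // u; ring.
case: (eqVneq a d) h => [<-|ad] h /=.
  by case: (eqVneq b c) => //= bc _; apply: (h a a b c) => // u; ring.
case: (eqVneq b c) h => [<-|bc] h _; first by apply: (h b b a d) => // u; ring.
case: (eqVneq b d) h => [<-|bd] h; first by apply: (h b b a c) => // u; ring.
case: (eqVneq c d) h => [<-|cd] h; first by apply: (h c c a b) => // u; ring.
exact: quartic_sum_le.
Qed.

End QuadraticCharacter.

(** * Gauss sums *)

#[global] Arguments real_complex_def : simpl never.

(** * Real-valued moduli and Parseval's identity *)

Section ComplexNorm.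
Variable R : rcfType.
Local Notation C := R[i].
Implicit Types (z w : C) (x : R).

(** The norm [|z|] is an element of the complex field; this is the same modulus as a real number, as
    needed in inequalities between real quantities. *)
Definition nrm z : R := Normc.normc z.
#[global] Arguments nrm : simpl never.

Lemma nrmE z : `|z| = (nrm z)%:C.
Proof. by case: z. Qed.

Lemma nrm0 : nrm 0 = 0.
Proof. by apply: complexI; rewrite -nrmE normr0. Qed.

Lemma nrm1 : nrm 1 = 1.
Proof. by apply: complexI; rewrite -nrmE normr1. Qed.

Lemma nrmM z w : nrm (z * w) = nrm z * nrm w.
Proof. by apply: complexI; rewrite -nrmE normrM !nrmE rmorphM. Qed.

Lemma nrmX z k : nrm (z ^+ k) = nrm z ^+ k.
Proof. by elim: k => [|k IH]; rewrite ?expr0 ?nrm1 // !exprS nrmM IH. Qed.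

Lemma nrmN z : nrm (- z) = nrm z.
Proof. by apply: complexI; rewrite -nrmE normrN nrmE. Qed.

Lemma nrm_ge0 z : 0 <= nrm z.
Proof. by rewrite -lecR -nrmE normr_ge0. Qed.

Lemma nrm_conj z : nrm z^* = nrm z.
Proof. by apply: complexI; rewrite -!nrmE norm_conjC. Qed.

Lemma nrm_real x : nrm x%:C = `|x|.
Proof. by rewrite /nrm /real_complex_def /= expr0n /= addr0 sqrtr_sqr. Qed.

Lemma nrmD z w : nrm (z + w) <= nrm z + nrm w.
Proof. by rewrite -lecR rmorphD -!nrmE ler_normD. Qed.

Lemma nrm_eq0 z : (nrm z == 0) = (z == 0).
Proof. by rewrite -(inj_eq (@complexI R)) -nrmE normr_eq0. Qed.

Lemma nrmV z : nrm z^-1 = (nrm z)^-1.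
Proof. by apply: complexI; rewrite -nrmE normfV nrmE fmorphV. Qed.

Lemma nrmB z w : nrm (z - w) <= nrm z + nrm w.
Proof. by rewrite -(nrmN w); apply: nrmD. Qed.

Lemma nrm_sum (I : Type) (r : seq I) (P : pred I) (f : I -> C) :
  nrm (\sum_(i <- r | P i) f i) <= \sum_(i <- r | P i) nrm (f i).
Proof.
elim/big_rec2: _ => [|i y x _ le_xy]; first by rewrite nrm0.
by apply: le_trans (nrmD _ _) _; rewrite lerD2l.
Qed.

Lemma sqr_nrm z : (nrm z ^+ 2)%:C = z * z^*.
Proof. by rewrite rmorphXn /= -nrmE normCK. Qed.

Lemma nrm_unity z n : (0 < n)%N -> z ^+ n = 1 -> nrm z = 1.
Proof.
move=> n0 zn; apply/eqP; rewrite -(pexpr_eq1 n0 (nrm_ge0 z)) -nrmX zn nrm1.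
by rewrite eqxx.
Qed.

Lemma conj_unit z : nrm z = 1 -> z^* = z^-1.
Proof.
move=> z1; have z0 : z != 0 by rewrite -nrm_eq0 z1 oner_eq0.
by apply: (mulfI z0); rewrite divff // -sqr_nrm z1 expr1n.
Qed.

End ComplexNorm.

Section Parseval.
Variable R : rcfType.
Local Notation C := R[i].

Lemma geometric_unity (K : fieldType) n (y : K) : y ^+ n = 1 -> y != 1 ->
  \sum_(k < n) y ^+ k = 0.
Proof.
move=> yn y1; have := subrX1 y n; rewrite yn subrr => /esym/eqP; rewrite mulf_eq0 subr_eq0.
by rewrite (negPf y1) /= => /eqP.
Qed.

Definition dft n (z : C) (f : nat -> C) (k : nat) : C := \sum_(j < n) f j * z ^+ (j * k).

Lemma parseval n (z : C) (f : nat -> C) : n.-primitive_root z ->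
  \sum_(k < n) nrm (dft n z f k) ^+ 2 = n%:R * \sum_(j < n) nrm (f j) ^+ 2.
Proof.
move=> zp; apply: complexI; rewrite rmorphM rmorph_nat !rmorph_sum /= mulr_sumr.
have n0 := prim_order_gt0 zp; have zn := prim_expr_order zp.
have z1 := nrm_unity n0 zn.
have z0 : z != 0 by rewrite -nrm_eq0 z1 oner_eq0.
rewrite (eq_bigr (fun k : 'I_n => \sum_(j < n) \sum_(i < n)
   (f j * (f i)^*) * (z ^+ j / z ^+ i) ^+ k)); last first.
  move=> k _; rewrite sqr_nrm /dft rmorph_sum mulr_suml; apply: eq_bigr => j _.
  rewrite mulr_sumr; apply: eq_bigr => i _.
  rewrite rmorphM rmorphXn /= (conj_unit z1) !exprM exprMn exprVn -!exprM !exprVn.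
  by rewrite mulrACA.
rewrite exchange_big /=; apply: eq_bigr => j _; rewrite exchange_big /= (bigD1 j) //=.
rewrite [X in _ + X]big1 => [|i nij].
  rewrite addr0 divff ?expf_neq0 // (eq_bigr (fun=> f j * (f j)^*)); last first.
    by move=> k _; rewrite expr1n mulr1.
  by rewrite sumr_const card_ord sqr_nrm mulr_natl.
rewrite -mulr_sumr geometric_unity ?mulr0 //.
  by rewrite exprMn exprVn -!exprM mulnC [(i * n)%N]mulnC !exprM zn !expr1n invr1 mulr1.
apply: contra nij => /eqP e; have /eqP : z ^+ j = z ^+ i.
  by rewrite -[RHS]mul1r -e divfK // expf_neq0.
by rewrite (eq_prim_root_expr zp) !modn_small // eq_sym.
Qed.

End Parseval.

Section GaussSums.
Variable R : rcfType.
Local Notation C := R[i].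

Definition legendreC (p j : nat) : R := (qchar (j%:R : 'F_p))%:~R.

Section Prime.
Variable p : nat.
Hypotheses (p_pr : prime p) (p_odd : odd p).

Lemma two_neq0_Fp : (1 + 1 : 'F_p) != 0.
Proof.
have -> : (1 + 1 : 'F_p) = 2%:R by [].
rewrite -(dvdn_pcharf (pchar_Fp p_pr)); apply/negP => /dvdn_leq.
by move/(_ isT); case: p p_pr p_odd => [|[|[|[]]]].
Qed.

Lemma natr_Fp_eq0 j : ((j%:R : 'F_p) == 0) = (p %| j)%N.
Proof. by rewrite -(dvdn_pcharf (pchar_Fp p_pr)). Qed.

Lemma legendreC_periodic : periodic p (legendreC p).
Proof.
move=> j; rewrite /legendreC natrD; congr (_%:~R); congr qchar.
by have /eqP -> : (p%:R : 'F_p) == 0; rewrite ?natr_Fp_eq0 ?dvdnn ?addr0.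
Qed.

Lemma legendreC_M i j : legendreC p (i * j) = legendreC p i * legendreC p j.
Proof. by rewrite /legendreC natrM qcharM ?intrM // two_neq0_Fp. Qed.

Lemma legendreC_dvd j : (p %| j)%N -> legendreC p j = 0.
Proof. by rewrite -natr_Fp_eq0 /legendreC => /eqP ->; rewrite qchar0. Qed.

Lemma legendreC_sqr j : ~~ (p %| j)%N -> legendreC p j ^+ 2 = 1.
Proof.
move=> nj; rewrite expr2 /legendreC -intrM -qcharM ?two_neq0_Fp // -expr2 qchar_sqr //.
by rewrite natr_Fp_eq0.
Qed.

Lemma legendreC_le1 j : `|legendreC p j| <= 1.
Proof. by rewrite /legendreC -intr_norm (ler_int R _ 1) qchar_le1. Qed.

Lemma sum_Fp (f : 'F_p -> int) : \sum_(j < p) f j%:R = \sum_(x : 'F_p) f x.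
Proof.
rewrite -(big_mkord xpredT (fun j => f j%:R)) -{1}(Fp_cast p_pr) big_mkord.
by apply: eq_bigr => x _; rewrite natr_Zp.
Qed.

Lemma legendreC_sum0 : \sum_(j < p) legendreC p j = 0.
Proof.
by rewrite -rmorph_sum (sum_Fp (@qchar _)) qchar_sum0 ?two_neq0_Fp.
Qed.

Definition gauss_sum (z : C) (k : nat) : C := dft p z (fun j => (legendreC p j)%:C) k.

Lemma gauss_sum_twist (z : C) k : z ^+ p = 1 ->
  gauss_sum z k = (legendreC p k)%:C * gauss_sum z 1.
Proof.
move=> zp; case: (boolP (p %| k)%N) => [pk|npk].
  rewrite legendreC_dvd // mul0r /gauss_sum /dft.
  rewrite (eq_bigr (fun j : 'I_p => (legendreC p j)%:C)); last first.
    by move=> j _; case/dvdnP: pk => q ->; rewrite mulnA mulnC exprM zp expr1n mulr1.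
  by rewrite -rmorph_sum legendreC_sum0.
have cop : coprime k p by rewrite coprime_sym prime_coprime.
pose f j : C := (legendreC p j)%:C * z ^+ j.
have perf : periodic p f.
  by move=> j; rewrite /f legendreC_periodic exprD zp mulr1.
rewrite /gauss_sum /dft [in RHS](eq_bigr (fun j : 'I_p => f j)); last first.
  by move=> j _; rewrite muln1.
rewrite -(sum_periodic_affine 0 (prime_gt0 p_pr) cop perf) mulr_sumr.
apply: eq_bigr => j _; rewrite /f addn0 mulrA -rmorphM legendreC_M mulrA -expr2.
by rewrite legendreC_sqr // mul1r mulnC.
Qed.

(** Parseval in place of a double sum: by [gauss_sum_twist] all p - 1 nonzero frequencies carry the
    same modulus, and the squared values of the character add up to p - 1. *)
Lemma gauss_sum_norm (z : C) : p.-primitive_root z -> nrm (gauss_sum z 1) ^+ 2 = p%:R.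
Proof.
move=> zp; have := parseval (fun j => (legendreC p j)%:C) zp.
have sqE : \sum_(j < p) nrm (legendreC p j)%:C ^+ 2 = (p%:R - 1 : R).
  rewrite (eq_bigr (fun j : 'I_p => 1 - (j == 0 :> nat)%N%:R)); last first.
    move=> j _; rewrite nrm_real; case: eqVneq => [->|j0].
      by rewrite legendreC_dvd // normr0 expr0n subrr.
    by rewrite real_normK ?num_real // legendreC_sqr ?subr0 // gtnNdvd // lt0n.
  rewrite sumrB sumr_const card_ord; congr (_ - _).
  case: p (prime_gt0 p_pr) => // q _; rewrite (bigD1 ord0) //= big1 ?addr0 //.
  by move=> i; rewrite -(inj_eq val_inj) /= => /negPf ->.
rewrite (eq_bigr (fun k : 'I_p => nrm (legendreC p k)%:C ^+ 2 * nrm (gauss_sum z 1) ^+ 2)).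
  rewrite -mulr_suml sqE mulrC => /mulIf; apply.
  by rewrite subr_eq0 (eqr_nat _ p 1) gtn_eqF // prime_gt1.
by move=> k _; rewrite -exprMn -nrmM -gauss_sum_twist // prim_expr_order.
Qed.

Lemma legendreC_unpaired_sum m1 m2 m3 m4 :
  ~~ paired (m1 %% p)%N (m2 %% p)%N (m3 %% p)%N (m4 %% p)%N ->
  (\sum_(l < p) legendreC p (l + m1) * (legendreC p (l + m2) * legendreC p (l + m3)
     * legendreC p (l + m4))) ^+ 4 <= 625 * p%:R ^+ 3 :> R.
Proof.
have eqE i j : ((i%:R : 'F_p) == j%:R) = ((i %% p)%N == (j %% p)%N).
  rewrite -(inj_eq val_inj) /= !val_Fp_nat //.
move=> npr.
have := @unpaired_sum_le 'F_p two_neq0_Fp m1%:R m2%:R m3%:R m4%:R.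
rewrite {1}/paired !eqE => /(_ npr).
rewrite -(sum_Fp (fun x => qchar (x + _) * (qchar (x + _) * qchar (x + _) * qchar (x + _)))).
rewrite card_Fp // -(ler_int R) rmorphXn rmorph_sum rmorphM rmorphXn rmorph_nat /=.
rewrite (eq_bigr (fun l : 'I_p => legendreC p (l + m1) * (legendreC p (l + m2) *
  legendreC p (l + m3) * legendreC p (l + m4)))); last first.
  by move=> l _; rewrite !rmorphM /= -!natrD.
by rewrite rmorph_nat.
Qed.

Definition modified_legendre (j : nat) : R := legendreC p j + (p %| j)%:R.

(** Here [g] is the normalised Gauss sum. The value 1 put at the multiples of [p] adds 1 at every
    frequency, which is the term [1 / sqrt p] after normalisation. *)
Lemma modified_legendre_dft (z : C) : p.-primitive_root z ->
  exists2 g : C, nrm g = 1 & forall k,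
    dft p z (fun j => (modified_legendre j)%:C) k
      = (Num.sqrt p%:R)%:C * (g * (legendreC p k)%:C + ((Num.sqrt p%:R)^-1)%:C).
Proof.
move=> zp; set q := Num.sqrt p%:R.
have q0 : q != 0 by rewrite gt_eqF // sqrtr_gt0 ltr0n prime_gt0.
have q0C : q%:C != 0 by rewrite fmorph_eq0.
have nG : nrm (gauss_sum z 1) = q.
  by rewrite -(ger0_norm (nrm_ge0 _)) -sqrtr_sqr gauss_sum_norm.
exists (gauss_sum z 1 / q%:C).
  by rewrite nrmM nG nrmV nrm_real ger0_norm ?sqrtr_ge0 // divff.
move=> k; rewrite fmorphV mulrDr divff //.
rewrite mulrA mulrCA divff // mulr1 mulrC -gauss_sum_twist ?prim_expr_order //.
rewrite /dft (eq_bigr (fun j : 'I_p => (legendreC p j)%:C * z ^+ (j * k) +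
   (j == 0 :> nat)%:R)); last first.
  move=> j _; rewrite /modified_legendre rmorphD mulrDl rmorph_nat; congr (_ + _).
  case: eqVneq => [->|j0]; first by rewrite dvdn0 mul0n expr0 mulr1.
  by rewrite gtnNdvd ?lt0n // mul0r.
rewrite big_split /=; congr (_ + _).
case: p (prime_gt0 p_pr) => // n _; rewrite (bigD1 ord0) //= big1 ?addr0 //.
by move=> i; rewrite -(inj_eq val_inj) /= => /negPf ->.
Qed.

End Prime.

(** The modulus is carried as the list of its primes, so that multiplicative statements are proved
    by induction on the list, one application of [sum_crt] at a time. *)
Definition jacobiL (ps : seq nat) (j : nat) : R := \prod_(p <- ps) legendreC p j.
Definition modified_jacobi (ps : seq nat) (j : nat) : R :=
  \prod_(p <- ps) modified_legendre p j.

Definition odd_primes ps := uniq ps && all (fun p => prime p && odd p) ps.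

Lemma coprime_prod p ps : prime p -> all prime ps -> p \notin ps -> coprime p (\prod_(q <- ps) q).
Proof.
move=> p_pr; elim: ps => [|q ps IH] /=; first by rewrite big_nil coprimen1.
case/andP=> q_pr ps_pr; rewrite inE negb_or => /andP[npq np].
by rewrite big_cons coprimeMr IH // prime_coprime // dvdn_prime2 // npq.
Qed.

Lemma odd_primes_cons p ps : odd_primes (p :: ps) ->
  [/\ prime p, odd p, odd_primes ps & coprime p (\prod_(q <- ps) q)].
Proof.
rewrite /odd_primes /= => /and3P[/andP[np ups] /andP[p_pr p_odd] aps].
split; rewrite ?ups //; apply: coprime_prod => //.
by apply: sub_all aps => q /andP[].
Qed.

Lemma prod_odd_primes_gt0 ps : odd_primes ps -> (0 < \prod_(p <- ps) p)%N.
Proof.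
elim: ps => [|p ps IH] ops; rewrite ?big_nil // big_cons.
by case/odd_primes_cons: ops => p_pr _ /IH ? _; rewrite muln_gt0 prime_gt0.
Qed.

Lemma prod_periodic ps (f : nat -> nat -> R) : (forall p, p \in ps -> periodic p (f p)) ->
  periodic (\prod_(p <- ps) p) (fun j => \prod_(p <- ps) f p j).
Proof.
move=> perf j; rewrite [LHS]big_seq [RHS]big_seq; apply: eq_bigr => p ps_p.
have /dvdnP[k ->] : (p %| \prod_(q <- ps) q)%N.
  by rewrite (perm_big _ (perm_to_rem ps_p)) big_cons dvdn_mulr.
by rewrite -(periodic_mod (perf p ps_p)) addnC modnMDl periodic_mod //; apply: perf.
Qed.

Lemma modified_legendre_periodic p : prime p -> periodic p (modified_legendre p).
Proof.
by move=> p_pr j; rewrite /modified_legendre legendreC_periodic // dvdn_addl.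
Qed.

Lemma jacobiL_periodic ps : odd_primes ps -> periodic (\prod_(p <- ps) p) (jacobiL ps).
Proof.
case/andP=> _ /allP aps; apply: prod_periodic => p /aps /andP[p_pr _].
exact: legendreC_periodic.
Qed.

Lemma modified_jacobi_periodic ps : odd_primes ps ->
  periodic (\prod_(p <- ps) p) (modified_jacobi ps).
Proof.
case/andP=> _ /allP aps; apply: prod_periodic => p /aps /andP[p_pr _].
exact: modified_legendre_periodic.
Qed.

Lemma modified_jacobi_sqr ps j : odd_primes ps -> modified_jacobi ps j ^+ 2 = 1.
Proof.
case/andP=> _ /allP aps; rewrite /modified_jacobi -prodrXl big_seq big1 // => p /aps /andP[pp po].
rewrite /modified_legendre; case: (boolP (p %| j)%N) => pj.
  by rewrite legendreC_dvd // add0r expr1n.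
by rewrite addr0 legendreC_sqr.
Qed.

Lemma jacobiL_le1 ps j : `|jacobiL ps j| <= 1.
Proof.
rewrite /jacobiL normr_prod; elim: ps => [|p ps IH]; first by rewrite big_nil.
by rewrite big_cons mulr_ile1 ?legendreC_le1 // prodr_ge0.
Qed.

(** Take the powers of [z] whose exponents are the Chinese remainder idempotents: (1, 0) and (0, 1)
    modulo (p, m). Their sum is 1 modulo p m. *)
Lemma primitive_root_split (K : fieldType) p m (z : K) : (0 < p)%N -> (0 < m)%N -> coprime p m ->
  (p * m).-primitive_root z ->
  exists u v : K, [/\ p.-primitive_root u, m.-primitive_root v & z = u * v].
Proof.
move=> p0 m0 cop zp.
have [e1 e1p e1m] : exists2 e, (e = 1 %[mod p])%N & (e = 0 %[mod m])%N.
  by exists (chinese p m 1 0); [apply: chinese_modl | apply: chinese_modr].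
have [e2 e2p e2m] : exists2 e, (e = 0 %[mod p])%N & (e = 1 %[mod m])%N.
  by exists (chinese p m 0 1); [apply: chinese_modl | apply: chinese_modr].
exists (z ^+ e1), (z ^+ e2); split.
- have := exp_prim_root zp e1.
  suff -> : gcdn e1 (p * m) = m by rewrite mulnK.
  rewrite mulnC Gauss_gcdl; last first.
    by rewrite coprime_sym /coprime -gcdn_modr e1p gcdn_modr gcdn1.
  by apply/gcdn_idPr; rewrite /dvdn e1m mod0n.
- have := exp_prim_root zp e2.
  suff -> : gcdn e2 (p * m) = p by rewrite mulKn.
  rewrite Gauss_gcdl.
    by apply/gcdn_idPr; rewrite /dvdn e2p mod0n.
  by rewrite coprime_sym /coprime -gcdn_modr e2m gcdn_modr gcdn1.
rewrite -exprD -[LHS]expr1; apply/eqP; rewrite (eq_prim_root_expr zp) chinese_remainder //.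
by rewrite -modnDm e1p e2p modnDm addn0 eqxx -modnDm e1m e2m modnDm add0n eqxx.
Qed.

(** The transform factors over the primes, and each normalised factor is a unimodular multiple of
    the character plus an error of at most [1 / sqrt P]. Expanding the product and removing the term
    made of main parts only gives the bound. *)
Lemma modified_jacobi_dft ps P (z : C) : odd_primes ps -> all (leq P) ps -> (0 < P)%N ->
  (\prod_(p <- ps) p)%N.-primitive_root z ->
  exists2 g : C, nrm g = 1 & forall k,
    nrm (dft (\prod_(p <- ps) p)%N z (fun j => (modified_jacobi ps j)%:C) k
          / (Num.sqrt (\prod_(p <- ps) p)%N%:R)%:C - g * (jacobiL ps k)%:C)
    <= (1 + (Num.sqrt P%:R)^-1) ^+ size ps - 1.
Proof.
move=> + + P0; elim: ps z => [|p ps IH] z.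
  move=> _ _ _; exists 1 => [|k]; first exact: nrm1.
  rewrite /dft big_nil big_ord1 /modified_jacobi /jacobiL !big_nil mul0n expr0.
  by rewrite sqrtr1 expr0 !rmorph1 invr1 !mulr1 !subrr nrm0.
case/odd_primes_cons=> p_pr p_odd ops cop /= /andP[Pp Pps].
set m := (\prod_(q <- ps) q)%N in IH cop *.
have m0 : (0 < m)%N := prod_odd_primes_gt0 ops.
have p0 := prime_gt0 p_pr.
rewrite big_cons -/m => /(primitive_root_split p0 m0 cop)[u [v [up vm ->]]].
have {IH} [g g1 IH] := IH v ops Pps vm.
have [g' g'1 pE] := modified_legendre_dft p_pr p_odd up.
exists (g' * g) => [|k]; first by rewrite nrmM g1 g'1 mulr1.
have -> : dft (p * m) (u * v) (fun j => (modified_jacobi (p :: ps) j)%:C) k =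
   dft p u (fun j => (modified_legendre p j)%:C) k
   * dft m v (fun j => (modified_jacobi ps j)%:C) k.
  rewrite /dft -(sum_crt (F := fun j => (modified_legendre p j)%:C * u ^+ (j * k))
    (G := fun j => (modified_jacobi ps j)%:C * v ^+ (j * k))) //.
  - apply: eq_bigr => j _; rewrite /modified_jacobi big_cons rmorphM exprMn.
    by rewrite mulrACA.
  - move=> j; rewrite modified_legendre_periodic // mulnDl exprD [u ^+ (p * k)]exprM.
    by rewrite (prim_expr_order up) expr1n mulr1.
  move=> j; rewrite modified_jacobi_periodic // mulnDl exprD [v ^+ (m * k)]exprM.
  by rewrite (prim_expr_order vm) expr1n mulr1.
have q0 : Num.sqrt p%:R != 0 :> R by rewrite gt_eqF // sqrtr_gt0 ltr0n.
rewrite natrM sqrtrM ?ler0n // rmorphM invfM pE /jacobiL big_cons -/(jacobiL _ _) rmorphM /=.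
set A := g' * _; set B := dft m _ _ _; set q := Num.sqrt _; set s := Num.sqrt m%:R.
set chi := (jacobiL ps k)%:C; set chp := (legendreC p k)%:C.
have q0C : q%:C != 0 by rewrite fmorph_eq0.
(* The error is split into 1 / sqrt p times the old transform, of modulus at most [E], plus a factor
   of modulus at most 1 times the old error [E - 1]. The resulting bound E / sqrt P + E - 1 is the
   required one. *)
have -> : q%:C * (A + (q^-1)%:C) * B * (q%:C^-1 * s%:C^-1) - g' * g * (chp * chi)
   = (q^-1)%:C * (B / s%:C) + A * (B / s%:C - g * chi).
  rewrite /A -/chp; move: (B) (s%:C^-1) ((q^-1)%:C) => b t r.
  rewrite [LHS](_ : _ = (q%:C / q%:C) * (g' * chp + r) * (b * t) - g' * g * (chp * chi));
    last by ring.
  by rewrite divff //; ring.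
set E := (1 + _) ^+ _ in IH *.
have {}IH : nrm (B / s%:C - g * chi) <= E - 1 := IH k.
have A1 : nrm A <= 1.
  by rewrite nrmM g'1 mul1r nrm_real legendreC_le1.
have B1 : nrm (B / s%:C) <= E.
  have -> : B / s%:C = (B / s%:C - g * chi) + g * chi by rewrite subrK.
  apply: le_trans (nrmD _ _) _; rewrite -[leRHS](subrK 1) lerD //.
  by rewrite nrmM g1 mul1r nrm_real jacobiL_le1.
have qP : nrm (q^-1)%:C <= (Num.sqrt P%:R)^-1.
  rewrite nrm_real ger0_norm ?invr_ge0 ?sqrtr_ge0 // lef_pV2 ?posrE ?sqrtr_gt0 ?ltr0n //.
  by rewrite ler_wsqrtr // ler_nat.
apply: le_trans (nrmD _ _) _; rewrite [nrm (_ * (B / _))]nrmM [nrm (A * _)]nrmM.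
apply: (@le_trans _ _ ((Num.sqrt P%:R)^-1 * E + 1 * (E - 1))); last first.
  by rewrite exprS -/E; apply: le_of_eq; ring.
by apply: lerD; apply: ler_pM => //; apply: nrm_ge0.
Qed.

(** Only the prime at the head of the list yields cancellation; the sum over the complementary
    modulus is bounded by its length. *)
Lemma jacobiL_unpaired_sum p ps m1 m2 m3 m4 : odd_primes (p :: ps) ->
  ~~ paired (m1 %% p)%N (m2 %% p)%N (m3 %% p)%N (m4 %% p)%N ->
  (\sum_(l < \prod_(q <- p :: ps) q) jacobiL (p :: ps) (l + m1) * (jacobiL (p :: ps) (l + m2)
     * jacobiL (p :: ps) (l + m3) * jacobiL (p :: ps) (l + m4))) ^+ 4
  <= 625 * p%:R ^+ 3 * (\prod_(q <- ps) q)%:R ^+ 4.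
Proof.
case/odd_primes_cons=> p_pr p_odd ops cop npr.
pose T l (f : nat -> R) := f (l + m1)%N * (f (l + m2)%N * f (l + m3)%N * f (l + m4)%N).
have perT k (f : nat -> R) : periodic k f -> periodic k (fun l => T l f).
  by move=> pf l; rewrite /T ![(l + k + _)%N]addnAC !pf.
rewrite big_cons.
have -> : \sum_(l < p * \prod_(q <- ps) q) T l (jacobiL (p :: ps)) =
    \sum_(l < p * \prod_(q <- ps) q) T l (legendreC p) * T l (jacobiL ps).
  apply: eq_bigr => l _; rewrite /T /jacobiL !big_cons [RHS]mulrACA; congr (_ * _).
  by rewrite [RHS]mulrACA; congr (_ * _); rewrite mulrACA.
have perP := perT _ _ (legendreC_periodic p_pr).
have perM := perT _ _ (jacobiL_periodic ops).
rewrite (sum_crt (prime_gt0 p_pr) (prod_odd_primes_gt0 ops) cop perP perM).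
rewrite exprMn ler_pM ?exprn_even_ge0 ?legendreC_unpaired_sum //.
rewrite -[leLHS]ger0_norm ?exprn_even_ge0 // normrX lerXn2r ?nnegrE //.
apply: le_trans (ler_norm_sum _ _ _) _.
apply: (@le_trans _ _ (\sum_(l < \prod_(q <- ps) q) 1)); last by rewrite sumr_const card_ord.
apply: ler_sum => l _; rewrite /T !normrM !mulr_ile1 ?mulr_ge0 ?jacobiL_le1 //.
Qed.

End GaussSums.

(** * The interpolation kernel *)

Lemma sum_arith_geom (K : comPzRingType) (N y : K) k :
  (1 - y) ^+ 2 * (\sum_(d < k) (N - 2 * d%:R) * y ^+ d)
  = N * (1 - y) * (1 - y ^+ k) - 2 * (y - k%:R * y ^+ k + (k%:R - 1) * y ^+ k.+1).
Proof.
elim: k => [|k IH]; first by rewrite big_ord0 expr0 expr1; ring.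
by rewrite big_ord_recr /= mulrDr IH -natr1 !exprS; ring.
Qed.

Lemma sum_arith_sqr (K : fieldType) n : 3%:R != 0 :> K ->
  \sum_(d < n) (n%:R - 2 * d%:R) ^+ 2 = n%:R * (n%:R ^+ 2 + 2) / 3%:R :> K.
Proof.
move=> K3.
have gen (N : K) k : \sum_(d < k) (N - 2 * d%:R) ^+ 2
  = (3%:R * (N ^+ 2 * k%:R - 2 * N * (k%:R * (k%:R - 1)))
     + 2 * (k%:R * (k%:R - 1) * (2 * k%:R - 1))) / 3%:R.
  elim: k => [|k IH]; first by rewrite big_ord0; field.
  by rewrite big_ord_recr /= IH -natr1; field.
by rewrite gen; field.
Qed.

Section Kernel.
Variable R : rcfType.
Local Notation C := R[i].
Variables (n s : nat) (z : C).
Hypotheses (n_gt0 : (0 < n)%N) (z_prim : (2 * n).-primitive_root z).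

Let w := z ^+ 2.

Lemma z_exp_n : z ^+ n = -1.
Proof.
have e : (z ^+ n) ^+ 2 = 1 by rewrite -exprM mulnC (prim_expr_order z_prim).
move/eqP: e; rewrite sqrf_eq1 => /orP[|/eqP //].
by rewrite -(prim_order_dvd z_prim) => /dvdn_leq -/(_ n_gt0); lia.
Qed.

Lemma w_prim : n.-primitive_root w.
Proof.
have := exp_prim_root z_prim 2; suff -> : gcdn 2 (2 * n) = 2%N by rewrite mulKn.
by apply/gcdn_idPl; rewrite dvdn_mulr.
Qed.

Lemma nrm_z : nrm z = 1.
Proof. by apply: (@nrm_unity _ _ (2 * n)); rewrite ?muln_gt0 ?(prim_expr_order z_prim). Qed.

Lemma z_neq0 : z != 0.
Proof. by rewrite -nrm_eq0 nrm_z oner_eq0. Qed.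

Lemma nrm_w : nrm w = 1.
Proof. by rewrite nrmX nrm_z expr1n. Qed.

Let y m := z ^+ (2 * m + 1).

Lemma y_exp_n m : y m ^+ n = -1.
Proof. by rewrite -exprM mulnC exprM z_exp_n -signr_odd addn1 /= mul2n odd_double. Qed.

Lemma y_neq1 m : y m != 1.
Proof.
apply/eqP => y1; have := y_exp_n m; rewrite y1 expr1n => /eqP.
by rewrite -subr_eq0 opprK -(natrD _ 1 1) pnatr_eq0.
Qed.

Lemma sum_w_exp k : \sum_(m < n) w ^+ (k * m) = if (n %| k)%N then n%:R else 0.
Proof.
under eq_bigr do rewrite exprM.
case: ifP => nk.
  have /eqP -> : w ^+ k == 1 by rewrite -(prim_order_dvd w_prim).
  by rewrite (eq_bigr (fun=> 1)) ?sumr_const ?card_ord // => i _; rewrite expr1n.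
apply: geometric_unity; last by rewrite -(prim_order_dvd w_prim) nk.
by rewrite -exprM mulnC exprM (prim_expr_order w_prim) expr1n.
Qed.

(* Interpolation weights: [z ^+ j = \sum_m kernel m * w ^- (m * (j + s))] for [j < n]. *)
Definition kernel m : C := n%:R^-1 * (w ^+ (m * s) * \sum_(j < n) y m ^+ j).

Lemma sum_y m : (\sum_(j < n) y m ^+ j) * (1 - y m) = 2.
Proof.
have := subrX1 (y m) n; rewrite y_exp_n => H.
rewrite -opprB mulrN mulrC -H; ring.
Qed.

Lemma nrm_kernel m : n%:R * nrm (kernel m) * nrm (1 - z ^+ (2 * m + 1)) = 2.
Proof.
have n0 : n%:R != 0 :> C by rewrite pnatr_eq0 -lt0n.
have -> : n%:R * nrm (kernel m) = nrm (\sum_(j < n) y m ^+ j).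
  have <- : nrm (n%:R : C) = n%:R.
    have -> : (n%:R : C) = (n%:R : R)%:C by rewrite rmorph_nat.
    by rewrite nrm_real normr_nat.
  by rewrite -nrmM /kernel mulrA divff // mul1r nrmM nrmX nrm_w expr1n mul1r.
rewrite -nrmM sum_y; have -> : (2 : C) = (2 : R)%:C by rewrite rmorph_nat.
by rewrite nrm_real normr_nat.
Qed.

(** The exponents 2 m + 1 and 2 (n - 1 - m) + 1 add up to 2 n, so the two roots involved are
    conjugate. Thus size bounds are needed for the lower half of the indices only. *)
Lemma kernel_rev m : (m < n)%N -> nrm (kernel (n.-1 - m)) = nrm (kernel m).
Proof.
move=> mn; have h1 := nrm_kernel m; have h2 := nrm_kernel (n.-1 - m).
have e : nrm (1 - z ^+ (2 * (n.-1 - m) + 1)) = nrm (1 - z ^+ (2 * m + 1)).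
  have <- : (z ^+ (2 * m + 1))^* = z ^+ (2 * (n.-1 - m) + 1).
    rewrite rmorphXn /= (conj_unit nrm_z) exprVn; apply: (mulfI (expf_neq0 (2 * m + 1) z_neq0)).
    rewrite divff ?expf_neq0 ?z_neq0 // -exprD.
    have -> : (2 * m + 1 + (2 * (n.-1 - m) + 1) = 2 * n)%N by lia.
    by rewrite (prim_expr_order z_prim).
  by rewrite -{1}[1]conjC1 -rmorphB /= nrm_conj.
move: h2; rewrite e -h1 => /mulIf /mulfI -> //.
  by rewrite pnatr_eq0 -lt0n.
by rewrite nrm_eq0 subr_eq0 eq_sym y_neq1.
Qed.

(** The chord bound on [1 - z ^+ (2 * m + 1)] is a hypothesis because it depends on which primitive
    root [z] is. It holds for the root exp(i PI / n), by [zeta_far]. *)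
Lemma kernel_le m : (2 * m + 1 <= n)%N ->
  2 * (2 * m + 1)%:R / n%:R <= nrm (1 - z ^+ (2 * m + 1)) ->
  nrm (kernel m) <= (2 * m + 1)%:R^-1.
Proof.
move=> mn h; have n0 : 0 < n%:R :> R by rewrite ltr0n.
have m0 : 0 < (2 * m + 1)%:R :> R by rewrite ltr0n addn1.
rewrite -(ler_pM2r m0) mulVf ?gt_eqF //.
have := ler_wpM2l (mulr_ge0 (ltW n0) (nrm_ge0 (kernel m))) h; rewrite nrm_kernel.
have -> : n%:R * nrm (kernel m) * (2 * (2 * m + 1)%:R / n%:R) =
    2 * (nrm (kernel m) * (2 * m + 1)%:R) by field; rewrite gt_eqF.
by move: (nrm _ * _) => x; lra.
Qed.

Lemma sum_nrm_kernel_sqr : \sum_(m < n) nrm (kernel m) ^+ 2 = 1.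
Proof.
have n0 : n%:R != 0 :> R by rewrite pnatr_eq0 -lt0n.
have := parseval (fun j => z ^+ j) w_prim.
rewrite [X in _ * X](eq_bigr (fun=> 1)) => [|j _]; last by rewrite nrmX nrm_z !expr1n.
rewrite sumr_const card_ord => H.
have -> : \sum_(m < n) nrm (kernel m) ^+ 2 =
   n%:R^-1 ^+ 2 * \sum_(m < n) nrm (dft n w (fun j => z ^+ j) m) ^+ 2.
  rewrite mulr_sumr; apply: eq_bigr => m _; rewrite /kernel nrmM nrmM nrmX nrm_w expr1n mul1r.
  have -> : (n%:R^-1 : C) = (n%:R^-1 : R)%:C by rewrite fmorphV rmorph_nat.
  rewrite nrm_real ger0_norm ?invr_ge0 ?ler0n // exprMn; congr (_ * nrm _ ^+ 2).
  apply: eq_bigr => j _; rewrite -!exprM -exprD; congr (z ^+ _); lia.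
by rewrite H; field.
Qed.

Lemma sum_arith_geom_y m :
  (\sum_(d < n) (n%:R - 2 * d%:R) * y m ^+ d) * (1 - y m) ^+ 2 = - 4 * y m.
Proof. by rewrite mulrC sum_arith_geom exprS y_exp_n; ring. Qed.

(** With y on the unit circle and y^n = -1, both |sum y^j|^2 and sum (n - 2 d) y^d equal -4 y / (1 -
    y)^2. So the squared modulus of the kernel is itself a discrete Fourier transform, and Parseval
    evaluates its fourth powers. *)
Lemma nrm_kernel_sqr m : (nrm (kernel m) ^+ 2)%:C =
  n%:R^-1 ^+ 2 * dft n w (fun d => (n%:R - 2 * d%:R) * z ^+ d) m.
Proof.
have y0 : y m != 0 by rewrite expf_neq0 // z_neq0.
have y1 : 1 - y m != 0 by rewrite subr_eq0 eq_sym y_neq1.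
have n0 : n%:R != 0 :> C by rewrite pnatr_eq0 -lt0n.
have -> : dft n w (fun d => (n%:R - 2 * d%:R) * z ^+ d) m =
   \sum_(d < n) (n%:R - 2 * d%:R) * y m ^+ d.
  apply: eq_bigr => d _; rewrite -mulrA -!exprM -exprD; congr (_ * z ^+ _); lia.
set S := \sum_(d < n) _; have SE : S * (1 - y m) ^+ 2 = - 4 * y m := sum_arith_geom_y m.
have cy : (y m)^* = (y m)^-1.
  by apply: conj_unit; rewrite nrmX nrm_z expr1n.
rewrite sqr_nrm /kernel; set G := \sum_(j < n) _.
have GE : G * (1 - y m) = 2 := sum_y m.
have cG : G^* * (1 - (y m)^-1) = 2.
  have := congr1 (fun x : C => x^*) GE; rewrite rmorphM rmorphB /= cy rmorph1.
  by rewrite rmorph_nat.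
have ww : w ^+ (m * s) * (w ^+ (m * s))^* = 1.
  by rewrite -sqr_nrm nrmX nrm_w !expr1n.
rewrite !rmorphM fmorphV rmorph_nat /=.
transitivity (n%:R^-1 ^+ 2 * (w ^+ (m * s) * (w ^+ (m * s))^*) * (G * G^*)); first by ring.
rewrite ww mulr1; congr (_ * _).
apply: (mulIf (expf_neq0 2 y1)); rewrite SE.
transitivity (G * (1 - y m) * (G^* * (1 - (y m)^-1)) * (- y m)); first by field.
by rewrite GE cG; ring.
Qed.

Lemma sum_nrm_kernel_4 :
  \sum_(m < n) nrm (kernel m) ^+ 4 = (n%:R ^+ 2 + 2) / (3 * n%:R ^+ 2).
Proof.
have n0 : n%:R != 0 :> R by rewrite pnatr_eq0 -lt0n.
have := parseval (fun d => (n%:R - 2 * d%:R) * z ^+ d) w_prim.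
have -> : \sum_(j < n) nrm ((n%:R - 2 * j%:R) * z ^+ j) ^+ 2 = n%:R * (n%:R ^+ 2 + 2) / 3%:R.
  rewrite -sum_arith_sqr ?pnatr_eq0 //; apply: eq_bigr => d _.
  rewrite nrmM nrmX nrm_z expr1n mulr1.
  have -> : n%:R - 2 * d%:R = (n%:R - 2 * d%:R : R)%:C.
    by rewrite rmorphB rmorphM !rmorph_nat.
  by rewrite nrm_real real_normK ?num_real.
move=> H; have -> : \sum_(m < n) nrm (kernel m) ^+ 4 = n%:R^-1 ^+ 4 *
   \sum_(m < n) nrm (dft n w (fun d => (n%:R - 2 * d%:R) * z ^+ d) m) ^+ 2.
  rewrite mulr_sumr; apply: eq_bigr => m _.
  have := congr1 (@nrm R) (nrm_kernel_sqr m); rewrite [nrm (_ * dft _ _ _ _)]nrmM nrmX.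
  have -> : (n%:R^-1 : C) = (n%:R^-1 : R)%:C by rewrite fmorphV rmorph_nat.
  rewrite !nrm_real !ger0_norm ?invr_ge0 ?ler0n ?exprn_ge0 ?nrm_ge0 // => e.
  by rewrite -[4%N]/(2 * 2)%N exprM e exprMn -exprM.
by rewrite H; field.
Qed.

(** The same closed form makes the square of the kernel a combination of powers of w^m, with
    exponents d + 2 s - 1; [n.-1] stands for -1. Summing over [m] keeps the single [d] that makes
    the exponent divisible by [n], namely [d0]. *)
Lemma nrm_sum_kernel_sqr d0 : (d0 < n)%N -> (n %| d0 + 2 * s + n.-1)%N ->
  nrm (\sum_(m < n) kernel m ^+ 2) = `|n%:R - 2 * d0%:R| / n%:R.
Proof.
move=> d0n dv; have n0 : n%:R != 0 :> C by rewrite pnatr_eq0 -lt0n.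
have kE m : kernel m ^+ 2 = - (n%:R^-1 ^+ 2 * \sum_(d < n) (n%:R - 2 * d%:R) *
    (z ^+ d / z * w ^+ ((d + 2 * s + n.-1) * m))).
  have y0 : y m != 0 by rewrite expf_neq0 // z_neq0.
  have y1 : 1 - y m != 0 by rewrite subr_eq0 eq_sym y_neq1.
  have -> : \sum_(d < n) (n%:R - 2 * d%:R) * (z ^+ d / z * w ^+ ((d + 2 * s + n.-1) * m))
     = (w ^+ (m * s)) ^+ 2 / y m * \sum_(d < n) (n%:R - 2 * d%:R) * y m ^+ d.
    rewrite mulr_sumr; apply: eq_bigr => d _; rewrite [RHS]mulrCA; congr (_ * _).
    have e : z ^+ d * w ^+ ((d + 2 * s + n.-1) * m) * y m = (w ^+ (m * s)) ^+ 2 * y m ^+ d * z.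
      rewrite -!exprM -!exprD -exprSr; apply/eqP; rewrite (eq_prim_root_expr z_prim).
      rewrite (_ : (d + _ + _)%N = (m * (2 * n) + (2 * (m * s * 2) + (2 * m + 1) * d).+1)%N).
        by rewrite modnMDl.
      by nia.
    apply: (mulIf y0); apply: (mulIf z_neq0).
    transitivity (z ^+ d * w ^+ ((d + 2 * s + n.-1) * m) * y m).
      by field; apply: z_neq0.
    by rewrite e; field.
  set S := \sum_(d < n) _; have SE : S * (1 - y m) ^+ 2 = - 4 * y m := sum_arith_geom_y m.
  rewrite /kernel; set G := \sum_(j < n) _.
  have GE : G * (1 - y m) = 2 := sum_y m.
  move: (w ^+ (m * s)) => W; rewrite !exprMn -mulrN; congr (_ * _).
  apply: (mulIf (expf_neq0 2 y1)).
  transitivity (W ^+ 2 * (G * (1 - y m)) ^+ 2); first by ring.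
  transitivity (- (W ^+ 2 / y m * (S * (1 - y m) ^+ 2))); last by ring.
  by rewrite GE SE; field.
rewrite (eq_bigr _ (fun (m : 'I_n) _ => kE m)) sumrN nrmN -mulr_sumr exchange_big /=.
rewrite (eq_bigr (fun d : 'I_n => (n%:R - 2 * d%:R) * (z ^+ d / z) *
   (if (n %| d + 2 * s + n.-1)%N then n%:R else 0))); last first.
  by move=> d _; rewrite -sum_w_exp mulr_sumr; apply: eq_bigr => m _; rewrite !mulrA.
rewrite (bigD1 (Ordinal d0n)) //= dv big1 ?addr0; last first.
  move=> d nd; rewrite ifN ?mulr0 //; apply: contra nd => dv2.
  rewrite -(inj_eq val_inj) /= -(modn_small (ltn_ord d)) -(modn_small d0n).
  by rewrite -(eqn_modDr (2 * s + n.-1)) [(d + _)%N]addnA [(d0 + _)%N]addnA (eqP dv) (eqP dv2).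
have <- : (n%:R - 2 * d0%:R : R)%:C = n%:R - 2 * d0%:R by rewrite rmorphB rmorphM !rmorph_nat.
have -> : (n%:R : C) = (n%:R : R)%:C by rewrite rmorph_nat.
rewrite !nrmM !nrmX !nrmV !nrm_real nrm_z expr1n invr1 !mulr1 normr_nat.
by field; rewrite pnatr_eq0 -lt0n.
Qed.

End Kernel.

(** * Values of the polynomial at the 2n-th roots of unity *)

Section Interpolation.
Variable R : rcfType.
Local Notation C := R[i].
Variables (n s : nat) (z : C) (a : nat -> R).
Hypotheses (n_gt0 : (0 < n)%N) (z_prim : (2 * n).-primitive_root z).
Hypotheses (a_per : periodic n a) (a_sqr : forall j, a j ^+ 2 = 1).

Let w := z ^+ 2.
Let wprim : n.-primitive_root w := w_prim z_prim.
Let w_neq0 : w != 0.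
Proof. by rewrite expf_neq0 ?(z_neq0 n_gt0 z_prim). Qed.
Let wn : w ^+ n = 1 := prim_expr_order wprim.

Lemma winv_prim : n.-primitive_root w^-1.
Proof.
have e : w^-1 = w ^+ n.-1.
  by apply: (mulfI w_neq0); rewrite divff // -exprS prednK.
have := exp_prim_root wprim n.-1; rewrite -e.
have /eqP -> : coprime n.-1 n by rewrite coprimePn.
by rewrite divn1.
Qed.

Let sqn : R := Num.sqrt n%:R.
Let sqn_gt0 : 0 < sqn.
Proof. by rewrite sqrtr_gt0 ltr0n. Qed.
Let sqn2 : sqn ^+ 2 = n%:R.
Proof. by rewrite sqr_sqrtr. Qed.

Definition nfourier k : C := dft n w^-1 (fun j => (a j)%:C) k / sqn%:C.

Lemma nrm_a j : nrm (a j)%:C = 1.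
Proof.
rewrite nrm_real; have := a_sqr j => /eqP; rewrite sqrf_eq1 => /orP[] /eqP ->.
  by rewrite normr1.
by rewrite normrN1.
Qed.

(** A combination of translates is the transform of [a] times the transform of [d]. Parseval is used
    twice, and [a] drops out in between because its values have modulus 1. *)
Lemma nfourier_orth (d : nat -> C) :
  \sum_(l < n) nrm (\sum_(m < n) d m * nfourier (l + m)) ^+ 2
  = n%:R * \sum_(m < n) nrm (d m) ^+ 2.
Proof.
have e l : \sum_(m < n) d m * nfourier (l + m) =
    dft n w^-1 (fun j => (a j)%:C * dft n w^-1 d j / sqn%:C) l.
  rewrite /nfourier /dft; under eq_bigr do rewrite mulr_suml mulr_sumr.
  rewrite exchange_big /=; apply: eq_bigr => j _.
  rewrite mulr_sumr !mulr_suml; apply: eq_bigr => m _.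
  by rewrite mulnDr exprD [(j * m)%N]mulnC; ring.
rewrite (eq_bigr _ (fun (l : 'I_n) _ => congr1 (fun x => nrm x ^+ 2) (e l))).
rewrite parseval ?winv_prim // -(parseval d winv_prim) mulr_sumr; apply: eq_bigr => j _.
rewrite !nrmM nrm_a mul1r nrmV nrm_real (gtr0_norm sqn_gt0) -sqn2.
by field; rewrite gt_eqF.
Qed.

(** Fourier inversion modulo [n], with [n - j] in the role of [- j]. The range of [j] matters: the
    left side is periodic in [j], whereas z^j changes sign when [j] grows by [n]. *)
Lemma kernel_dual j : (j < n)%N ->
  \sum_(m < n) kernel n s z m * w^-1 ^+ (m * (j + s)) = z ^+ j.
Proof.
move=> jn; have n0 : n%:R != 0 :> C by rewrite pnatr_eq0 -lt0n.
rewrite (eq_bigr (fun m : 'I_n => n%:R^-1 * \sum_(j' < n) z ^+ j' * w ^+ ((j' + (n - j)) * m))).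
  rewrite -mulr_sumr exchange_big /=.
  rewrite (eq_bigr (fun j' : 'I_n => z ^+ j' * (if (n %| j' + (n - j))%N then n%:R else 0))).
    rewrite (bigD1 (Ordinal jn)) //= subnKC ?dvdnn ?big1 ?addr0; first by field.
      move=> i; rewrite -(inj_eq val_inj) /= => nij; rewrite ifN ?mulr0 //.
      apply: contra nij => /dvdnP[k e]; have := ltn_ord i; move: e => + iN.
      by case: k => [|[|k]]; lia.
    exact: ltnW.
  by move=> i _; rewrite -(sum_w_exp z_prim) mulr_sumr.
move=> m _; rewrite /kernel -/w -mulrA; congr (_ * _); rewrite mulrAC mulr_sumr.
apply: eq_bigr => i _; rewrite exprVn.
have W0 := expf_neq0 (m * (j + s)) w_neq0.
apply: (mulIf W0); rewrite mulrAC divfK // -!mulrA -exprD.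
have -> : ((i + (n - j)) * m + m * (j + s) = n * m + m * (s + i))%N by nia.
rewrite [w ^+ (n * m + _)]exprD [w ^+ (n * m)]exprM wn expr1n mul1r -!exprM -!exprD; congr (z ^+ _).
by nia.
Qed.

Lemma poly_odd_roots l :
  nrm (\sum_(j < n) (a (j + s))%:C * (z * w^-1 ^+ l) ^+ j)
  = sqn * nrm (\sum_(m < n) kernel n s z m * nfourier (l + m)).
Proof.
(* By [kernel_dual] this is the periodic sequence with value z^j at j + s for j < n, so the twisted
   coefficients can be summed over any full period and the rotation only produces a phase. *)
pose D i := \sum_(m < n) kernel n s z m * w^-1 ^+ (m * i).
have vn : w^-1 ^+ n = 1 by rewrite exprVn wn invr1.
have perD : periodic n D.
  move=> i; apply: eq_bigr => m _; rewrite mulnDr exprD [w^-1 ^+ (m * n)]exprM.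
  by rewrite exprAC vn expr1n mulr1.
pose f i := (a i)%:C * w^-1 ^+ (i * l) * D i.
have perf : periodic n f.
  move=> i; rewrite /f perD a_per mulnDl exprD [w^-1 ^+ (n * l)]exprM vn expr1n mulr1.
  by [].
have e : sqn%:C * \sum_(m < n) kernel n s z m * nfourier (l + m)
   = w^-1 ^+ (s * l) * \sum_(j < n) (a (j + s))%:C * (z * w^-1 ^+ l) ^+ j.
  transitivity (\sum_(i < n) f i).
    rewrite mulr_sumr /nfourier /dft.
    rewrite (eq_bigr (fun m : 'I_n => \sum_(j < n) kernel n s z m *
      ((a j)%:C * w^-1 ^+ (j * (l + m))))); last first.
      move=> m _; rewrite -mulr_sumr mulrCA [sqn%:C * _]mulrC divfK //.
      by rewrite fmorph_eq0 gt_eqF.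
    rewrite exchange_big /=; apply: eq_bigr => i _; rewrite /f /D mulr_sumr.
    apply: eq_bigr => m _; rewrite mulnDr exprD [(i * m)%N]mulnC.
    by ring.
  rewrite -(sum_periodic_shift s perf) mulr_sumr; apply: eq_bigr => j _.
  rewrite /f /D kernel_dual // mulnDl exprD exprMn -!exprM [(l * j)%N]mulnC.
  by ring.
have := congr1 (@nrm R) e; rewrite nrmM nrm_real (gtr0_norm sqn_gt0) => ->.
by rewrite nrmM nrmX nrmV (nrm_w n_gt0 z_prim) invr1 expr1n mul1r.
Qed.

Lemma poly_even_roots l :
  nrm (\sum_(j < n) (a (j + s))%:C * (w^-1 ^+ l) ^+ j) = sqn * nrm (nfourier l).
Proof.
have vn : w^-1 ^+ n = 1 by rewrite exprVn wn invr1.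
pose f i := (a i)%:C * w^-1 ^+ (i * l).
have perf : periodic n f.
  by move=> i; rewrite /f a_per mulnDl exprD [w^-1 ^+ (n * l)]exprM vn expr1n mulr1.
have e : sqn%:C * nfourier l
   = w^-1 ^+ (s * l) * \sum_(j < n) (a (j + s))%:C * (w^-1 ^+ l) ^+ j.
  rewrite /nfourier mulrC divfK ?fmorph_eq0 ?gt_eqF // -/(\sum_(i < n) f i).
  rewrite /dft -/(\sum_(i < n) f i) -(sum_periodic_shift s perf) mulr_sumr; apply: eq_bigr => j _.
  by rewrite /f mulnDl exprD -!exprM [(l * j)%N]mulnC; ring.
have := congr1 (@nrm R) e; rewrite nrmM nrm_real (gtr0_norm sqn_gt0) => ->.
by rewrite nrmM nrmX nrmV (nrm_w n_gt0 z_prim) invr1 expr1n mul1r.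
Qed.

End Interpolation.

(** * Fourth moments *)

Section FourthMoment.
Variable R : rcfType.
Local Notation C := R[i].

Lemma sum4_prod (K : comPzRingType) n (f g h k : 'I_n -> K) :
  \sum_i \sum_j \sum_a \sum_b f i * g j * (h a * k b)
  = (\sum_i f i) * (\sum_j g j) * ((\sum_a h a) * (\sum_b k b)).
Proof.
rewrite big_distrlr /= mulr_suml; apply: eq_bigr => i _; rewrite mulr_suml; apply: eq_bigr => j _.
rewrite big_distrlr mulr_sumr; apply: eq_bigr => a _; rewrite mulr_sumr; exact: eq_bigr.
Qed.

Lemma nrm4_sum n (u : 'I_n -> C) (x : 'I_n -> R) :
  (nrm (\sum_i u i * (x i)%:C) ^+ 4)%:C =
  \sum_i \sum_j \sum_a \sum_b
     (u i * (u j)^*) * (u a * (u b)^*) * (x i * (x j * x a * x b))%:C.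
Proof.
rewrite -[4%N]/(2 * 2)%N exprM rmorphXn /= sqr_nrm rmorph_sum expr2 -sum4_prod.
apply: eq_bigr => i _; apply: eq_bigr => j _; apply: eq_bigr => a _; apply: eq_bigr => b _.
have cR (t : R) : (t%:C)^* = t%:C by apply: conjc_real.
rewrite !rmorphM /= !cR; move: (u i) (u j)^* (u a) (u b)^* => ? ? ? ?.
by move: (_%:C) (_%:C) (_%:C) (_%:C) => ? ? ? ?; ring.
Qed.

(** Inclusion-exclusion: two different matchings hold together only when all four indices coincide,
    and such a quadruple is counted three times. Written with indicators, the condition [paired] can
    be summed in closed form. *)
Definition pairings (K : pzRingType) (T : eqType) (i j a b : T) : K :=
  (i == j)%:R * (a == b)%:R + (i == b)%:R * (j == a)%:R + (i == a)%:R * (j == b)%:R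
  - 2 * ((i == j)%:R * (a == b)%:R * (i == a)%:R).

Lemma pairingsE (K : pzRingType) (T : eqType) (i j a b : T) :
  pairings K i j a b = (paired i j a b)%:R.
Proof.
rewrite /pairings /paired.
case: (i =P j) => ?; case: (a =P b) => ?; case: (i =P b) => ?; case: (j =P a) => ?;
case: (i =P a) => ?; case: (j =P b) => ? //=; try congruence;
rewrite ?(mulr0, mul0r, mulr1, addr0, add0r, subr0) //.
by rewrite addrAC -mulr2n subrr add0r.
Qed.

Lemma sum_deltal (K : pzRingType) n (i : 'I_n) (f : 'I_n -> K) :
  \sum_j (i == j)%:R * f j = f i.
Proof.
rewrite (bigD1 i) //= eqxx mul1r big1 ?addr0 // => j; rewrite eq_sym => /negPf ->.
by rewrite mul0r.
Qed.

(** Two of the matchings join each index with a conjugated one and give the square of the sum of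
    |u|^2. The third joins the two unconjugated indices and gives the modulus squared of the sum of
    u^2. *)
Lemma sum_pairings n (u : 'I_n -> C) :
  \sum_i \sum_j \sum_a \sum_b (u i * (u j)^*) * (u a * (u b)^*) * pairings C i j a b
  = (2 * (\sum_i nrm (u i) ^+ 2) ^+ 2 + nrm (\sum_i u i ^+ 2) ^+ 2
      - 2 * \sum_i nrm (u i) ^+ 4)%:C.
Proof.
pose v i j a b := (u i * (u j)^*) * (u a * (u b)^*).
have e1 : \sum_i \sum_j \sum_a \sum_b (i == j)%:R * (a == b)%:R * v i j a b
   = ((\sum_i nrm (u i) ^+ 2) ^+ 2)%:C.
  rewrite rmorphXn rmorph_sum expr2 big_distrlr /=; apply: eq_bigr => i _.
  under eq_bigr do under eq_bigr do under eq_bigr do rewrite -mulrA mulrCA.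
  under eq_bigr do under eq_bigr do rewrite sum_deltal.
  under eq_bigr do rewrite -mulr_sumr.
  by rewrite sum_deltal; apply: eq_bigr => a _; rewrite !sqr_nrm.
have e2 : \sum_i \sum_j \sum_a \sum_b (i == b)%:R * (j == a)%:R * v i j a b
   = ((\sum_i nrm (u i) ^+ 2) ^+ 2)%:C.
  rewrite rmorphXn rmorph_sum expr2 big_distrlr /=; apply: eq_bigr => i _.
  under eq_bigr do under eq_bigr do under eq_bigr do rewrite -mulrA.
  under eq_bigr do under eq_bigr do rewrite sum_deltal.
  under eq_bigr do rewrite sum_deltal.
  by apply: eq_bigr => j _; rewrite !sqr_nrm /v; ring.
have e3 : \sum_i \sum_j \sum_a \sum_b (i == a)%:R * (j == b)%:R * v i j a b
   = (nrm (\sum_i u i ^+ 2) ^+ 2)%:C.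
  rewrite sqr_nrm rmorph_sum big_distrlr /=; apply: eq_bigr => i _; apply: eq_bigr => j _.
  under eq_bigr do under eq_bigr do rewrite -mulrA mulrCA.
  under eq_bigr do rewrite sum_deltal.
  by rewrite sum_deltal rmorphXn /v; ring.
have e4 : \sum_i \sum_j \sum_a \sum_b (i == j)%:R * (a == b)%:R * (i == a)%:R * v i j a b
   = (\sum_i nrm (u i) ^+ 4)%:C.
  rewrite rmorph_sum; apply: eq_bigr => i _ /=.
  under eq_bigr do under eq_bigr do under eq_bigr do rewrite -!mulrA mulrCA.
  under eq_bigr do under eq_bigr do rewrite sum_deltal.
  under eq_bigr do under eq_bigr do rewrite mulrCA.
  under eq_bigr do rewrite sum_deltal.
  by rewrite sum_deltal -[4%N]/(2 * 2)%N exprM rmorphXn /= sqr_nrm /v expr2.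
have lin (A B D : R) : (2 * A + B - 2 * D)%:C = A%:C + A%:C + B%:C - 2 * D%:C.
  by rewrite rmorphB rmorphD !rmorphM rmorph_nat /=; ring.
rewrite lin -{1}e1 -e2 -e3 -e4.
rewrite mulr_sumr -!big_split -sumrB /=; apply: eq_bigr => i _.
rewrite mulr_sumr -!big_split -sumrB /=; apply: eq_bigr => j _.
rewrite mulr_sumr -!big_split -sumrB /=; apply: eq_bigr => a _.
rewrite mulr_sumr -!big_split -sumrB /=; apply: eq_bigr => b _.
rewrite -/(v i j a b) /pairings.
move: (v i j a b) (_ == _)%:R (_ == _)%:R (_ == _)%:R (_ == _)%:R (_ == _)%:R (_ == _)%:R => *.
by ring.
Qed.

Lemma nrm4_sub_le (u v : C) S : nrm u <= S -> nrm v <= S ->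
  `|nrm u ^+ 4 - nrm v ^+ 4| <= 4 * S ^+ 3 * nrm (u - v).
Proof.
move=> uS vS; have u0 := nrm_ge0 u; have v0 := nrm_ge0 v.
have d1 : `|nrm u - nrm v| <= nrm (u - v).
  rewrite ler_norml; apply/andP; split.
    have := nrmB u (u - v); rewrite opprB addrC subrK; lra.
  have := nrmD (u - v) v; rewrite subrK; lra.
move: (nrm u) (nrm v) (nrm (u - v)) u0 v0 d1 uS vS => a b d a0 b0 d1 aS bS.
have -> : a ^+ 4 - b ^+ 4 = (a + b) * (a ^+ 2 + b ^+ 2) * (a - b) by ring.
rewrite normrM; apply: ler_pM => //.
have S0 : 0 <= S by apply: le_trans a0 aS.
have sq x : 0 <= x -> x <= S -> x ^+ 2 <= S ^+ 2.
  by move=> x0 xS; rewrite lerXn2r // nnegrE.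
rewrite ger0_norm ?mulr_ge0 ?addr_ge0 ?sqr_ge0 //.
have -> : 4 * S ^+ 3 = (S + S) * (S ^+ 2 + S ^+ 2) by ring.
by rewrite ler_pM ?addr_ge0 ?sqr_ge0 // lerD // sq.
Qed.

Section Correlations.
Variables (n : nat) (X : nat -> C) (chi : nat -> R) (g : C) (eta delta : R) (W : pred nat).
Hypotheses (n_gt0 : (0 < n)%N) (nrm_g : nrm g = 1) (eta_ge0 : 0 <= eta) (eta_le1 : eta <= 1).
Hypothesis chi_le1 : forall k, `|chi k| <= 1.
Hypothesis X_approx : forall k, nrm (X k - g * (chi k)%:C) <= eta.
Hypothesis X_orth : forall d : nat -> C,
  \sum_(l < n) nrm (\sum_(m < n) d m * X (l + m)%N) ^+ 2 = n%:R * \sum_(m < n) nrm (d m) ^+ 2.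
Hypothesis delta_ge0 : 0 <= delta.
Hypothesis unpaired_corr : forall m1 m2 m3 m4 : nat,
  [&& m1 < n, m2 < n, m3 < n & m4 < n]%N -> [&& W m1, W m2, W m3 & W m4] ->
  ~~ paired m1 m2 m3 m4 ->
  `|\sum_(l < n) chi (l + m1) * (chi (l + m2) * chi (l + m3) * chi (l + m4))| <= delta * n%:R.

Lemma nrm_X_le k : nrm (X k) <= 1 + eta.
Proof.
rewrite -[X k](subrK (g * (chi k)%:C)) addrC.
apply: le_trans (nrmD _ _) _; rewrite nrmM nrm_g mul1r nrm_real.
by have := chi_le1 k; have := X_approx k; lra.
Qed.

Lemma sum_nrm_X_sqr m : (m < n)%N -> \sum_(l < n) nrm (X (l + m)) ^+ 2 = n%:R.
Proof.
move=> mn; have := X_orth (fun k => (k == m)%:R).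
have dE (f : nat -> C) : \sum_(k < n) (k == m :> nat)%:R * f k = f m.
  rewrite (bigD1 (Ordinal mn)) //= eqxx mul1r big1 ?addr0 // => k.
  by rewrite -(inj_eq val_inj) /= => /negPf ->; rewrite mul0r.
rewrite (eq_bigr (fun l : 'I_n => nrm (X (l + m)) ^+ 2)) => [->|l _]; last first.
  by rewrite (dE (fun k => X (l + k)%N)).
rewrite (bigD1 (Ordinal mn)) //= eqxx nrm1 expr1n big1 ?addr0 ?mulr1 // => k.
by rewrite -(inj_eq val_inj) /= => /negPf ->; rewrite nrm0 expr0n.
Qed.

Lemma chi_sqr_le1 k : chi k ^+ 2 <= 1.
Proof.
by rewrite -[chi k ^+ 2]real_normK ?num_real // exprn_ile1.
Qed.

(** The zeros of the character are controlled without counting them: |X| is at most |chi| + eta,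
    while the mean square of X is exactly 1. The 3 absorbs 2 eta + eta^2. *)
Lemma sum_chi_sqr_ge m : (m < n)%N -> n%:R * (1 - 3 * eta) <= \sum_(l < n) chi (l + m) ^+ 2.
Proof.
move=> mn; rewrite mulrBr mulr1 lerBlDr.
have -> : n%:R * (3 * eta) = \sum_(l < n) 3 * eta by rewrite sumr_const card_ord mulr_natl.
rewrite -(sum_nrm_X_sqr mn) -big_split /=; apply: ler_sum => l _.
set k := (l + m)%N.
have h : nrm (X k) <= `|chi k| + eta.
  rewrite -[X k](subrK (g * (chi k)%:C)) addrC.
  apply: le_trans (nrmD _ _) _; rewrite nrmM nrm_g mul1r nrm_real.
  by rewrite lerD2l.
have := chi_le1 k; have := nrm_ge0 (X k); rewrite -[chi k ^+ 2]real_normK ?num_real //.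
move: (nrm _) (`|_|) h (normr_ge0 (chi k)) => x c h c0 x0 c1.
have : x ^+ 2 <= (c + eta) ^+ 2 by rewrite lerXn2r // ?nnegrE // addr_ge0.
have : c * eta <= eta by rewrite ler_piMl.
have : eta ^+ 2 <= eta by rewrite expr2 ler_piMl.
have -> : (c + eta) ^+ 2 = c ^+ 2 + 2 * (c * eta) + eta ^+ 2 by ring.
by move: (c ^+ 2) (c * eta) (eta ^+ 2) (x ^+ 2) => *; lra.
Qed.

(** The lower bound uses a b >= a + b - 1 for a, b <= 1, which reduces the product to two means of
    squares. *)
Lemma paired_corr m m' : (m < n)%N -> (m' < n)%N ->
  `|\sum_(l < n) chi (l + m) ^+ 2 * chi (l + m') ^+ 2 - n%:R| <= 6 * eta * n%:R.
Proof.
move=> mn mn'; rewrite ler_norml; apply/andP; split.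
  have h1 := sum_chi_sqr_ge mn; have h2 := sum_chi_sqr_ge mn'.
  have : \sum_(l < n) (chi (l + m) ^+ 2 + chi (l + m') ^+ 2 - 1)
      <= \sum_(l < n) chi (l + m) ^+ 2 * chi (l + m') ^+ 2.
    apply: ler_sum => l _; rewrite -subr_ge0.
    have := chi_sqr_le1 (l + m); have := chi_sqr_le1 (l + m').
    move: (chi (l + m) ^+ 2) (chi (l + m') ^+ 2) => a b b1 a1.
    have -> : a * b - (a + b - 1) = (1 - a) * (1 - b) by ring.
    by rewrite mulr_ge0 ?subr_ge0.
  rewrite sumrB big_split /= sumr_const card_ord.
  by lra.
apply: (@le_trans _ _ 0); last by rewrite !mulr_ge0.
rewrite subr_le0; apply: (@le_trans _ _ (\sum_(l < n) 1)); last by rewrite sumr_const card_ord.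
by apply: ler_sum => l _; rewrite mulr_ile1 ?sqr_ge0 ?chi_sqr_le1.
Qed.

Lemma corr_le (m1 m2 m3 m4 : 'I_n) : [&& W m1, W m2, W m3 & W m4] ->
  `|n%:R^-1 * \sum_(l < n) chi (l + m1) * (chi (l + m2) * chi (l + m3) * chi (l + m4))
     - pairings R m1 m2 m3 m4| <= 6 * eta + delta.
Proof.
move=> hW; rewrite pairingsE.
have n0 : 0 < n%:R :> R by rewrite ltr0n.
have avgE (x y : R) : n%:R^-1 * x - y = (x - y * n%:R) / n%:R by field; rewrite gt_eqF.
rewrite avgE normrM normfV (ger0_norm (ltW n0)) ler_pdivrMr //.
have pE : paired m1 m2 m3 m4 = paired (m1 : nat) (m2 : nat) (m3 : nat) (m4 : nat) by [].
case: (boolP (paired m1 m2 m3 m4)) => [pr|npr]; last first.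
  rewrite mul0r subr0; apply: le_trans (unpaired_corr _ hW _) _; rewrite -?pE ?ltn_ord //.
  by rewrite ler_pM2r // lerDr mulr_ge0.
rewrite mul1r mulrDl; apply: le_trans (_ : 6 * eta * n%:R <= _); last first.
  by rewrite lerDl mulr_ge0 ?ler0n.
case/or3P: pr => /andP[/eqP -> /eqP ->].
- apply: le_trans (paired_corr (ltn_ord m2) (ltn_ord m4)).
  by apply: le_of_eq; congr (`|_ - _|); apply: eq_bigr => l _; ring.
- apply: le_trans (paired_corr (ltn_ord m3) (ltn_ord m4)).
  by apply: le_of_eq; congr (`|_ - _|); apply: eq_bigr => l _; ring.
apply: le_trans (paired_corr (ltn_ord m4) (ltn_ord m3)).
by apply: le_of_eq; congr (`|_ - _|); apply: eq_bigr => l _; ring.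
Qed.

(** After expansion, each quadruple of indices contributes its weight times the error of one
    normalised correlation, bounded by [corr_le]. Quadruples that leave [W] have weight zero, and
    the absolute weights add up to the fourth power on the right. *)
Lemma chi_fourth_moment (u : nat -> C) : (forall m, ~~ W m -> u m = 0) ->
  `|n%:R^-1 * \sum_(l < n) nrm (\sum_(m < n) u m * (chi (l + m))%:C) ^+ 4
    - (2 * (\sum_(m < n) nrm (u m) ^+ 2) ^+ 2 + nrm (\sum_(m < n) u m ^+ 2) ^+ 2
        - 2 * \sum_(m < n) nrm (u m) ^+ 4)|
  <= (6 * eta + delta) * (\sum_(m < n) nrm (u m)) ^+ 4.
Proof.
move=> uW; have pE := sum_pairings (fun m : 'I_n => u m); rewrite /= in pE.
rewrite -nrm_real rmorphB /= -pE rmorphM rmorph_sum /=.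
under eq_bigr => l _ do rewrite (nrm4_sum (fun m : 'I_n => u m) (fun m : 'I_n => chi (l + m))).
rewrite exchange_big /=; under eq_bigr do rewrite exchange_big /=.
under eq_bigr do under eq_bigr do rewrite exchange_big /=.
under eq_bigr do under eq_bigr do under eq_bigr do rewrite exchange_big /=.
have -> : (\sum_(m < n) nrm (u m)) ^+ 4 = \sum_i \sum_j \sum_a \sum_b
    nrm (u (i : 'I_n)) * nrm (u (j : 'I_n)) * (nrm (u (a : 'I_n)) * nrm (u (b : 'I_n))).
  by rewrite sum4_prod; ring.
rewrite !mulr_sumr -sumrB; apply: le_trans (nrm_sum _ _ _) _; apply: ler_sum => i _.
rewrite !mulr_sumr -sumrB; apply: le_trans (nrm_sum _ _ _) _; apply: ler_sum => j _.
rewrite !mulr_sumr -sumrB; apply: le_trans (nrm_sum _ _ _) _; apply: ler_sum => a _.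
rewrite !mulr_sumr -sumrB; apply: le_trans (nrm_sum _ _ _) _; apply: ler_sum => b _.
rewrite -mulr_sumr mulrCA -mulrBr !nrmM !nrm_conj [leRHS]mulrC.
case: (boolP [&& W i, W j, W a & W b]) => [hW|].
  apply: ler_wpM2l; first by rewrite !mulr_ge0 ?nrm_ge0.
  have := corr_le hW; rewrite -nrm_real rmorphB rmorphM rmorph_sum /=.
  by rewrite fmorphV rmorph_nat !pairingsE rmorph_nat.
rewrite !negb_and => /or4P[] /uW ->; by rewrite !(nrm0, mul0r, mulr0).
Qed.

(* The tail of the weights off [W] is small in mean square and only logarithmically large in
   absolute value, so it is negligible in the fourth moment; on [W] the sums [X] may be replaced
   by the character, whose fourth-order correlations are under control. *)
Lemma fourth_moment (c : nat -> C) (L Lam sigma : R) :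
  0 < sigma -> \sum_(m < n) nrm (c m) ^+ 2 = 1 -> \sum_(m < n) nrm (c m) <= L ->
  \sum_(m < n | W m) nrm (c m) <= Lam ->
  \sum_(m < n | ~~ W m) nrm (c m) ^+ 2 <= sigma ^+ 2 ->
  `|n%:R^-1 * \sum_(l < n) nrm (\sum_(m < n) c m * X (l + m)%N) ^+ 4
    - (2 + nrm (\sum_(m < n) c m ^+ 2) ^+ 2 - 2 * \sum_(m < n) nrm (c m) ^+ 4)|
  <= 32 * L ^+ 3 * sigma + (38 * eta + delta) * Lam ^+ 4 + 8 * sigma ^+ 2.
Proof.
move=> s0 c2 cL cLam ctail.
pose u m := if W m then c m else 0.
pose v m := if W m then 0 else c m.
have n0 : 0 < n%:R :> R by rewrite ltr0n.
have uE : \sum_(m < n) nrm (u m) = \sum_(m < n | W m) nrm (c m).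
  by rewrite [RHS]big_mkcond; apply: eq_bigr => m _; rewrite /u; case: ifP; rewrite ?nrm0.
have u_le : \sum_(m < n) nrm (u m) <= L.
  apply: le_trans cL; apply: ler_sum => m _; rewrite /u; case: ifP; rewrite ?nrm0 ?nrm_ge0 //.
have uLam : \sum_(m < n) nrm (u m) <= Lam by rewrite uE.
have v2E : \sum_(m < n) nrm (v m) ^+ 2 = \sum_(m < n | ~~ W m) nrm (c m) ^+ 2.
  rewrite [RHS]big_mkcond; apply: eq_bigr => m _; rewrite /v.
  by case: (W m); rewrite /= ?nrm0 ?expr0n.
have uv2 : \sum_(m < n) nrm (u m) ^+ 2 + \sum_(m < n) nrm (v m) ^+ 2 = 1.
  rewrite -c2 -big_split; apply: eq_bigr => m _; rewrite /u /v.
  by case: (W m); rewrite /= nrm0 expr0n /= ?addr0 ?add0r.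
pose tau := \sum_(m < n) nrm (v m) ^+ 2.
have tau0 : 0 <= tau by apply: sumr_ge0 => m _; apply: sqr_ge0.
have tau_s : tau <= sigma ^+ 2 by rewrite /tau v2E.
have v_le1 : tau <= 1.
  by rewrite -uv2 lerDr; apply: sumr_ge0 => m _; apply: sqr_ge0.
pose B l := \sum_(m < n) c m * X (l + m)%N.
pose M l := \sum_(m < n) u m * X (l + m)%N.
pose T l := \sum_(m < n) v m * X (l + m)%N.
pose Y l := \sum_(m < n) u m * (chi (l + m))%:C.
have BMT l : B l - M l = T l.
  rewrite -sumrB; apply: eq_bigr => m _; rewrite -mulrBl; congr (_ * _).
  by rewrite /u /v; case: (W m); rewrite ?subrr ?subr0.
have sup (d : nat -> C) (S : R) l : \sum_(m < n) nrm (d m) <= S ->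
    nrm (\sum_(m < n) d m * X (l + m)%N) <= 2 * S.
  move=> dS; apply: le_trans (nrm_sum _ _ _) _.
  apply: (@le_trans _ _ (\sum_(m < n) nrm (d m) * 2)); last by rewrite -mulr_suml mulrC ler_wpM2l.
  apply: ler_sum => m _; rewrite nrmM ler_wpM2l ?nrm_ge0 //.
  by have := nrm_X_le (l + m); have := eta_le1; lra.
have avg (f h : nat -> R) b : (forall l, `|f l - h l| <= b) ->
    `|n%:R^-1 * \sum_(l < n) f l - n%:R^-1 * \sum_(l < n) h l| <= b.
  move=> fh; rewrite -mulrBr -sumrB normrM gtr0_norm ?invr_gt0 //.
  rewrite mulrC ler_pdivrMr //; apply: le_trans (ler_norm_sum _ _ _) _.
  apply: (@le_trans _ _ (\sum_(l < n) b)); first by apply: ler_sum.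
  by rewrite sumr_const card_ord -[b *+ n]mulr_natr.
have step1 : `|n%:R^-1 * \sum_(l < n) nrm (B l) ^+ 4 - n%:R^-1 * \sum_(l < n) nrm (M l) ^+ 4|
    <= 32 * L ^+ 3 * sigma.
  have L0 : 0 <= L by apply: le_trans cL; apply: sumr_ge0 => m _; apply: nrm_ge0.
  rewrite -mulrBr -sumrB normrM gtr0_norm ?invr_gt0 // mulrC ler_pdivrMr //.
  apply: le_trans (ler_norm_sum _ _ _) _.
  apply: (@le_trans _ _ (\sum_(l < n) 4 * (2 * L) ^+ 3 * nrm (T l))).
    apply: ler_sum => l _; rewrite -BMT; apply: nrm4_sub_le; exact: sup.
  rewrite -mulr_sumr; have -> : 4 * (2 * L) ^+ 3 = 32 * L ^+ 3 by ring.
  rewrite -[32 * L ^+ 3 * sigma * n%:R]mulrA.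
  apply: ler_wpM2l; first by rewrite mulr_ge0 // exprn_ge0.
  (* The arithmetic-geometric inequality in place of Cauchy-Schwarz: the mean of |T| is at most tau
     / (2 sigma) + sigma / 2, hence at most sigma. *)
  apply: (@le_trans _ _ (\sum_(l < n) (nrm (T l) ^+ 2 / (2 * sigma) + sigma / 2))).
    apply: ler_sum => l _; rewrite -subr_ge0; set x := nrm (T l).
    have -> : x ^+ 2 / (2 * sigma) + sigma / 2 - x = (x - sigma) ^+ 2 / (2 * sigma).
      by field; rewrite gt_eqF.
    by rewrite divr_ge0 ?sqr_ge0 // mulr_ge0 // ltW.
  rewrite big_split /= -mulr_suml X_orth sumr_const card_ord -/tau -[sigma / 2 *+ n]mulr_natl.
  rewrite -subr_ge0.
  have -> : sigma * n%:R - (n%:R * tau / (2 * sigma) + n%:R * (sigma / 2)) =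
     n%:R * (sigma ^+ 2 - tau) / (2 * sigma) by field; rewrite gt_eqF.
  by rewrite divr_ge0 // ?mulr_ge0 ?subr_ge0 // ltW.
(* Both sums are at most 2 Lam and differ by at most Lam eta, so the fourth powers differ by at most
   4 (2 Lam)^3 Lam eta. Together with the 6 eta of [step3] this makes 38 eta. *)
have step2 : `|n%:R^-1 * \sum_(l < n) nrm (M l) ^+ 4 - n%:R^-1 * \sum_(l < n) nrm (Y l) ^+ 4|
    <= 32 * eta * Lam ^+ 4.
  have Lam0 : 0 <= Lam by apply: le_trans uLam; apply: sumr_ge0 => m _; apply: nrm_ge0.
  apply: (avg (fun l => nrm (M l) ^+ 4) (fun l => nrm (Y l) ^+ 4)) => l.
  have <- : nrm (g * Y l) = nrm (Y l) by rewrite nrmM nrm_g mul1r.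
  apply: le_trans (nrm4_sub_le (S := 2 * Lam) _ _) _; first exact: sup.
    rewrite nrmM nrm_g mul1r; apply: le_trans (nrm_sum _ _ _) _.
    apply: (@le_trans _ _ Lam); last by lra.
    apply: le_trans uLam; apply: ler_sum => m _; rewrite nrmM nrm_real ler_piMr ?nrm_ge0 //.
  have -> : 32 * eta * Lam ^+ 4 = 4 * (2 * Lam) ^+ 3 * (Lam * eta) by ring.
  apply: ler_wpM2l; first by rewrite mulr_ge0 // exprn_ge0 // mulr_ge0.
  rewrite mulr_sumr -sumrB; apply: le_trans (nrm_sum _ _ _) _.
  apply: (@le_trans _ _ (\sum_(m < n) nrm (u m) * eta)); last by rewrite -mulr_suml ler_wpM2r.
  by apply: ler_sum => m _; rewrite mulrCA -mulrBr nrmM ler_wpM2l ?nrm_ge0.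
have step3 := @chi_fourth_moment u (fun m nW => ltac:(by rewrite /u (negPf nW))).
have Lam0 : 0 <= \sum_(m < n) nrm (u m) by apply: sumr_ge0 => m _; apply: nrm_ge0.
have {}step3 : `|n%:R^-1 * \sum_(l < n) nrm (Y l) ^+ 4
    - (2 * (\sum_(m < n) nrm (u m) ^+ 2) ^+ 2 + nrm (\sum_(m < n) u m ^+ 2) ^+ 2
        - 2 * \sum_(m < n) nrm (u m) ^+ 4)| <= (6 * eta + delta) * Lam ^+ 4.
  apply: le_trans step3 _; apply: ler_wpM2l; first by rewrite addr_ge0 // mulr_ge0.
  by rewrite lerXn2r // nnegrE (le_trans Lam0).
have c_le1 m : (m < n)%N -> nrm (c m) ^+ 2 <= 1.
  move=> mn; rewrite -c2 (bigD1 (Ordinal mn)) //= lerDl.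
  by apply: sumr_ge0 => k _; apply: sqr_ge0.
have nsq (x : C) : nrm (x ^+ 2) = nrm x ^+ 2 by rewrite nrmX.
have cu (e : R -> R) (m : nat) : e 0 = 0 -> e (nrm (c m)) - e (nrm (u m)) = e (nrm (v m)).
  by move=> e0; rewrite /u /v; case: (W m); rewrite nrm0 e0 ?subrr ?subr0.
(* Returning from [u] to [c] in the main term: [q3] enters twice, [q1] once and [q2] twice, in all 4
   tau + 2 tau + 2 tau, whence 8 sigma^2. *)
have q1 : `|nrm (\sum_(m < n) u m ^+ 2) ^+ 2 - nrm (\sum_(m < n) c m ^+ 2) ^+ 2| <= 2 * tau.
  set p := \sum_(m < n) u m ^+ 2; set q := \sum_(m < n) c m ^+ 2.
  have pq : nrm (q - p) <= tau.
    rewrite -sumrB; apply: le_trans (nrm_sum _ _ _) _; apply: ler_sum => m _.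
    rewrite -nsq; apply: le_of_eq; congr nrm.
    by rewrite /u /v; case: (W m); rewrite expr0n /= ?subrr ?subr0.
  have q1 : nrm q <= 1.
    rewrite -c2; apply: le_trans (nrm_sum _ _ _) _; apply: ler_sum => m _; by rewrite nsq.
  have p1 : nrm p <= 1.
    rewrite -uv2; apply: (@le_trans _ _ (\sum_(m < n) nrm (u m) ^+ 2)); last by rewrite lerDl.
    apply: le_trans (nrm_sum _ _ _) _; apply: ler_sum => m _; by rewrite nsq.
  have d1 : nrm p <= nrm q + nrm (q - p).
    by rewrite -{1}(subKr q p) nrmB.
  have d2 : nrm q <= nrm p + nrm (q - p).
    by rewrite -{1}(subrK p q) addrC nrmD.
  have := nrm_ge0 p; have := nrm_ge0 q; move: (nrm p) (nrm q) (nrm (q - p)) pq q1 p1 d1 d2.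
  move=> a b d dt b1 a1 d1 d2 b0 a0.
  have -> : a ^+ 2 - b ^+ 2 = (a - b) * (a + b) by ring.
  rewrite normrM mulrC; apply: ler_pM => //; first by rewrite ger0_norm ?addr_ge0 //; lra.
  by rewrite ler_norml; apply/andP; split; lra.
have q2 : `|\sum_(m < n) nrm (u m) ^+ 4 - \sum_(m < n) nrm (c m) ^+ 4| <= tau.
  rewrite distrC -sumrB; apply: le_trans (ler_norm_sum _ _ _) _; apply: ler_sum => m _.
  rewrite (cu (fun x => x ^+ 4)) ?expr0n // ger0_norm ?exprn_ge0 ?nrm_ge0 //.
  rewrite -[4%N]/(2 + 2)%N exprD ler_piMr ?sqr_ge0 // /v.
  by case: (W m); rewrite ?nrm0 ?expr0n // c_le1.
have q3 : `|(\sum_(m < n) nrm (u m) ^+ 2) ^+ 2 - 1| <= 2 * tau.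
  have -> : \sum_(m < n) nrm (u m) ^+ 2 = 1 - tau by rewrite -uv2 addrK.
  have -> : (1 - tau) ^+ 2 - 1 = - (tau * (2 - tau)) by ring.
  rewrite normrN ger0_norm ?mulr_ge0 //; last by lra.
  by rewrite mulrC ler_wpM2r //; lra.
rewrite -/(B _) in step1 *.
move: step1 step2 step3 q1 q2 q3 tau_s.
move: (sigma ^+ 2) (_ * _ * sigma) (nrm (\sum_(m < n) u m ^+ 2) ^+ 2).
move: (\sum_(m < n) nrm (u m) ^+ 4) ((\sum_(m < n) nrm (u m) ^+ 2) ^+ 2).
move: (\sum_(m < n) nrm (c m) ^+ 4) (nrm (\sum_(m < n) c m ^+ 2) ^+ 2).
move: (_ * \sum_(l < n) nrm (Y l) ^+ 4) (_ * \sum_(l < n) nrm (M l) ^+ 4).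
move: (_ * \sum_(l < n) nrm (B l) ^+ 4) tau {tau0 v_le1} (Lam ^+ 4).
move=> b t L4 y mm q4 q2' u4 u22 s2 e1 qu.
have -> : 32 * eta * L4 = 32 * (eta * L4) by ring.
have -> : (6 * eta + delta) * L4 = 6 * (eta * L4) + delta * L4 by ring.
have -> : (38 * eta + delta) * L4 = 38 * (eta * L4) + delta * L4 by ring.
move: (eta * L4) (delta * L4) => eL dL.
rewrite !ler_norml => /andP[? ?] /andP[? ?] /andP[? ?] /andP[? ?] /andP[? ?] /andP[? ?] ?.
by apply/andP; split; lra.
Qed.

End Correlations.
End FourthMoment.

(** * The fourth norm for a product of distinct odd primes *)

Section FourthNorm.
Variable R : rcfType.
Local Notation C := R[i].

Definition odd_harmonic k : R := \sum_(m < k) (2 * m + 1)%:R^-1.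

Lemma sum_sym_le n (P : pred nat) (F b : nat -> R) : (forall m, 0 <= b m) ->
  (forall m, (m < n)%N -> P (n.-1 - m)%N = P m) -> (forall m, (m < n)%N -> F (n.-1 - m)%N = F m) ->
  (forall m, (2 * m + 1 <= n)%N -> F m <= b m) ->
  \sum_(m < n | P m) F m <= 2 * \sum_(m < n | P m && (2 * m + 1 <= n)%N) b m.
Proof.
move=> b0 Psym Fsym Fb.
pose b' m := if (2 * m + 1 <= n)%N then b m else 0.
have b'0 m : 0 <= b' m by rewrite /b'; case: ifP.
have -> : \sum_(m < n | P m && (2 * m + 1 <= n)%N) b m = \sum_(m < n | P m) b' m.
  by rewrite big_mkcondr.
have e : \sum_(m < n | P m) b' (n.-1 - m)%N = \sum_(m < n | P m) b' m.
  have rE (m : 'I_n) : (n - m.+1 = n.-1 - m)%N by lia.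
  rewrite [RHS](reindex_inj rev_ord_inj) /=.
  by apply: eq_big => [m|m _]; rewrite /= rE // Psym.
rewrite mulr2n mulrDl !mul1r -{2}e -big_split /=; apply: ler_sum => m _.
have [h|h] := leqP (2 * m + 1) n.
  apply: le_trans (Fb _ h) _; rewrite {1}/b' h lerDl; exact: b'0.
rewrite -Fsym //; have h' : (2 * (n.-1 - m) + 1 <= n)%N by have := ltn_ord m; lia.
by apply: le_trans (Fb _ h') _; rewrite {2}/b' h' lerDr; exact: b'0.
Qed.

(** Telescoping: (2 m + 1)^2 exceeds 4 m (m + 1), so each term is at most 1 / (4 m) - 1 / (4 (m +
    1)). *)
Lemma sum_inv_sqr_tail K n : (0 < K)%N ->
  \sum_(m < n | (K <= m)%N) ((2 * m + 1)%:R^-1 : R) ^+ 2 <= (4 * K)%:R^-1.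
Proof.
move=> K0.
have tel k : (K <= k)%N ->
    \sum_(m < k | (K <= m)%N) ((2 * m + 1)%:R^-1 : R) ^+ 2 <= (4 * K)%:R^-1 - (4 * k)%:R^-1.
  elim: k => [|k IH]; first by lia.
  rewrite leq_eqVlt => /orP[/eqP <-|].
    by rewrite subrr big1 // => i; rewrite leqNgt ltn_ord.
  rewrite ltnS => Kk; rewrite big_mkcond big_ord_recr /= -big_mkcond /= Kk.
  apply: le_trans (lerD (IH Kk) (lexx _)) _.
  have k0 : 0 < k%:R :> R by rewrite ltr0n (leq_trans K0).
  have -> : (4 * k.+1)%:R = 4 * (k%:R + 1) :> R by rewrite natrM natr1.
  have -> : (2 * k + 1)%:R = 2 * k%:R + 1 :> R by rewrite natrD natrM.
  have -> : (4 * k)%:R = 4 * k%:R :> R by rewrite natrM.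
  rewrite -subr_ge0; move: (k%:R : R) k0 ((4 * K)%:R^-1) => x x0 c.
  have -> : c - (4 * (x + 1))^-1 - (c - (4 * x)^-1 + (2 * x + 1)^-1 ^+ 2) =
     1 / (4 * x * (x + 1) * (2 * x + 1) ^+ 2).
    by field; rewrite !gt_eqF //; lra.
  by rewrite divr_ge0 // !mulr_ge0 ?sqr_ge0 //; lra.
have [Kn|nK] := leqP K n.
  by apply: le_trans (tel _ Kn) _; rewrite gerBl invr_ge0.
by rewrite big1 ?invr_ge0 // => i Ki; have := ltn_ord i; lia.
Qed.

(** The mean square is exactly 1, so (|X|^2 - 1)^2 >= 0 bounds the fourth moment from below, and the
    pointwise bound on one factor |X|^2 bounds it from above. *)
Lemma sum_nrm4_near n (X : nat -> C) eta : (0 < n)%N -> 0 <= eta -> eta <= 1 ->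
  (forall k, nrm (X k) <= 1 + eta) -> \sum_(l < n) nrm (X l) ^+ 2 = n%:R ->
  `|n%:R^-1 * \sum_(l < n) nrm (X l) ^+ 4 - 1| <= 3 * eta.
Proof.
move=> n0 e0 e1 X1 X2; have n0' : 0 < n%:R :> R by rewrite ltr0n.
have lo : n%:R <= \sum_(l < n) nrm (X l) ^+ 4.
  have : \sum_(l < n) (2 * nrm (X l) ^+ 2 - 1) <= \sum_(l < n) nrm (X l) ^+ 4.
    apply: ler_sum => l _; rewrite -subr_ge0.
    rewrite (_ : _ - _ = (nrm (X l) ^+ 2 - 1) ^+ 2) ?sqr_ge0 //; ring.
  by rewrite sumrB -mulr_sumr X2 sumr_const card_ord; lra.
have hi : \sum_(l < n) nrm (X l) ^+ 4 <= (1 + 3 * eta) * n%:R.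
  rewrite -X2 mulr_sumr; apply: ler_sum => l _.
  rewrite -[4%N]/(2 + 2)%N exprD; apply: ler_wpM2r; first exact: sqr_ge0.
  apply: (@le_trans _ _ ((1 + eta) ^+ 2)); first by rewrite lerXn2r // nnegrE ?nrm_ge0 ?addr_ge0.
  have -> : (1 + eta) ^+ 2 = 1 + 2 * eta + eta ^+ 2 by ring.
  by have : eta ^+ 2 <= eta; [rewrite expr2 ler_piMl | lra].
have -> (x : R) : n%:R^-1 * x - 1 = (x - n%:R) / n%:R by field; rewrite gt_eqF.
rewrite normrM normfV (gtr0_norm n0') ler_pdivrMr // ger0_norm ?subr_ge0 //.
by move: (\sum_(l < n) _) hi => x; lra.
Qed.

Variables (p : nat) (ps : seq nat).
Hypotheses (ops : odd_primes (p :: ps)) (p_min : all (leq p) ps).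
Let n := (\prod_(q <- p :: ps) q)%N.
Let K := p./2.
(** Modulo [n] the window is the run of p - 1 consecutive integers from -K to K - 1, invariant under
    m -> -1 - m, the symmetry of [kernel_rev]. *)
Let W m := (m < K)%N || (n - K <= m)%N.

Let p_pr : prime p. Proof. by case/odd_primes_cons: ops. Qed.
Let p_odd : odd p. Proof. by case/odd_primes_cons: ops. Qed.
Let n_gt0 : (0 < n)%N. Proof. exact: prod_odd_primes_gt0. Qed.
Let p_dvd : (p %| n)%N. Proof. by rewrite /n big_cons dvdn_mulr. Qed.
Let pK : p = (2 * K + 1)%N.
Proof. by rewrite /K mul2n -{1}(odd_double_half p) p_odd addnC. Qed.
Let K_gt0 : (0 < K)%N.
Proof. by have := prime_gt1 p_pr; rewrite pK; lia. Qed.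

Let p_le_n : (2 * K + 1 <= n)%N.
Proof. by rewrite -pK dvdn_leq. Qed.

Lemma window_low m : (2 * m + 1 <= n)%N -> W m = (m < K)%N.
Proof.
move: p_le_n; rewrite /W; move: n K => N k.
by case: (ltnP m k) => //= h1 h2 h3; apply/negbTE; rewrite -ltnNge; lia.
Qed.

Lemma window_mod_inj m m' : (m < n)%N -> (m' < n)%N -> W m -> W m' ->
  (m %% p == m' %% p)%N = (m == m').
Proof.
move=> mn mn' Wm Wm'; apply/eqP/eqP => [|-> //].
wlog le : m m' mn mn' Wm Wm' / (m <= m')%N.
  by move=> H; case/orP: (leq_total m m') => h e; [|symmetry]; apply: H.
have pn : (p <= n)%N by apply: dvdn_leq.
move=> /eqP; rewrite eq_sym eqn_mod_dvd // => dv.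
case: (posnP (m' - m)) => [|d0]; first by lia.
move: Wm Wm'; rewrite /W => /orP[w1|w1] /orP[w2|w2].
- by have := dvdn_leq d0 dv; lia.
- have dv2 : (p %| n - (m' - m))%N by rewrite dvdn_sub.
  have n1 : (0 < n - (m' - m))%N by clear -mn' d0; lia.
  by have := dvdn_leq n1 dv2; clear -pK w1 w2 mn' d0; lia.
- by have := dvdn_leq d0 dv; lia.
- by have := dvdn_leq d0 dv; lia.
Qed.

Lemma window_sym m : (m < n)%N -> W (n.-1 - m) = W m.
Proof.
by move=> mn; rewrite /W; apply/orP/orP => -[h|h]; [right|left|right|left]; lia.
Qed.

(** The divisor is the number 2 n of nodes times n^2. The isolated 1/2 comes from the even roots,
    the other half from the pairings at the odd roots. The parameters stand for: [eta] the distance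
    of X from the character, [delta] the correlation saving p^(-1/4), [sigma] the root mean square
    of the kernel off the window, [L] and [Lam] its total weight everywhere and on the window. They
    are constrained by inequalities only, an arbitrary real closed field having no logarithm. *)
Theorem fourth_norm_estimate (s d0 : nat) (z : C) (delta sigma L Lam : R) :
  let eta := (1 + (Num.sqrt p%:R)^-1) ^+ (size ps).+1 - 1 in
  let A x := \sum_(j < n) (modified_jacobi R (p :: ps) (j + s))%:C * x ^+ j in
  (2 * n).-primitive_root z ->
  (forall k, (k <= n)%N -> 2 * k%:R / n%:R <= nrm (1 - z ^+ k)) ->
  (d0 < n)%N -> (n %| d0 + 2 * s + n.-1)%N ->
  eta <= 1 -> 0 <= delta -> 625 <= delta ^+ 4 * p%:R ->
  0 < sigma -> 1 <= sigma ^+ 2 * (2 * K)%:R ->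
  2 * odd_harmonic n <= L -> 2 * odd_harmonic K <= Lam ->
  `|(\sum_(l < n) (nrm (A ((z ^+ 2)^-1 ^+ l)) ^+ 4 + nrm (A (z * (z ^+ 2)^-1 ^+ l)) ^+ 4))
      / (2 * n%:R ^+ 3)
    - (1 / 2 + (2 + (`|n%:R - 2 * d0%:R| / n%:R) ^+ 2
               - 2 * ((n%:R ^+ 2 + 2) / (3 * n%:R ^+ 2))) / 2)|
  <= (3 * eta + (32 * L ^+ 3 * sigma + (38 * eta + delta) * Lam ^+ 4 + 8 * sigma ^+ 2)) / 2.
Proof.
move=> eta A zp zfar d0n dv eta1 delta0 hdelta sigma0 hsigma hL hLam.
have n0 : 0 < n%:R :> R by rewrite ltr0n.
pose a := modified_jacobi R (p :: ps).
have a_per : periodic n a := modified_jacobi_periodic R ops.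
have a_sqr j : a j ^+ 2 = 1 := modified_jacobi_sqr R j ops.
pose X := nfourier n z a; pose c := kernel n s z.
have [|g g1 gE] := @modified_jacobi_dft R (p :: ps) p (z ^+ 2)^-1 ops _ (prime_gt0 p_pr)
  (winv_prim n_gt0 zp).
  by rewrite /= leqnn.
have orth := nfourier_orth n_gt0 zp a_sqr.
have eta0 : 0 <= eta.
  by rewrite subr_ge0 exprn_ege1 // lerDl invr_ge0 sqrtr_ge0.
pose chi := jacobiL R (p :: ps).
have X_approx k : nrm (X k - g * (chi k)%:C) <= eta := gE k.
have chi1 k : `|chi k| <= 1 := @jacobiL_le1 R (p :: ps) k.
have unp (m1 m2 m3 m4 : nat) :
  [&& m1 < n, m2 < n, m3 < n & m4 < n]%N -> [&& W m1, W m2, W m3 & W m4] ->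
  ~~ paired m1 m2 m3 m4 ->
  `|\sum_(l < n) chi (l + m1)%N * (chi (l + m2)%N * chi (l + m3)%N * chi (l + m4)%N)| <= delta * n%:R.
  move=> /and4P[n1 n2 n3 n4] /and4P[W1 W2 W3 W4] npr.
  have := @jacobiL_unpaired_sum R p ps m1 m2 m3 m4 ops; rewrite {1}/paired !window_mod_inj //.
  move=> /(_ npr); rewrite -/n -/chi; set S := \sum_(l < n) _ => S4.
  rewrite -(@ler_pXn2r _ 4) ?nnegrE ?mulr_ge0 // -normrX ger0_norm ?exprn_even_ge0 //.
  apply: le_trans S4 _; rewrite {1}/n big_cons natrM.
  set P : R := p%:R; set M : R := (\prod_(q <- ps) q)%N%:R.
  have -> : (delta * (P * M)) ^+ 4 = delta ^+ 4 * P * (P ^+ 3 * M ^+ 4) by ring.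
  rewrite -mulrA; apply: ler_wpM2r => //; by rewrite mulr_ge0 ?exprn_ge0.
have c_le m : (2 * m + 1 <= n)%N -> nrm (c m) <= (2 * m + 1)%:R^-1.
  by move=> h; apply: kernel_le => //; apply: zfar.
have c_sym m : (m < n)%N -> nrm (c (n.-1 - m)%N) = nrm (c m) by apply: kernel_rev.
have inv0 m : 0 <= (2 * m + 1)%:R^-1 :> R by rewrite invr_ge0.
have cL : \sum_(m < n) nrm (c m) <= L.
  apply: le_trans hL; apply: le_trans (@sum_sym_le n predT _ _ inv0 _ c_sym c_le) _ => //.
  rewrite ler_wpM2l // /odd_harmonic [leRHS](bigID (fun m : 'I_n => (2 * m + 1 <= n)%N)) /=.
  by rewrite lerDl; apply: sumr_ge0.
have Kn : (K <= n)%N.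
  by apply: leq_trans p_le_n; rewrite addn1 mul2n -addnn ltnW // ltnS leq_addr.
have cLam : \sum_(m < n | W m) nrm (c m) <= Lam.
  apply: le_trans hLam.
  apply: le_trans (@sum_sym_le n W _ _ inv0 window_sym c_sym c_le) _ => //.
  rewrite ler_wpM2l // /odd_harmonic (big_ord_widen n (fun m => (2 * m + 1)%:R^-1) Kn).
  rewrite [leRHS](bigID (fun m : 'I_n => (2 * m + 1 <= n)%N)) /= ler_wpDr //.
    by apply: sumr_ge0.
  apply: le_of_eq; apply: eq_bigl => m.
  by case: (leqP (2 * m + 1) n) => h; rewrite ?andbF ?andbT // window_low.
have ctail : \sum_(m < n | ~~ W m) nrm (c m) ^+ 2 <= sigma ^+ 2.
  apply: (@le_trans _ _ (2 * (4 * K)%:R^-1)); last first.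
    have K0 : 0 < K%:R :> R by rewrite ltr0n.
    move: hsigma; rewrite !natrM => hs.
    rewrite (_ : 2 * _ = (2 * K%:R)^-1); last by field; rewrite gt_eqF.
    by rewrite -div1r ler_pdivrMr // mulr_gt0.
  apply: le_trans (@sum_sym_le n (fun m => ~~ W m) (fun m => nrm (c m) ^+ 2)
    (fun m => (2 * m + 1)%:R^-1 ^+ 2) _ _ _ _) _.
  - by move=> m; apply: sqr_ge0.
  - by move=> m mn; rewrite window_sym.
  - by move=> m mn; rewrite c_sym.
  - by move=> m h; rewrite lerXn2r ?nnegrE ?nrm_ge0 // c_le.
  rewrite ler_wpM2l //; apply: le_trans (sum_inv_sqr_tail n K_gt0).
  rewrite [leRHS](bigID (fun m : 'I_n => ~~ W m && (2 * m + 1 <= n)%N)) /= ler_wpDr //.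
    by apply: sumr_ge0 => m _; apply: sqr_ge0.
  apply: le_of_eq; apply: eq_bigl => m; rewrite /W.
  by case: (ltnP m K).
have main := fourth_moment n_gt0 g1 eta0 eta1 chi1 X_approx orth delta0 unp sigma0
  (sum_nrm_kernel_sqr s n_gt0 zp) cL cLam ctail.
rewrite (sum_nrm_kernel_4 s n_gt0 zp) (nrm_sum_kernel_sqr n_gt0 zp d0n dv) in main.
have X2 : \sum_(l < n) nrm (X l) ^+ 2 = n%:R.
  have := sum_nrm_X_sqr orth n_gt0; by under eq_bigr do rewrite addn0.
have even := sum_nrm4_near n_gt0 eta0 eta1 (nrm_X_le g1 chi1 X_approx) X2.
have sE : (Num.sqrt n%:R : R) ^+ 4 = n%:R ^+ 2 by rewrite -[4%N]/(2 * 2)%N exprM sqr_sqrtr.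
have -> : (\sum_(l < n) (nrm (A ((z ^+ 2)^-1 ^+ l)) ^+ 4 + nrm (A (z * (z ^+ 2)^-1 ^+ l)) ^+ 4))
      / (2 * n%:R ^+ 3) = (n%:R^-1 * (\sum_(l < n) nrm (X l) ^+ 4)
   + n%:R^-1 * \sum_(l < n) nrm (\sum_(m < n) c m * X (l + m)%N) ^+ 4) / 2.
  rewrite -mulrDr -big_split /=.
  rewrite (eq_bigr (fun l : 'I_n => n%:R ^+ 2 * (nrm (X l) ^+ 4 +
      nrm (\sum_(m < n) c m * X (l + m)%N) ^+ 4))); last first.
    move=> l _; rewrite /A (poly_even_roots s n_gt0 zp a_per) (poly_odd_roots s n_gt0 zp a_per).
    by rewrite !exprMn sE mulrDr.
  by rewrite -mulr_sumr; field; rewrite gt_eqF.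
move: main even; rewrite !ler_norml => /andP[? ?] /andP[? ?].
by apply/andP; split; lra.
Qed.

End FourthNorm.

(** * The coefficients of J + V *)

Local Notation RR := Rdefinitions.R.

Lemma legendreE a p : prime p -> legendre a p = legendreC RR p a.
Proof.
move=> p_pr; rewrite /legendre /legendreC /qchar natr_Fp_eq0 //; case: ifP => // _.
have -> : is_square (a%:R : 'F_p) = has (fun x => (x * x %% p == a %% p)%N) (iota 0 p).
  have eqE (i j : nat) : ((i%:R : 'F_p) == j%:R) = ((i %% p)%N == (j %% p)%N).
    by rewrite -(inj_eq val_inj) /= !val_Fp_nat.
  apply/is_squareP/hasP => [[y yE]|[x _ xE]].
    exists (y : nat); first by rewrite mem_iota add0n (leq_trans (ltn_ord y)) // Fp_cast.
    by rewrite -eqE natrM natr_Zp -expr2 yE.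
  by exists (x%:R); apply/eqP; rewrite expr2 -natrM eqE.
by case: has.
Qed.

Section Squarefree.
Variable n : nat.
Hypotheses (n_odd : odd n) (n_gt1 : (1 < n)%N) (n_sqf : squarefree n).

Lemma squarefree_logn m p : (m %| n)%N -> p \in primes m -> logn p m = 1%N.
Proof.
move=> mn pm; have : (0 < logn p m)%N by rewrite logn_gt0.
case e : (logn p m) => [|[|k]] // _; exfalso.
have p_pr : prime p by move: pm; rewrite mem_primes => /andP[].
apply: (n_sqf p_pr); apply: dvdn_trans mn; rewrite mulnn.
have m0 : (0 < m)%N by move: pm; rewrite mem_primes => /and3P[].
by rewrite pfactor_dvdn // e.
Qed.

Lemma prod_primes_squarefree : (\prod_(p <- primes n) p)%N = n.
Proof.
rewrite [RHS]prod_prime_decomp 1?ltnW // prime_decompE big_map /=.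
by rewrite big_seq [RHS]big_seq; apply: eq_bigr => p pn; rewrite (squarefree_logn _ pn) ?expn1.
Qed.

Lemma odd_primes_primes : odd_primes (primes n).
Proof.
rewrite /odd_primes primes_uniq; apply/allP => p; rewrite mem_primes => /and3P[p_pr _ pn].
by rewrite p_pr (dvdn_odd pn).
Qed.

Lemma primes_pdiv : exists2 qs, primes n = pdiv n :: qs & all (leq (pdiv n)) qs.
Proof.
have pd : pdiv n \in primes n by rewrite mem_primes pdiv_prime // pdiv_dvd ltnW.
have : pdiv n = head 1%N (primes n) by rewrite /pdiv.
case e : (primes n) pd => [|q qs] //= _ ->; exists qs => //.
apply/allP => x xq; have : x \in primes n by rewrite e inE xq orbT.
have -> : q = pdiv n by rewrite /pdiv e.
by rewrite mem_primes => /and3P[xp _ xn]; rewrite pdiv_min_dvd // prime_gt1.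
Qed.

Lemma jacobiE j m : (m %| n)%N -> jacobi j m = \prod_(p <- primes m) legendreC RR p j.
Proof.
move=> mn; rewrite /jacobi unlock /=.
have : {subset primes m <= primes m} by [].
elim: {1 3 4}(primes m) => [|p s IH] sub //=.
rewrite IH; last by move=> x xs; apply: sub; rewrite inE xs orbT.
rewrite (squarefree_logn mn) ?sub ?mem_head // RpowE expr1 legendreE //.
by have := sub p (mem_head _ _); rewrite mem_primes => /andP[].
Qed.

(** As [n] is squarefree, the primes of n / gcd(j, n) are exactly the primes of n that do not divide
    j, and the others contribute the factor 1. *)
Lemma modified_jacobiE j : modified_jacobi RR (primes n) j = jacobi j (n %/ gcdn j n).
Proof.
have n0 : (0 < n)%N by apply: ltnW.
have g0 : (0 < gcdn j n)%N by rewrite gcdn_gt0 n0 orbT.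
have dv : (n %/ gcdn j n %| n)%N by rewrite dvdn_div ?dvdn_gcdr.
have m0 : (0 < n %/ gcdn j n)%N by rewrite divn_gt0 // dvdn_leq // dvdn_gcdr.
rewrite jacobiE // /modified_jacobi.
have mE : (gcdn j n * (n %/ gcdn j n) = n)%N by rewrite mulnC divnK ?dvdn_gcdr.
rewrite [RHS](perm_big [seq p <- primes n | ~~ (p %| j)%N]); last first.
  apply: uniq_perm; rewrite ?filter_uniq ?primes_uniq // => p.
  rewrite mem_filter !mem_primes m0 n0 /=; case: (boolP (prime p)) => //= p_pr; last first.
    by rewrite andbF.
  case: (boolP (p %| j)%N) => pj /=.
    apply/negP => pm; apply: (n_sqf p_pr); rewrite -mE dvdn_mul // dvdn_gcd pj.
    exact: dvdn_trans pm dv.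
  apply/idP/idP => [pm|pn]; first exact: dvdn_trans pm dv.
  move: pn; rewrite -{1}mE Euclid_dvdM // => /orP[] //; rewrite dvdn_gcd (negPf pj).
  by [].
rewrite big_filter [RHS]big_mkcond; apply: eq_big_seq => p.
rewrite mem_primes => /andP[p_pr _]; rewrite /modified_legendre.
by case: (boolP (p %| j)%N) => pj; rewrite /= ?addr0 // legendreC_dvd // add0r.
Qed.

(** At each index one summand vanishes: if gcd(j, n) > 1 the symbol modulo [n] is zero, and
    otherwise V has no term. The index 0 belongs to V, since its gcd with [n] is [n]. *)
Lemma coef_modified_jacobi j : (j < n)%N ->
  addpoly (Jpoly n) (Vpoly n) j = modified_jacobi RR (primes n) j.
Proof.
move=> jn; rewrite modified_jacobiE /addpoly /Jpoly /Vpoly jn andbT RplusE /=.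
have n0 : (0 < n)%N by apply: ltnW.
case: (ltnP 1 (gcdn j n)) => g1; last first.
  have g : gcdn j n = 1%N.
    by apply/eqP; rewrite eqn_leq g1 gcdn_gt0 n0 orbT.
  rewrite g divn1 addr0; case: (posnP j) => // j0.
  by move: g1; rewrite j0 gcd0n leqNgt n_gt1.
case: ifP => _; last by rewrite add0r.
have pp := pdiv_prime g1; have := pdiv_dvd (gcdn j n); rewrite dvdn_gcd => /andP[pj pn].
have pin : pdiv (gcdn j n) \in primes n by rewrite mem_primes pp n0.
rewrite (jacobiE _ (dvdnn n)) (big_rem _ pin) /= legendreC_dvd // mul0r add0r.
by [].
Qed.

(** The integer part may be negative or exceed [n]; by periodicity only its residue counts, which
    gives a natural shift. *)
Lemma rotate_coef r j : (j < n)%N ->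
  addpoly (rotate n (Jpoly n) r) (rotate n (Vpoly n) r) j =
  modified_jacobi RR (primes n) (j + Z.to_nat (Z.modulo (floorZ (Rmult (INR n) r)) (Z.of_nat n))).
Proof.
move=> jn; rewrite /addpoly /rotate jn.
set f := floorZ _; set k := Z.to_nat (Z.modulo (Z.add (Z.of_nat j) f) _).
have kE : k = ((j + Z.to_nat (Z.modulo f (Z.of_nat n))) %% n)%N.
  have nZ : Z.lt Z0 (Z.of_nat n) by move: n_gt1; lia.
  rewrite /k -Zplus_mod_idemp_r; have := Z.mod_pos_bound f _ nZ.
  move: (Z.modulo f (Z.of_nat n)) => g g_bound.
  have [small|large] := ltnP (j + Z.to_nat g) n.
    by rewrite (modn_small small) Z.mod_small; lia.
  have -> : (j + Z.to_nat g)%N = (n + (j + Z.to_nat g - n))%N by rewrite subnKC.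
  rewrite modnDl modn_small; last by lia.
  by rewrite -(Zmod_unique _ _ (Zpos xH) (Z.sub (Z.add (Z.of_nat j) g) (Z.of_nat n))); lia.
have kn : (k < n)%N by rewrite kE ltn_mod ltnW.
rewrite -[LHS]/(addpoly (Jpoly n) (Vpoly n) k) coef_modified_jacobi // kE.
have := modified_jacobi_periodic RR odd_primes_primes; rewrite prod_primes_squarefree => per.
exact: periodic_mod per _.
Qed.

End Squarefree.

Lemma IZR_natE k : IZR (Z.of_nat k) = k%:R.
Proof. by rewrite -INR_IZR_INZ INRE. Qed.

Lemma sumRE k (f : nat -> RR) : sumR k f = \sum_(j < k) f j.
Proof. by elim: k => [|k IH]; rewrite ?big_ord0 //= big_ord_recr /= IH. Qed.

(** * The root of unity exp(i PI / n) and its chords *)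

Definition cis (t : RR) : RR[i] := Complex (cos t) (sin t).
#[local] Arguments cis t%_ring_scope.

Lemma cisD s t : cis (s + t) = cis s * cis t.
Proof.
by rewrite /cis cosD sinD; apply/eqP; rewrite eq_complex /= !eqxx [_ * _ + _]addrC eqxx.
Qed.

Lemma cis0 : cis 0 = 1.
Proof. by rewrite /cis cos_0 sin_0. Qed.

Lemma cisX t k : cis t ^+ k = cis (k%:R * t).
Proof.
elim: k => [|k IH]; first by rewrite expr0 mulr0n mul0r cis0.
by rewrite exprS IH -cisD -natr1 mulrDl mul1r addrC.
Qed.

Lemma cis_neq0 t : cis t != 0.
Proof.
apply/eqP => H; have := cisD t (- t); rewrite subrr cis0 H mul0r => /eqP.
by rewrite oner_eq0.
Qed.

Lemma cisN t : cis (- t) = (cis t)^-1.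
Proof. by apply: (mulfI (cis_neq0 t)); rewrite divff ?cis_neq0 // -cisD subrr cis0. Qed.

Lemma nrm_complex (z : RR[i]) : nrm z = R_sqrt.sqrt (complex.Re z ^+ 2 + complex.Im z ^+ 2)%R.
Proof. by rewrite RsqrtE; case: z. Qed.

Lemma nrm_1_sub_cis t : (0 <= t)%coqR -> (t <= 2 * PI)%coqR ->
  nrm (1 - cis t) = (2 * sin (t / 2))%coqR.
Proof.
move=> t0 t1; rewrite nrm_complex /=.
have -> : (1 - cos t) ^+ 2 + (0 - sin t) ^+ 2 = Rsqr (2 * sin (t / 2))%coqR.
  have ct := cos_2a_sin (t / 2)%coqR; have st := sin2_cos2 t.
  have e : (2 * (t / 2))%coqR = t by Rfield.
  rewrite e in ct; rewrite !expr2 /Rsqr in st *.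
  change ((1 - cos t) * (1 - cos t) + (0 - sin t) * (0 - sin t)
    = 2 * sin (t / 2) * (2 * sin (t / 2)))%coqR.
  by Lra.nra.
rewrite sqrt_Rsqr //; apply: Rmult_le_pos; first by Lra.lra.
by apply: sin_ge_0; Lra.lra.
Qed.

(** Concavity through two mean values: sin x >= x cos x and 1 - sin x <= (PI / 2 - x) cos x. If sin
    x were below the chord, the first would force cos x < 2 / PI, and the second would then put sin
    x above the chord. *)
Lemma jordan_sin x : (0 <= x)%coqR -> (x <= PI / 2)%coqR -> (2 * x / PI <= sin x)%coqR.
Proof.
move=> x0 x1; have pi0 := PI_RGT_0.
case: (Req_dec x 0) => [->|xn0]; first by rewrite sin_0; apply: Req_le; Rfield; Lra.lra.
case: (Req_dec x (PI / 2)%coqR) => [->|xn1].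
  by rewrite sin_PI2; apply: Req_le; Rfield; Lra.lra.
have xp : (0 < x)%coqR by Lra.lra.
have xl : (x < PI / 2)%coqR by Lra.lra.
have [c1 [e1 [c1a c1b]]] := MVT_cor2 sin cos 0 x xp (fun c _ => derivable_pt_lim_sin c).
have [c2 [e2 [c2a c2b]]] := MVT_cor2 sin cos x (PI / 2)%coqR xl (fun c _ => derivable_pt_lim_sin c).
rewrite sin_0 in e1; rewrite sin_PI2 in e2.
have h1 : (cos x <= cos c1)%coqR by apply: Rlt_le; apply: cos_decreasing_1; Lra.lra.
have h2 : (cos c2 <= cos x)%coqR by apply: Rlt_le; apply: cos_decreasing_1; Lra.lra.
case: (Rle_lt_dec (2 * x / PI)%coqR (sin x)) => // lt.
exfalso.
have k1 : (x * cos x <= sin x)%coqR by Lra.nra.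
have k2 : (1 - sin x <= cos x * (PI / 2 - x))%coqR by Lra.nra.
have k3 : (cos x < 2 / PI)%coqR.
  apply: (Rmult_lt_reg_l x) => //; apply: Rle_lt_trans k1 _.
  by apply: Rlt_le_trans lt _; apply: Req_le; Rfield; Lra.lra.
have k4 : (cos x * (PI / 2 - x) < 2 / PI * (PI / 2 - x))%coqR.
  by apply: Rmult_lt_compat_r => //; Lra.lra.
have k5 : (2 / PI * (PI / 2 - x) = 1 - 2 * x / PI)%coqR by Rfield; Lra.lra.
by Lra.lra.
Qed.

Section Root.
Variable n : nat.
Hypothesis n_gt0 : (0 < n)%N.
Let nR : (0 < INR n)%coqR.
Proof. by apply: lt_0_INR; apply/ssrnat.ltP. Qed.
Definition zeta : RR[i] := cis (PI / INR n)%coqR.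

Lemma zetaX k : zeta ^+ k = cis (INR k * (PI / INR n))%coqR.
Proof. by rewrite /zeta cisX -INRE. Qed.

Lemma zeta_far k : (k <= n)%N -> 2 * k%:R / n%:R <= nrm (1 - zeta ^+ k).
Proof.
move=> kn; have pi0 := PI_RGT_0.
have kR : (INR k <= INR n)%coqR by apply: le_INR; apply/ssrnat.leP.
have k0 : (0 <= INR k)%coqR by apply: pos_INR.
have q1 : (0 <= INR k / INR n <= 1)%coqR.
  split; first by apply: Rcomplements.Rdiv_le_0_compat.
  by apply/Rcomplements.Rle_div_l => //; Lra.lra.
have e : (INR k * (PI / INR n) = INR k / INR n * PI)%coqR by Rfield; Lra.lra.
rewrite zetaX nrm_1_sub_cis ?e; [|by Lra.nra|by Lra.nra].
rewrite -!INRE; apply/RleP.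
have j := @jordan_sin (INR k / INR n * PI / 2)%coqR ltac:(Lra.nra) ltac:(Lra.nra).
have e2 : (2 * (INR k / INR n * PI / 2) / PI = INR k / INR n)%coqR by Rfield; split; Lra.lra.
rewrite e2 in j.
by change (INR 2 * INR k / INR n <= 2 * sin (INR k / INR n * PI / 2))%coqR; rewrite /=; Lra.lra.
Qed.

Lemma zeta_prim : (2 * n).-primitive_root zeta.
Proof.
have pi0 := PI_RGT_0.
have [||m mp mdvd] := @prim_order_exists _ (2 * n) zeta.
- by rewrite muln_gt0.
- rewrite zetaX; have -> : (INR (2 * n) * (PI / INR n) = 2 * PI)%coqR.
    by rewrite mult_INR /=; Rfield; Lra.lra.
  by rewrite /cis cos_2PI sin_2PI.
have m0 := prim_order_gt0 mp.
have mle : (m <= 2 * n)%N by rewrite dvdn_leq // muln_gt0.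
move: mle; rewrite leq_eqVlt => /orP[/eqP <- //|mlt]; exfalso.
have mR : (0 < INR m)%coqR by apply: lt_0_INR; apply/ssrnat.ltP.
have mR2 : (INR m < 2 * INR n)%coqR.
  by move/ssrnat.ltP/lt_INR: mlt; rewrite mult_INR.
have q1 : (0 < INR m / INR n)%coqR by apply: Rdiv_lt_0_compat.
have q2 : (INR m / INR n < 2)%coqR by apply/Rcomplements.Rlt_div_l.
have := congr1 (fun x => nrm (1 - x)) (prim_expr_order mp).
have e : (INR m * (PI / INR n) = INR m / INR n * PI)%coqR by Rfield; Lra.lra.
rewrite subrr nrm0 zetaX nrm_1_sub_cis ?e; [|by Lra.nra|by Lra.nra].
have : (0 < sin (INR m / INR n * PI / 2))%coqR by apply: sin_gt_0; Lra.nra.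
move=> h1 h2; change (2 * sin (INR m / INR n * PI / 2) = 0)%coqR in h2.
by Lra.lra.
Qed.

Lemma zeta_even l : (zeta ^+ 2)^-1 ^+ l = cis (even_node n l).
Proof.
rewrite zetaX -cisN cisX -INRE; congr cis; rewrite /even_node.
change (INR l * - (2 * (PI / INR n)) = - (2 * PI * INR l / INR n))%coqR.
by Rfield; Lra.lra.
Qed.

Lemma zeta_odd l : zeta * (zeta ^+ 2)^-1 ^+ l = cis (odd_node n l).
Proof. by rewrite zeta_even /zeta -cisD. Qed.

Lemma nrm_poly (a b : nat -> RR) t : (forall j, (j < n)%N -> a j = b j) ->
  nrm (\sum_(j < n) (b j)%:C * cis t ^+ j) = poly_abs n a t.
Proof.
move=> ab; rewrite nrm_complex /poly_abs /poly_re /poly_im !sumRE !RpowE RplusE.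
have sumE k : \sum_(j < k) (b j)%:C * cis t ^+ j =
    Complex (\sum_(j < k) b j * cos (INR j * t)%coqR) (\sum_(j < k) b j * sin (INR j * t)%coqR).
  elim: k => [|k IH]; first by rewrite !big_ord0.
  rewrite !big_ord_recr /= IH cisX -INRE; apply/eqP.
  by rewrite eq_complex /= !mul0r subr0 addr0 !eqxx.
by rewrite sumE /=; congr (R_sqrt.sqrt (_ ^+ 2 + _ ^+ 2)); apply: eq_bigr => j _; rewrite ab.
Qed.

End Root.

(** * Transfer to the norms of the statement *)

Definition start_index (n : nat) (r : RR) : nat :=
  Z.to_nat (Z.modulo (floorZ (INR n * r)%coqR) (Z.of_nat n)).

Definition JV_poly (n : nat) (r : RR) : nat -> RR :=
  addpoly (rotate n (Jpoly n) r) (rotate n (Vpoly n) r).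

Lemma normpow_2_JV n r : odd n -> (1 < n)%N -> squarefree n -> normpow n (JV_poly n r) 2 = INR n.
Proof.
move=> n_odd n_gt1 n_sqf; rewrite normpow_2 sumRE INRE.
rewrite (eq_bigr (fun=> 1)) ?sumr_const ?card_ord // => j _.
rewrite RpowE /JV_poly rotate_coef // modified_jacobi_sqr //; exact: odd_primes_primes.
Qed.

Lemma normpow_4_JV n r d0 (delta sigma L Lam : RR) :
  odd n -> (1 < n)%N -> squarefree n ->
  let eta := ((1 + / sqrt (INR (pdiv n))) ^ size (primes n) - 1)%coqR in
  (d0 < n)%N -> (n %| d0 + 2 * start_index n r + n.-1)%N ->
  (eta <= 1)%coqR -> (0 <= delta)%coqR -> (625 <= delta ^ 4 * INR (pdiv n))%coqR ->
  (0 < sigma)%coqR -> (1 <= sigma ^ 2 * INR (2 * (pdiv n)./2))%coqR ->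
  (2 * sumR n (fun m => / INR (2 * m + 1)) <= L)%coqR ->
  (2 * sumR (pdiv n)./2 (fun m => / INR (2 * m + 1)) <= Lam)%coqR ->
  (Rabs (normpow n (JV_poly n r) 4 / INR n ^ 2
     - (1 / 2 + (2 + (Rabs (INR n - 2 * INR d0) / INR n) ^ 2
               - 2 * ((INR n ^ 2 + 2) / (3 * INR n ^ 2))) / 2))
   <= (3 * eta + (32 * L ^ 3 * sigma + (38 * eta + delta) * Lam ^ 4 + 8 * sigma ^ 2)) / 2)%coqR.
Proof.
move=> n_odd n_gt1 n_sqf eta d0n dv eta1 delta0 hdelta sigma0 hsigma hL hLam.
have n0 : (0 < n)%N := ltnW n_gt1.
have [qs psE qmin] := primes_pdiv n_gt1.
have prodE := prod_primes_squarefree n_gt1 n_sqf.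
have ops := odd_primes_primes n_odd.
have rc := rotate_coef n_odd n_gt1 n_sqf r.
rewrite psE in prodE ops rc.
have n4 := normpow_4 n (JV_poly n r) (elimT ssrnat.ltP n0).
have nn0 : n%:R != 0 :> RR by rewrite pnatr_eq0 -lt0n.
have := @fourth_norm_estimate RR (pdiv n) qs ops qmin (start_index n r) d0 (zeta n)
  delta sigma L Lam; cbv zeta.
rewrite prodE => /(_ (zeta_prim n0) (zeta_far n0) d0n dv).
have etaE : (1 + (Num.sqrt (pdiv n)%:R)^-1) ^+ (size qs).+1 - 1 = eta.
  by rewrite /eta psE RminusE RpowE RplusE RinvE RsqrtE INRE.
(* The two notations for real literals, [k%:R] and the embedding of an integer, are reconciled one
   constant at a time. *)
have c2 : 2%:R = 2%coqR by rewrite -(IZR_natE 2).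
have c625 : 625%:R = 625%coqR by rewrite -(IZR_natE 625).
have c32 : 32%:R = 32%coqR by rewrite -(IZR_natE 32).
have c38 : 38%:R = 38%coqR by rewrite -(IZR_natE 38).
have c3 : 3%:R = 3%coqR by rewrite -(IZR_natE 3).
have c8 : 8%:R = 8%coqR by rewrite -(IZR_natE 8).
have hsE k : odd_harmonic RR k = sumR k (fun m => / INR (2 * m + 1))%coqR.
  by rewrite sumRE; apply: eq_bigr => m _; rewrite INRE.
rewrite !hsE etaE.
have eta1' : eta <= 1 by apply/RleP.
have delta0' : 0 <= delta by apply/RleP.
have hdelta' : 625 <= delta ^+ 4 * (pdiv n)%:R.
  by rewrite c625 -INRE -RpowE; apply/RleP.
have sigma0' : 0 < sigma by apply/RltP.
have hsigma' : 1 <= sigma ^+ 2 * (2 * (pdiv n)./2)%:R.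
  by rewrite -INRE -RpowE; apply/RleP.
move=> /(_ eta1' delta0' hdelta' sigma0' hsigma').
rewrite c2 => /(_ ltac:(by apply/RleP) ltac:(by apply/RleP)) /RleP.
have -> : \sum_(l < n) (nrm (\sum_(j < n) (modified_jacobi RR (pdiv n :: qs) (j + start_index n r))%:C
           * (zeta n ^+ 2)^-1 ^+ l ^+ j) ^+ 4
     + nrm (\sum_(j < n) (modified_jacobi RR (pdiv n :: qs) (j + start_index n r))%:C
           * (zeta n * (zeta n ^+ 2)^-1 ^+ l) ^+ j) ^+ 4)
   = sumR n (fun l => poly_abs n (JV_poly n r) (even_node n l) ^ 4
                   + poly_abs n (JV_poly n r) (odd_node n l) ^ 4)%coqR.
  rewrite sumRE; apply: eq_bigr => l _; rewrite RplusE !RpowE.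
  rewrite (zeta_odd n0) (zeta_even n0).
  by congr (_ ^+ 4 + _ ^+ 4); apply: nrm_poly rc.
move=> H; apply: Rle_trans (Rle_trans _ _ _ _ H) _.
  apply: Req_le; rewrite n4 !RabsE; congr (`| _ |).
  rewrite !RpowE !RdivE ?(RminusE, RplusE, RmultE, INRE, RabsE).
  rewrite c3 -c2; congr (_ - _).
  set S := sumR _ _.
  by field.
apply: Req_le; rewrite c3 c32 c38 c8.
by rewrite !RpowE !RdivE ?(RminusE, RplusE, RmultE).
Qed.

Lemma pdiv_half n : odd n -> (1 < n)%N -> pdiv n = (2 * (pdiv n)./2 + 1)%N.
Proof.
move=> n_odd n_gt1; rewrite mul2n -{1}(odd_double_half (pdiv n)) (dvdn_odd (pdiv_dvd n)) //.
by rewrite addnC.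
Qed.

Lemma pdiv_ge3 n : odd n -> (1 < n)%N -> (3 <= pdiv n)%N.
Proof.
move=> n_odd n_gt1; rewrite ltn_neqAle prime_gt1 ?pdiv_prime // andbT eq_sym.
by apply: contraL n_odd => /eqP e; rewrite -dvdn2 -e pdiv_dvd.
Qed.

(** Since ln 3 >= 1, this bounds the number of prime factors by ln n, which controls the exponent in
    [eta]. *)
Lemma size_primes_le n : odd n -> (1 < n)%N -> squarefree n -> (3 ^ size (primes n) <= n)%N.
Proof.
move=> n_odd n_gt1 n_sqf; rewrite -{2}(prod_primes_squarefree n_gt1 n_sqf).
have : all (leq 3) (primes n).
  apply/allP => q; rewrite mem_primes => /and3P[q_pr _ qn].
  apply: leq_trans (pdiv_ge3 n_odd n_gt1) _.
  by rewrite pdiv_min_dvd // prime_gt1.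
elim: (primes n) => [|q qs IH] /=; first by rewrite big_nil.
by case/andP=> q3 /IH h; rewrite big_cons expnS leq_mul.
Qed.

Lemma kernel_index_exists n s : (0 < n)%N -> exists2 d0, (d0 < n)%N & (n %| d0 + 2 * s + n.-1)%N.
Proof.
move=> n0; pose k := (2 * s + n.-1)%N; exists ((n - k %% n) %% n)%N; first by rewrite ltn_mod.
rewrite -addnA -/k /dvdn modnDml -modnDmr subnK ?modnn //; exact: ltnW (ltn_pmod _ n0).
Qed.

End CharacterPolynomials.

(** * Asymptotics *)

From mathcomp Require Import ssreflect ssrfun ssrbool eqtype ssrnat seq div prime.
Import TrigonometricMeans CharacterPolynomials.
Import zify_ssreflect.

Local Open Scope R_scope.

Lemma ln_le_sub1 y : 0 < y -> ln y <= y - 1.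
Proof. intros Hy. pose proof (exp_ineq1_le (ln y)) as H. rewrite exp_ln in H; lra. Qed.

Lemma sum_inv_odd_le k : (1 <= k)%N -> sumR k (fun m => / INR (2 * m + 1)) <= 1 + ln (INR k).
Proof.
  intros Hk; destruct k as [|k]; [easy|clear Hk].
  induction k as [|k IH].
  - simpl; rewrite ln_1; lra.
  - change (sumR (S (S k)) (fun m => / INR (2 * m + 1)))
      with (sumR (S k) (fun m => / INR (2 * m + 1)) + / INR (2 * S k + 1)).
    pose proof (pos_INR k) as Hk.
    assert (E1 : INR (S k) = INR k + 1) by apply S_INR.
    assert (E2 : INR (S (S k)) = INR k + 2) by (rewrite S_INR E1; ring).
    assert (E3 : INR (2 * S k + 1) = 2 * INR k + 3).
    { replace (2 * S k + 1)%N with (2 * k + 3)%coq_nat by lia.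
      rewrite plus_INR mult_INR; simpl; ring. }
    rewrite E1 in IH; rewrite E2 E3.
    assert (Hl : ln ((INR k + 1) / (INR k + 2)) <= (INR k + 1) / (INR k + 2) - 1).
    { apply ln_le_sub1; apply Rdiv_lt_0_compat; lra. }
    rewrite ln_div in Hl; [|lra|lra].
    assert (Hf : (INR k + 1) / (INR k + 2) - 1 = - / (INR k + 2)) by (field; lra).
    assert (Hi : / (2 * INR k + 3) <= / (INR k + 2)) by (apply Rinv_le_contravar; lra).
    lra.
Qed.

(** With y = k x the power is at most exp y, which is at most 1 / (1 - y), hence at most 1 + 2 y as
    long as y <= 1/2. *)
Lemma pow_1_plus_le x k : 0 <= x -> INR k * x <= / 2 -> (1 + x) ^ k - 1 <= 2 * (INR k * x).
Proof.
  intros Hx Hk.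
  assert (H1 : (1 + x) ^ k <= exp (INR k * x)).
  { clear Hk; induction k as [|k IH]; [simpl; rewrite Rmult_0_l exp_0; lra|].
    rewrite S_INR Rmult_plus_distr_r Rmult_1_l exp_plus -tech_pow_Rmult Rmult_comm.
    apply Rmult_le_compat; [apply pow_le; lra|lra|easy|apply exp_ineq1_le]. }
  pose proof (exp_ineq1_le (- (INR k * x))) as H2.
  rewrite exp_Ropp in H2; pose proof (exp_pos (INR k * x)) as He.
  set (y := INR k * x) in *.
  assert (Hy : 0 <= y) by (apply Rmult_le_pos; [apply pos_INR|easy]).
  assert (H3 : exp y * (1 - y) <= 1).
  { apply (Rmult_le_compat_l (exp y)) in H2; [|lra].
    rewrite Rinv_r in H2; lra. }
  nra.
Qed.

(** Here u = p^(1/8), v = p^(1/32) and l = ln n, so powers of [theta * u] dominate those of [l]. The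
    bound on [Lam] comes from ln p <= 32 (v - 1); its fourth power is of order u, against 1 / u^2 in
    front. The largest constant is 81 * 66^4 / 2, where 81 = 2 * 38 + 5, and 10^9 leaves room for
    the rest. *)
Lemma error_bound (theta u v l eta Lam : R) :
  0 < theta <= 1 -> 0 < u -> 1 <= theta * u -> 0 < v -> v ^ 4 = u -> 1 <= l ->
  l ^ 7 <= (theta * u) ^ 8 -> 0 <= eta <= 2 * (l / u ^ 4) -> 0 <= Lam <= 66 * v ->
  (3 * eta + (32 * (4 * l) ^ 3 * (2 / u ^ 4) + (38 * eta + 5 / u ^ 2) * Lam ^ 4
     + 8 * (2 / u ^ 4) ^ 2)) / 2 <= 10 ^ 9 * theta.
Proof.
  intros Ht Hu Htu Hv Hvu Hl Hl7 Heta HLam.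
  set (T := theta * u) in *.
  assert (sq : forall x y, 0 <= y -> x ^ 2 <= y ^ 2 -> x <= y).
  { intros x y Hy H; apply Rnot_lt_le; intros Hlt; nra. }
  assert (HT2 : l <= T ^ 2).
  { apply sq; [apply pow2_ge_0|]; apply sq; [apply pow2_ge_0|].
    replace (((T ^ 2) ^ 2) ^ 2) with (T ^ 8) by ring.
    replace ((l ^ 2) ^ 2) with (l ^ 4) by ring.
    apply Rle_trans with (2 := Hl7); apply Rle_pow; [easy|lia]. }
  assert (HT4 : l ^ 3 <= T ^ 4).
  { apply sq; [replace (T ^ 4) with ((T ^ 2) ^ 2) by ring; apply pow2_ge_0|].
    replace ((T ^ 4) ^ 2) with (T ^ 8) by ring.
    replace ((l ^ 3) ^ 2) with (l ^ 6) by ring.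
    apply Rle_trans with (2 := Hl7); apply Rle_pow; [easy|lia]. }
  set (s := / u).
  assert (Hs : 0 < s) by (now apply Rinv_0_lt_compat).
  assert (Hsu : s * u = 1) by (unfold s; field; lra).
  assert (Hst : s <= theta).
  { apply Rmult_le_reg_r with u; [easy|]. fold T; lra. }
  assert (Hs1 : s <= 1) by lra.
  assert (pw : forall k x, 0 <= x <= 1 -> 0 <= x ^ k.+1 <= x).
  { intros k x Hx; induction k as [|k IH]; [simpl; lra|].
    rewrite -(tech_pow_Rmult x k.+1); nra. }
  assert (Hl4 : l / u ^ 4 <= theta ^ 2 * s ^ 2).
  { replace (theta ^ 2 * s ^ 2) with (T ^ 2 / u ^ 4) by (unfold T, s; field; lra).
    apply Rmult_le_compat_r; [|easy].
    apply Rlt_le, Rinv_0_lt_compat, pow_lt; easy. }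
  assert (HL3 : 32 * (4 * l) ^ 3 * (2 / u ^ 4) <= 4096 * theta ^ 4).
  { replace (32 * (4 * l) ^ 3 * (2 / u ^ 4)) with (4096 * (l ^ 3 / u ^ 4)) by (field; lra).
    replace (theta ^ 4) with (T ^ 4 / u ^ 4) by (unfold T; field; lra).
    apply Rmult_le_compat_l; [lra|]; apply Rmult_le_compat_r; [|easy].
    apply Rlt_le, Rinv_0_lt_compat, pow_lt; easy. }
  assert (HLam4 : Lam ^ 4 <= 66 ^ 4 * u).
  { rewrite -Hvu -Rpow_mult_distr; apply pow_incr; lra. }
  assert (Ht2 := pw 1%nat theta ltac:(lra)).
  assert (Ht4 := pw 3%nat theta ltac:(lra)).
  assert (Hs2 := pw 1%nat s ltac:(lra)).
  assert (Hs8 := pw 7%nat s ltac:(lra)).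
  assert (Heta2 : eta <= 2 * (theta ^ 2 * s ^ 2)) by lra.
  assert (Hts : theta ^ 2 * s ^ 2 <= s ^ 2) by nra.
  assert (Hts' : theta ^ 2 * s ^ 2 <= theta) by nra.
  replace (5 / u ^ 2) with (5 * s ^ 2) by (unfold s; field; lra).
  replace (8 * (2 / u ^ 4) ^ 2) with (32 * s ^ 8) by (unfold s; field; lra).
  assert (HA : (38 * eta + 5 * s ^ 2) * Lam ^ 4 <= 81 * s ^ 2 * (66 ^ 4 * u)).
  { apply Rmult_le_compat; [lra|apply pow_le; lra|lra|easy]. }
  replace (81 * s ^ 2 * (66 ^ 4 * u)) with (81 * 66 ^ 4 * s * (s * u)) in HA by ring.
  rewrite Hsu Rmult_1_r in HA.
  assert (HB : 81 * 66 ^ 4 * s <= 81 * 66 ^ 4 * theta) by (apply Rmult_le_compat_l; lra).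
  lra.
Qed.

(* Both [y] and the folded value of [1 + 4 x] lie in [[-1, 1]] and agree up to [e] modulo [2]. *)
Lemma fold_distance (x y e : R) (m : Z) : - / 2 < x <= / 2 -> -1 <= y <= 1 -> Rabs e < 1 ->
  y = 1 + 4 * x + e - 2 * IZR m -> Rabs (Rabs y - Rabs (1 - 4 * Rabs x)) <= Rabs e.
Proof.
  intros Hx Hy He E.
  assert (He' := Rabs_def2 _ _ He); destruct He' as [He1 He2].
  assert (Hm : (-1 <= m <= 2)%Z).
  { assert (H1 : IZR (-2) < IZR m) by (simpl; lra).
    assert (H2 : IZR m < IZR 3) by lra.
    apply lt_IZR in H1, H2; lia. }
  assert (D : m = (-1)%Z \/ m = 0%Z \/ m = 1%Z \/ m = 2%Z) by lia.
  unfold Rabs; destruct D as [-> | [-> | [-> | ->]]];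
    repeat match goal with |- context [Rcase_abs ?a] => destruct (Rcase_abs a) end; lra.
Qed.

(** From d0 = 1 - 2 s and s = floor(n r), both modulo n, the quotient (n - 2 d0) / n is 1 + 4 r
    modulo 2 up to (4 e1 + 2) / n, where e1 is a fractional part; hence 6 / n. The bound on [n]
    keeps this error below 1, as [fold_distance] requires. *)
Lemma kernel_index_phase n r d0 : (1 < n)%N -> (d0 < n)%N ->
  (n %| d0 + 2 * start_index n r + n.-1)%N ->
  6 < INR n -> let x := r + IZR (floorZ (/ 2 - r)) in
  Rabs (Rabs (INR n - 2 * INR d0) / INR n - Rabs (1 - 4 * Rabs x)) <= 6 / INR n.
Proof.
  intros Hn Hd Hdv H6 x.
  set (N := INR n) in *.
  destruct (base_Int_part (/ 2 - r)) as [Hj1 Hj2]; fold (floorZ (/ 2 - r)) in Hj1, Hj2.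
  destruct (base_Int_part (N * r)) as [Hf1 Hf2]; fold (floorZ (N * r)) in Hf1, Hf2.
  assert (HnZ : (0 < Z.of_nat n)%Z) by lia.
  set (f := floorZ (N * r)) in *; set (j := floorZ (/ 2 - r)) in *.
  set (q := (f / Z.of_nat n)%Z).
  assert (Hs : INR (start_index n r) = IZR f - N * IZR q).
  { unfold start_index; fold N; fold f.
    rewrite INR_IZR_INZ Z2Nat.id; [|apply Z.mod_pos_bound; easy].
    rewrite Z.mod_eq; [|lia]. rewrite minus_IZR mult_IZR -INR_IZR_INZ; easy. }
  destruct (dvdnP Hdv) as [t Ht].
  assert (HtR : INR d0 + 2 * INR (start_index n r) + (N - 1) = INR t * N).
  { unfold N; rewrite -mult_INR multE -Ht.
    replace (d0 + 2 * start_index n r + n.-1)%N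
      with (d0 + 2 * start_index n r + (n - 1))%coq_nat by lia.
    rewrite plus_INR plus_INR mult_INR minus_INR; [simpl; ring|lia]. }
  assert (HdR : 0 <= INR d0 <= N - 1).
  { split; [apply pos_INR|]. unfold N; change 1 with (INR 1).
    rewrite -minus_INR; [apply le_INR|]; lia. }
  set (e1 := N * r - IZR f).
  set (e := - (4 * e1 + 2) / N).
  set (y := (N - 2 * INR d0) / N).
  assert (HN : N <> 0) by lra.
  assert (Hy : y = 1 + 4 * x + e - 2 * IZR (2 * j + 2 * q + Z.of_nat t - 1)).
  { rewrite minus_IZR !plus_IZR !mult_IZR -INR_IZR_INZ.
    assert (Er : INR d0 = INR t * N - 2 * (IZR f - N * IZR q) - (N - 1)) by lra.
    unfold y, e, x, e1; rewrite Er; fold j; field; easy. }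
  assert (He : Rabs e <= 6 / N).
  { unfold e, e1, Rdiv; rewrite Rabs_mult (Rabs_pos_eq (/ N));
      [|apply Rlt_le, Rinv_0_lt_compat; lra].
    apply Rmult_le_compat_r; [apply Rlt_le, Rinv_0_lt_compat; lra|].
    apply Rabs_le; lra. }
  assert (Hy1 : -1 <= y <= 1).
  { unfold y; split.
    - apply Rmult_le_reg_r with N; [lra|]. unfold Rdiv; rewrite Rmult_assoc Rinv_l; lra.
    - apply Rmult_le_reg_r with N; [lra|]. unfold Rdiv; rewrite Rmult_assoc Rinv_l; lra. }
  assert (He1 : Rabs e < 1).
  { apply Rle_lt_trans with (1 := He). apply Rmult_lt_reg_r with N; [lra|].
    unfold Rdiv; rewrite Rmult_assoc Rinv_l; lra. }
  assert (Hx : - / 2 < x <= / 2) by (unfold x; lra).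
  pose proof (fold_distance x y e _ Hx Hy1 He1 Hy) as Hfold.
  replace (Rabs (N - 2 * INR d0) / N) with (Rabs y); last first.
  { unfold y, Rdiv; rewrite Rabs_mult (Rabs_pos_eq (/ N)); [easy|].
    apply Rlt_le, Rinv_0_lt_compat; lra. }
  lra.
Qed.

Lemma ln_3_ge1 : 1 <= ln 3.
Proof.
  rewrite -(ln_exp 1); apply ln_le; [apply exp_pos|apply exp_le_3].
Qed.

Lemma size_primes_ln n : odd n -> (1 < n)%N -> squarefree n ->
  INR (size (primes n)) <= ln (INR n).
Proof.
  intros H1 H2 H3.
  assert (H : INR (3 ^ size (primes n)) <= INR n).
  { apply le_INR; apply/leP; apply size_primes_le; easy. }
  assert (E : INR (3 ^ size (primes n)) = 3 ^ size (primes n)).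
  { elim: (size (primes n)) => [|k IH] //; rewrite expnS mult_INR IH; simpl; ring. }
  rewrite E in H.
  assert (Hln : ln (3 ^ size (primes n)) <= ln (INR n)) by (apply ln_le; [apply pow_lt; lra|easy]).
  rewrite ln_pow in Hln; [|lra].
  pose proof ln_3_ge1; pose proof (pos_INR (size (primes n))); nra.
Qed.

(** To the 10^9 of [error_bound] are added 6, half of the 12 theta lost in replacing [q ^ 2] by
    [w ^ 2], and 2/3 for the deviation of the fourth-power sum of the kernel from 1/3. *)
Lemma JV_fourth_norm_limit n r theta : odd n -> (1 < n)%N -> squarefree n ->
  0 < theta <= / 12 -> ln (INR n) ^ 7 <= theta ^ 8 * INR (pdiv n) ->
  Rabs (normpow n (JV_poly n r) 4 / INR n ^ 2 - 1
        - (/ 6 + 8 * (Rabs (r + IZR (floorZ (/ 2 - r))) - / 4) ^ 2))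
  <= (10 ^ 9 + 7) * theta.
Proof.
  intros n_odd n_gt1 n_sqf Ht Hl7.
  pose proof (pdiv_ge3 n_odd n_gt1) as Hp3.
  assert (Hpn : (pdiv n <= n)%N) by (apply dvdn_leq; [lia|apply pdiv_dvd]).
  set (P := INR (pdiv n)) in *; set (N := INR n) in *; set (l := ln N) in *.
  assert (HP3 : 3 <= P) by (unfold P; change 3 with (IZR (Z.of_nat 3));
    rewrite -INR_IZR_INZ; apply le_INR; lia).
  assert (HPN : P <= N) by (apply le_INR; lia).
  assert (Hl : 1 <= l).
  { apply Rle_trans with (1 := ln_3_ge1); apply ln_le; lra. }
  set (u := sqrt (sqrt (sqrt P))).
  assert (HsP : 0 < sqrt P) by (apply sqrt_lt_R0; lra).
  assert (HssP : 0 < sqrt (sqrt P)) by (now apply sqrt_lt_R0).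
  assert (Hu : 0 < u) by (now apply sqrt_lt_R0).
  assert (Hu2 : u ^ 2 = sqrt (sqrt P)) by (unfold u; rewrite pow2_sqrt; lra).
  assert (Hu4 : u ^ 4 = sqrt P).
  { replace (u ^ 4) with ((u ^ 2) ^ 2) by ring. rewrite Hu2 pow2_sqrt; lra. }
  assert (Hu8 : u ^ 8 = P).
  { replace (u ^ 8) with ((u ^ 4) ^ 2) by ring. rewrite Hu4 pow2_sqrt; lra. }
  set (T := theta * u).
  assert (HT : 0 < T) by (apply Rmult_lt_0_compat; lra).
  assert (HT8 : l ^ 7 <= T ^ 8) by (unfold T; rewrite Rpow_mult_distr Hu8; lra).
  assert (Hl71 : 1 <= l ^ 7) by (apply pow_R1_Rle; easy).
  assert (HT1 : 1 <= T).
  { apply Rnot_lt_le; intros HTlt.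
    assert (T ^ 8 < 1) by (apply pow_lt_1_compat; [lra|lia]). lra. }
  assert (Hu1 : 1 <= u) by (unfold T in HT1; nra).
  set (v := sqrt (sqrt u)).
  assert (Hsu : 0 < sqrt u) by (now apply sqrt_lt_R0).
  assert (Hv : 0 < v) by (now apply sqrt_lt_R0).
  assert (Hv4 : v ^ 4 = u).
  { replace (v ^ 4) with ((v ^ 2) ^ 2) by ring. unfold v; rewrite pow2_sqrt; [|lra].
    rewrite pow2_sqrt; lra. }
  assert (HlnP : 0 <= ln P <= 32 * (v - 1)).
  { split; [rewrite -ln_1; apply ln_le; lra|].
    rewrite -Hu8 -Hv4 -pow_mult ln_pow; [|easy].
    pose proof (ln_le_sub1 v Hv). replace (INR (4 * 8)%coq_nat) with 32 by (simpl; ring). lra. }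
  set (eta := (1 + / sqrt P) ^ size (primes n) - 1).
  pose proof (size_primes_ln n n_odd n_gt1 n_sqf) as Hsz; fold N in Hsz; fold l in Hsz.
  pose proof (pos_INR (size (primes n))) as Hsz0.
  assert (Hiu : 0 < / u ^ 4) by (apply Rinv_0_lt_compat, pow_lt; easy).
  assert (HlT : l <= T ^ 4).
  { apply Rnot_lt_le; intros H.
    assert (HT4 : 0 < T ^ 4) by (apply pow_lt; easy).
    assert (T ^ 8 < l ^ 2) by (replace (T ^ 8) with ((T ^ 4) ^ 2) by ring; nra).
    assert (l ^ 2 <= l ^ 7) by (apply Rle_pow; [easy|lia]). lra. }
  assert (Hlu : l / u ^ 4 <= / 2).
  { apply Rle_trans with (theta ^ 4).
    - replace (theta ^ 4) with (T ^ 4 / u ^ 4) by (unfold T; field; lra).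
      apply Rmult_le_compat_r; lra.
    - assert (theta ^ 4 <= (/ 12) ^ 4) by (apply pow_incr; lra). lra. }
  assert (Hszu : INR (size (primes n)) * / sqrt P <= l / u ^ 4).
  { rewrite -Hu4; apply Rmult_le_compat_r; lra. }
  assert (Heta : 0 <= eta <= 2 * (l / u ^ 4)).
  { split.
    - unfold eta. assert (1 <= (1 + / sqrt P) ^ size (primes n)).
      { apply pow_R1_Rle. rewrite -Hu4; lra. } lra.
    - apply Rle_trans with (2 * (INR (size (primes n)) * / sqrt P)); [|lra].
      apply pow_1_plus_le; [rewrite -Hu4; lra|lra]. }
  destruct (kernel_index_exists (start_index n r) (ltnW n_gt1)) as [d0 Hd0 Hdv].
  assert (Hhalf : INR (2 * (pdiv n)./2) = P - 1).
  { assert (HP1 : P = INR (2 * (pdiv n)./2) + 1).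
    { unfold P; rewrite {1}(pdiv_half n_odd n_gt1) addn1 S_INR; reflexivity. }
    lra. }
  assert (HK : (1 <= (pdiv n)./2)%N).
  { pose proof (pdiv_half n_odd n_gt1); lia. }
  assert (HKP : INR (pdiv n)./2 <= P).
  { apply le_INR; pose proof (pdiv_half n_odd n_gt1); lia. }
  assert (HK0 : 0 < INR (pdiv n)./2) by (apply lt_0_INR; lia).
  (* With u^8 = P these choices give delta^4 P = 625 exactly and sigma^2 (P - 1) = 4 (P - 1) / P >=
     1. [L] absorbs 2 (1 + l) because l >= 1. *)
  pose proof (normpow_4_JV (delta := 5 / u ^ 2) (sigma := 2 / u ^ 4) (L := 4 * l)
    (Lam := 2 * (1 + ln P)) n_odd n_gt1 n_sqf Hd0 Hdv) as Hmain.
  cbv zeta in Hmain; fold P in Hmain; fold N in Hmain; fold eta in Hmain.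
  specialize (Hmain ltac:(lra)).
  specialize (Hmain ltac:(apply Rlt_le, Rdiv_lt_0_compat; [lra|apply pow_lt; lra])).
  specialize (Hmain ltac:(rewrite -Hu8; right; field; lra)).
  specialize (Hmain ltac:(apply Rdiv_lt_0_compat; [lra|apply pow_lt; lra])).
  assert (Hsig : 1 <= (2 / u ^ 4) ^ 2 * INR (2 * (pdiv n)./2)).
  { rewrite Hhalf. replace ((2 / u ^ 4) ^ 2) with (4 / P) by (rewrite -Hu8; field; lra).
    apply Rmult_le_reg_r with P; [lra|].
    replace (4 / P * (P - 1) * P) with (4 * (P - 1)) by (field; lra). lra. }
  specialize (Hmain Hsig).
  pose proof (sum_inv_odd_le n (ltnW n_gt1)) as Hh1; fold N in Hh1; fold l in Hh1.
  pose proof (sum_inv_odd_le _ HK) as Hh2.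
  assert (Hln2 : ln (INR (pdiv n)./2) <= ln P) by (apply ln_le; easy).
  specialize (Hmain ltac:(lra) ltac:(lra)).
  pose proof (error_bound theta u v l eta (2 * (1 + ln P)) ltac:(lra) Hu HT1 Hv Hv4 Hl HT8 Heta
    ltac:(lra)) as Herr.
  set (G := normpow n (JV_poly n r) 4 / N ^ 2) in *.
  set (q := Rabs (N - 2 * INR d0) / N) in *.
  set (x := r + IZR (floorZ (/ 2 - r))) in *.
  assert (HNu : / N <= theta).
  { apply Rle_trans with (/ u).
    - apply Rinv_le_contravar; [easy|]. apply Rle_trans with (2 := HPN).
      rewrite -Hu8 -{1}(pow_1 u); apply Rle_pow; [easy|lia].
    - apply Rmult_le_reg_r with u; [easy|]. rewrite Rinv_l; [|lra]. fold T; easy. }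
  assert (HN0 : 0 < / N) by (apply Rinv_0_lt_compat; lra).
  assert (HNN : N * / N = 1) by (field; lra).
  assert (HN6 : 6 < N) by nra.
  pose proof (kernel_index_phase n r d0 n_gt1 Hd0 Hdv HN6) as Hph; cbv zeta in Hph.
  fold N in Hph; fold x in Hph; fold q in Hph.
  set (w := Rabs (1 - 4 * Rabs x)) in *.
  assert (Hqw : Rabs (q - w) <= 6 * theta).
  { unfold Rdiv in Hph; lra. }
  assert (Hd0N : 0 <= INR d0 <= N).
  { split; [apply pos_INR|apply le_INR; lia]. }
  assert (Hq : 0 <= q <= 1).
  { unfold q; split.
    - apply Rmult_le_pos; [apply Rabs_pos|lra].
    - apply Rmult_le_reg_r with N; [lra|]. unfold Rdiv; rewrite Rmult_assoc Rinv_l; [|lra].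
      rewrite Rmult_1_r Rmult_1_l; apply Rabs_le; lra. }
  assert (Hw : 0 <= w <= 1).
  { unfold w; split; [apply Rabs_pos|].
    assert (Hx : Rabs x <= / 2).
    { unfold x; destruct (base_Int_part (/ 2 - r)); unfold floorZ; apply Rabs_le; lra. }
    pose proof (Rabs_pos x); apply Rabs_le; lra. }
  assert (Hw2 : w ^ 2 = 16 * (Rabs x - / 4) ^ 2).
  { unfold w; rewrite pow2_abs; field. }
  assert (Hq2 : Rabs (q ^ 2 - w ^ 2) <= 12 * theta).
  { replace (q ^ 2 - w ^ 2) with ((q - w) * (q + w)) by ring.
    rewrite Rabs_mult (Rabs_pos_eq (q + w)); [|lra].
    pose proof (Rabs_pos (q - w)); nra. }
  assert (Hinv : (N ^ 2 + 2) / (3 * N ^ 2) = / 3 + 2 / 3 * (/ N) ^ 2) by (field; lra).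
  rewrite Hinv in Hmain.
  assert (HN2 : 0 <= (/ N) ^ 2 <= theta) by nra.
  assert (A1 : Rabs (G - (1 / 2 + (2 + q ^ 2 - 2 * (/ 3 + 2 / 3 * (/ N) ^ 2)) / 2)) <= 10 ^ 9 * theta)
    by lra.
  apply Rabs_le_between in A1; apply Rabs_le_between in Hq2; apply Rabs_le_between.
  lra.
Qed.

Theorem theorem6 (S : nat -> Prop)
  (S_infinite : forall N : nat, exists n : nat, S n /\ (N <= n)%coq_nat)
  (S_odd : forall n : nat, S n -> odd n)
  (S_gt1 : forall n : nat, S n -> (1 < n)%N)
  (S_sqfree : forall n : nat, S n -> squarefree n)
  (S_growth : forall eps : R, (0 < eps)%R ->
      exists N : nat, forall n : nat, S n -> (N <= n)%coq_nat ->
        (Rabs (ln (INR n) ^ 7 / INR (smallest_prime_factor n)) < eps)%R)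
  (r : R) :
  forall eps : R, (0 < eps)%R ->
    exists N : nat, forall n : nat, S n -> (N <= n)%coq_nat ->
      (Rabs (merit_factor n (addpoly (rotate n (Jpoly n) r) (rotate n (Vpoly n) r))
             - f_lim r) < eps)%R.
Proof.
  intros eps Heps.
  set (C := 10 ^ 9 + 7).
  assert (HC : 7 < C) by (unfold C; lra).
  (* Both [G - 1] and its limit [D] are bounded below, by 1/12 and 1/6, so passing to reciprocals
     multiplies the error by at most 72. The first bound on [theta] secures the 1/12; the 73 in the
     second makes the final inequality strict. *)
  set (theta := Rmin (/ (12 * C)) (eps / (73 * C))).
  assert (Ht0 : 0 < theta).
  { apply Rmin_pos; [apply Rinv_0_lt_compat; lra|apply Rdiv_lt_0_compat; lra]. }
  assert (Ht1 : C * theta <= / 12).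
  { apply Rle_trans with (C * / (12 * C)); [|right; field; lra].
    apply Rmult_le_compat_l; [lra|apply Rmin_l]. }
  assert (Ht2 : 72 * (C * theta) < eps).
  { apply Rle_lt_trans with (72 * (C * (eps / (73 * C)))).
    - apply Rmult_le_compat_l; [lra|]; apply Rmult_le_compat_l; [lra|apply Rmin_r].
    - replace (72 * (C * (eps / (73 * C)))) with (72 / 73 * eps) by (field; lra). lra. }
  destruct (S_growth (theta ^ 8)) as [N0 HN0]; [now apply pow_lt|].
  exists N0; intros n Sn Hn.
  pose proof (S_odd n Sn) as n_odd; pose proof (S_gt1 n Sn) as n_gt1.
  pose proof (S_sqfree n Sn) as n_sqf.
  specialize (HN0 n Sn Hn); unfold smallest_prime_factor in HN0.
  assert (HP : 0 < INR (pdiv n)).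
  { apply lt_0_INR; pose proof (pdiv_ge3 n_odd n_gt1); lia. }
  assert (HNp : 0 < INR n) by (apply lt_0_INR; lia).
  assert (Hl7 : ln (INR n) ^ 7 <= theta ^ 8 * INR (pdiv n)).
  { apply Rabs_def2 in HN0 as [HN0 _].
    apply (Rmult_lt_compat_r (INR (pdiv n))) in HN0; [|easy].
    unfold Rdiv in HN0; rewrite Rmult_assoc Rinv_l in HN0; lra. }
  pose proof (JV_fourth_norm_limit n r theta n_odd n_gt1 n_sqf ltac:(nra) Hl7) as Hlim.
  fold C in Hlim; fold (JV_poly n r).
  unfold merit_factor, f_lim, f_base; rewrite normpow_2_JV; [|easy|easy|easy].
  set (D := / 6 + 8 * (Rabs (r + IZR (floorZ (/ 2 - r))) - / 4) ^ 2) in *.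
  set (G := normpow n (JV_poly n r) 4 / INR n ^ 2) in *.
  assert (HD : / 6 <= D).
  { unfold D; pose proof (pow2_ge_0 (Rabs (r + IZR (floorZ (/ 2 - r))) - / 4)); lra. }
  assert (HG := proj1 (Rabs_le_between _ _) Hlim).
  assert (HGp : / 12 <= G - 1) by lra.
  replace (INR n ^ 2 / (normpow n (JV_poly n r) 4 - INR n ^ 2)) with (/ (G - 1)); last first.
  { replace (normpow n (JV_poly n r) 4) with (G * INR n ^ 2) by (unfold G; field; lra).
    field; split; [|lra]. replace (G * INR n ^ 2 - INR n ^ 2) with ((G - 1) * INR n ^ 2) by ring.
    apply Rgt_not_eq, Rmult_lt_0_compat; [lra|now apply pow_lt]. }
  replace (/ (G - 1) - / D) with ((D - (G - 1)) * (/ (G - 1) * / D)) by (field; lra).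
  rewrite Rabs_mult (Rabs_minus_sym D).
  assert (H1 : 0 < / (G - 1) <= 12).
  { split; [apply Rinv_0_lt_compat; lra|]. rewrite -(Rinv_inv 12); apply Rinv_le_contravar; lra. }
  assert (H2 : 0 < / D <= 6).
  { split; [apply Rinv_0_lt_compat; lra|]. rewrite -(Rinv_inv 6); apply Rinv_le_contravar; lra. }
  rewrite (Rabs_pos_eq (/ (G - 1) * / D)); [|nra].
  apply Rle_lt_trans with (C * theta * 72); [|lra].
  apply Rmult_le_compat; [apply Rabs_pos|nra|easy|nra].
Qed.
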